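(* Let $\Omega\subseteq\mathbb{C}$ be open and let $P(z)$, $z\in\Omega$, be a holomorphic family of (classical) pseudodifferential operators on the noncommutative torus $\mathbb{T}^n_\theta$, of order $w(z)$ (with $w$ holomorphic on $\Omega$). Then: (1) $P(z)$, $z\in\Omega$, is a holomorphic family in $\mathscr{L}(C^\infty(\mathbb{T}^n_\theta))$. (2) If $m\in\mathbb{R}$ and $\Re w(z)\le m$ on $\Omega$, then $P(z)$, $z\in\Omega$, is a holomorphic family in $\mathscr{L}(W_2^{s+m}(\mathbb{T}^n_\theta),W_2^{s}(\mathbb{T}^n_\theta))$ for all $s\in\mathbb{R}$. (3) If $m<0$ and $\Re w(z)<m$ (resp., $\Re w(z)\le m$) on $\Omega$, then $P(z)$, $z\in\Omega$, is a holomorphic family in $\mathscr{L}_p$ (resp., $\mathscr{L}_{p,\infty}$) with $p=n|m|^{-1}$.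
   Context: Noncommutative torus. Let $n\ge 2$ and let $\theta=(\theta_{jk})$ be a real antisymmetric $n\times n$ matrix. $C(\mathbb{T}^n_\theta)$ is the universal $C^*$-algebra (norm $\|\cdot\|$) generated by unitaries $U_1,\dots,U_n$ with $U_kU_j=e^{2i\pi\theta_{jk}}U_jU_k$. Put $U^k=U_1^{k_1}\cdots U_n^{k_n}$, $k\in\mathbb{Z}^n$. $\tau$ is the trace with $\tau(U^k)=1$ if $k=0$ and $0$ otherwise. $L_2(\mathbb{T}^n_\theta)$ is the Hilbert space completion for $(u|v)=\tau(uv^* )$; $(U^k)_{k}$ is an orthonormal basis, and $C(\mathbb{T}^n_\theta)$ acts by left multiplication. $C^\infty(\mathbb{T}^n_\theta)=\{\sum_k u_kU^k:\ (u_k)\text{ rapidly decaying}\}$ is a Fréchet $*$-algebra with semi-norms $\|\delta^\beta u\|$, where $\delta_1,\dots,\delta_n$ are the derivations with $\delta_j(U^k)=k_jU^k$ and $\delta^\beta=\delta_1^{\beta_1}\cdots\delta_n^{\beta_n}$. $\mathscr{D}'(\mathbb{T}^n_\theta)$ is its topological dual; $u\in\mathscr{D}'$ has Fourier coefficients $u_k=\langle u,(U^k)^*\rangle$, and $C^\infty\subset L_2\subset\mathscr{D}'$ via $\langle u,v\rangle=\tau(uv)$. For $s\in\mathbb{R}$, $W_2^s(\mathbb{T}^n_\theta)=\{u\in\mathscr{D}':\ \sum_k(1+|k|^2)^s|u_k|^2<\infty\}$ with its Hilbert norm. $\mathscr{L}(E,F)$ is the space of continuous linear maps, $\mathscr{L}(E)=\mathscr{L}(E,E)$,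 with the topology of uniform convergence on bounded sets. Symbols and operators. $C^\infty(\mathbb{T}^n_\theta\times V)$ denotes the Fréchet space $C^\infty(V;C^\infty(\mathbb{T}^n_\theta))$ for $V\subseteq\mathbb{R}^n$ open. For $q\in\mathbb{C}$, $S_q(\mathbb{T}^n_\theta\times\mathbb{R}^n)$ is the space of $\rho\in C^\infty(\mathbb{T}^n_\theta\times(\mathbb{R}^n\setminus0))$ with $\rho(t\xi)=t^q\rho(\xi)$ for $t>0$. $S^q(\mathbb{T}^n_\theta\times\mathbb{R}^n)$ (classical symbols) consists of $\rho\in C^\infty(\mathbb{T}^n_\theta\times\mathbb{R}^n)$ for which there are $\rho_{q-j}\in S_{q-j}$, $j\ge0$, such that for all $N,\alpha,\beta$ there is $C$ with $\|\delta^\alpha\partial_\xi^\beta(\rho-\sum_{j<N}\rho_{q-j})(\xi)\|\le C|\xi|^{\Re q-N-|\beta|}$ for $|\xi|\ge1$. The operator with symbol $\rho$ is $P_\rho(\sum_ku_kU^k)=\sum_ku_k\rho(k)U^k$ on $C^\infty(\mathbb{T}^n_\theta)$; it extends to the Sobolev spaces. $\Psi^q(\mathbb{T}^n_\theta)=\{P_\rho:\rho\in S^q\}$. Holomorphic families. A map $u:\Omega\to E$ into a topological vector space is holomorphic (a holomorphic family in $E$) if $\lim_{z\to z_0}(u(z)-u(z_0))/(z-z_0)$ exists in $E$ for every $z_0\in\Omega$. A family $\rho(z)$, $z\in\Omega$, of classical symbols is holomorphic of order $w(z)$ if: (i) $w$ is holomorphic on $\Omega$ and $\rho(z)\in S^{w(z)}$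 for all $z$; (ii) $\rho(z)$ is a holomorphic family in $C^\infty(\mathbb{T}^n_\theta\times\mathbb{R}^n)$; (iii) there are $\rho_j(z)\in S_{w(z)-j}$ such that for all $N\ge0$, compact $K\subseteq\Omega$ and $\alpha,\beta$ there is $C$ with $\|\delta^\alpha\partial_\xi^\beta(\rho(z)-\sum_{j<N}\rho_j(z))(\xi)\|\le C|\xi|^{\Re w(z)-N-|\beta|}$ for all $z\in K$, $|\xi|\ge1$. A holomorphic family of pseudodifferential operators of order $w(z)$ is a family $P(z)=P_{\rho(z)}$ with $\rho(z)$ such a family. Schatten classes. For compact $T$ on $L_2(\mathbb{T}^n_\theta)$ with singular values $\mu_0(T)\ge\mu_1(T)\ge\cdots$ and $p>0$: $\mathscr{L}_p=\{T:\sum_j\mu_j(T)^p<\infty\}$ with quasi-norm $(\sum\mu_j(T)^p)^{1/p}$, and $\mathscr{L}_{p,\infty}=\{T:\mu_j(T)=O(j^{-1/p})\}$ with quasi-norm $\sup_j(j+1)^{1/p}\mu_j(T)$. *)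

(* Defs.v *)
From HB Require Import structures.
Set Warnings "-all".
From mathcomp Require Import all_boot all_order all_algebra finmap complex.
From mathcomp Require Import all_classical all_reals all_analysis.

Set Implicit Arguments.
Unset Strict Implicit.
Unset Printing Implicit Defensive.

Import Order.TTheory GRing.Theory Num.Theory.
Import numFieldNormedType.Exports.

Local Open Scope classical_set_scope.
Local Open Scope ring_scope.

(* R[i] gets the topology of its modulus, as a normed module over itself. *)
#[non_forgetful_inheritance]
HB.instance Definition _ (R : realType) := NormedModule.copy R[i] R[i]^o.

(* In a normed module over R[i], `|x| lives in R[i]; [nrm] is the same number
   as an element of R. *)
Definition nrm (R : realType) (V : normedModType R[i]) (x : V) : R :=
  complex.Re `|x|.

(* e^{it} *)
Definition expi (R : realType) (t : R) : R[i] := Complex (cos t) (sin t).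

(* t^q for t > 0 and complex q *)
Definition cpow (R : realType) (t : R) (q : R[i]) : R[i] :=
  (expR (complex.Re q * ln t))%:C%C * expi (complex.Im q * ln t).

(* Euclidean norm (the library norm on 'rV[R]_n is the sup norm) *)
Definition enorm (R : realType) n (x : 'rV[R]_n) : R :=
  Num.sqrt (\sum_(j < n) (x ord0 j) ^+ 2).

Definition zvec (R : realType) n (k : 'rV[int]_n) : 'rV[R]_n :=
  map_mx intr k.

HB.mixin Record isHilbert (R : realType) (H : Type)
    of CompleteNormedModule R[i] H := {
  hdot : H -> H -> R[i] ;
  hdotDl : forall x y z, hdot (x + y) z = hdot x z + hdot y z ;
  hdotZl : forall (a : R[i]) x y, hdot (a *: x) y = a * hdot x y ;
  hdotC : forall x y, hdot x y = (hdot y x)^* ;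
  hdot_norm : forall x, hdot x x = `|x| ^+ 2 }.

#[short(type="hilbertType")]
HB.structure Definition Hilbert (R : realType) :=
  {H of isHilbert R H & CompleteNormedModule R[i] H}.

(* Unital C^*-algebras.  The product is not the one of [GRing.Algebra]:
   Hierarchy Builder does not allow a join of that structure with
   [NormedModule] besides [Num.NumDomain]. *)
HB.mixin Record isCStar (R : realType) (A : Type)
    of CompleteNormedModule R[i] A := {
  cmul : A -> A -> A ;
  cone : A ;
  star : A -> A ;
  cmulA : associative cmul ;
  cmul1x : left_id cone cmul ;
  cmulx1 : right_id cone cmul ;
  cmulDl : forall x y z, cmul (x + y) z = cmul x z + cmul y z ;
  cmulDr : forall x y z, cmul x (y + z) = cmul x y + cmul x z ;
  cmulZl : forall (a : R[i]) x y, cmul (a *: x) y = a *: cmul x y ;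
  cmulZr : forall (a : R[i]) x y, cmul x (a *: y) = a *: cmul x y ;
  starK : involutive star ;
  starD : forall x y, star (x + y) = star x + star y ;
  starZ : forall (a : R[i]) x, star (a *: x) = a^* *: star x ;
  starM : forall x y, star (cmul x y) = cmul (star y) (star x) ;
  cstar_normM : forall x y, `|cmul x y| <= `|x| * `|y| ;
  cstar_norm : forall x, `|cmul (star x) x| = `|x| ^+ 2 }.

#[short(type="cstarType")]
HB.structure Definition CStar (R : realType) :=
  {A of isCStar R A & CompleteNormedModule R[i] A}.

Infix "**" := cmul (at level 40, left associativity) : ring_scope.

(* A topological vector space, presented as a linear subspace [gdom] of an
   ambient module, with the topology generated by a family of [0, +oo]-valued
   gauges (seminorms, or one quasi-norm).  Gauges are only meaningful on
   [gdom].  A map defined on a subspace D is represented by its extension by 0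
   outside D, so that it corresponds to exactly one function. *)
Record gauged (R : realType) := Gauged {
  gvec :> lmodType R[i] ;
  gdom : set gvec ;
  gauges : set (gvec -> \bar R) }.

Arguments gdom {R} E _ : rename.
Arguments gauges {R} E _ : rename.

Section Gauged.
Variable R : realType.
Implicit Types E F : gauged R.

Definition gnbhs E (x : E) : set_system E :=
  [set V | exists G : set (E -> \bar R), exists e : R,
     [/\ finite_set G, G `<=` gauges E, 0 < e &
       [set y | forall p, G p -> (p (y - x)%R < e%:E)%E] `<=` V]].

Definition gcontinuous E F (T : E -> F) :=
  forall x, gdom E x ->
    (T @ within (gdom E) (gnbhs x)) --> gnbhs (T x).

Definition gbounded E (B : set E) :=
  B `<=` gdom E /\
  forall p, gauges E p -> exists M : R, forall x, B x -> (p x <= M%:E)%E.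

(* continuous linear maps, with uniform convergence on bounded sets *)
Definition Lin E F : gauged R := @Gauged R (E -> F)
  [set T | [/\ forall x, gdom E x -> gdom F (T x),
             forall (a : R[i]) x y, gdom E x -> gdom E y ->
               T (a *: x + y) = a *: T x + T y,
             gcontinuous T &
             forall x, ~ gdom E x -> T x = 0]]
  [set g | exists B : set E, exists q : F -> \bar R,
     [/\ gbounded B, gauges F q &
       g = fun T => ereal_sup [set q (T x) | x in B]]].

Definition scalars : gauged R :=
  @Gauged R (R[i]^o) setT [set (fun x : R[i]^o => (nrm x)%:E)].

Definition holomorphic (Om : set R[i]) E (u : R[i] -> E) :=
  (forall z, Om z -> gdom E (u z)) /\
  forall z0, Om z0 -> exists2 l : E, gdom E l &
    ((fun z => (z - z0)^-1 *: (u z - u z0)) @ z0^') --> gnbhs l.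

(* D_1^{b_1} ... D_n^{b_n} x *)
Definition multi_iter n (X : Type) (D : 'I_n -> X -> X) (b : 'I_n -> nat)
    (x : X) : X :=
  foldr (fun j y => iter (b j) (D j) y) x (enum 'I_n).

Section Smooth.
Variables (n : nat) (E : gauged R).
Implicit Types f : 'rV[R]_n -> E.

Definition is_pderiv f (j : 'I_n) (x : 'rV[R]_n) (l : E) :=
  gdom E l /\
  ((fun h : R => (h^-1)%:C%C *: (f (x + h *: delta_mx ord0 j) - f x)) @ 0^')
    --> gnbhs l.

Definition pderiv (j : 'I_n) f : 'rV[R]_n -> E :=
  fun x => xget 0 [set l | is_pderiv f j x l].

Fixpoint Ck (V : set 'rV[R]_n) (k : nat) f : Prop :=
  (forall x, V x -> gdom E (f x) /\ (f @ x --> gnbhs (f x))) /\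
  (if k is k'.+1 then
     forall j, (forall x, V x -> exists l, is_pderiv f j x l) /\
       Ck V k' (pderiv j f)
   else True).

Definition Csmooth (V : set 'rV[R]_n) : gauged R :=
  @Gauged R ('rV[R]_n -> E)
  [set f | (forall k, Ck V k f) /\ (forall x, ~ V x -> f x = 0)]
  [set g | exists K : set 'rV[R]_n, exists b : 'I_n -> nat,
     exists p : E -> \bar R,
     [/\ compact K, K `<=` V, gauges E p &
       g = fun f => ereal_sup [set p (multi_iter pderiv b f x) | x in K]]].

End Smooth.

End Gauged.

Section Torus.
Variable R : realType.

Definition zpow (A : cstarType R) (u : A) (m : int) : A :=
  match m with Posz p => iter p (cmul u) cone | Negz p => iter p.+1 (cmul (star u)) cone end.

(* U^k = U_1^{k_1} ... U_n^{k_n}, for unitaries U_j (so that U_j^{-1} = U_j^* ) *)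
Definition mono (A : cstarType R) n (U : 'I_n -> A) (k : 'rV[int]_n) : A :=
  \big[cmul/cone]_(j < n) zpow (U j) (k ord0 j).

Definition nc_relations n (theta : 'M[R]_n) (A : cstarType R)
    (U : 'I_n -> A) :=
  (forall j, star (U j) ** U j = cone /\ U j ** star (U j) = cone) /\
  forall j k, U k ** U j = expi (2 * pi * theta j k) *: (U j ** U k).

Definition star_hom (A B : cstarType R) (phi : A -> B) :=
  [/\ forall (a : R[i]) x y, phi (a *: x + y) = a *: phi x + phi y,
      forall x y, phi (x ** y) = phi x ** phi y,
      phi cone = cone &
      forall x, phi (star x) = star (phi x)].

Definition cstar_generates (A : cstarType R) n (U : 'I_n -> A) :=
  forall S : set A, closed S ->
    S cone ->
    (forall (a : R[i]) x y, S x -> S y -> S (a *: x + y)) ->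
    (forall x y, S x -> S y -> S (x ** y)) ->
    (forall x, S x -> S (star x)) ->
    (forall j, S (U j)) ->
    S = setT.

(* The universal C^*-algebra C(T_theta), its canonical trace, and the Hilbert
   space completion L_2(T_theta). All of these are determined by theta up to
   unique isomorphism. *)
Record nctorus n (theta : 'M[R]_n) := NCTorus {
  nc_alg :> cstarType R ;
  nc_gen : 'I_n -> nc_alg ;
  nc_rel : nc_relations theta nc_gen ;
  nc_generated : cstar_generates nc_gen ;
  nc_universal : forall (B : cstarType R) (V : 'I_n -> B),
    nc_relations theta V ->
    exists2 phi : nc_alg -> B, star_hom phi & forall j, phi (nc_gen j) = V j ;
  nc_tr : nc_alg -> R[i] ;
  nc_tr_linear : forall (a : R[i]) x y,
    nc_tr (a *: x + y) = a * nc_tr x + nc_tr y ;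
  nc_tr_norm : forall x, `|nc_tr x| <= `|x| ;
  nc_tr_pos : forall x, 0 <= nc_tr (x ** star x) ;
  nc_tr_tracial : forall x y, nc_tr (x ** y) = nc_tr (y ** x) ;
  nc_tr_mono : forall k, nc_tr (mono nc_gen k) = (k == 0)%:R ;
  nc_L2 : hilbertType R ;
  nc_emb : nc_alg -> nc_L2 ;
  nc_emb_linear : forall (a : R[i]) x y,
    nc_emb (a *: x + y) = a *: nc_emb x + nc_emb y ;
  nc_emb_dot : forall x y, hdot (nc_emb x) (nc_emb y) = nc_tr (x ** star y) ;
  nc_emb_dense : closure (range nc_emb) = setT }.

Variables (n : nat) (theta : 'M[R]_n) (T : nctorus theta).

Local Notation Zn := 'rV[int]_n.
Local Notation "U^ k" := (mono (@nc_gen n theta T) k) (at level 1, k at level 1).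

(* finite subsets of Z^n directed by inclusion: unconditional summation *)
Definition zfilter : set_system {fset Zn} :=
  [set Q | exists J : {fset Zn}, forall K : {fset Zn}, fsubset J K -> Q K].

Definition zsums_to (f : Zn -> T) (a : T) :=
  ((fun K : {fset Zn} => \sum_(k <- K) f k) @ zfilter) --> a.

Definition zsum (f : Zn -> T) : T := xget 0 [set a | zsums_to f a].

Definition rapidly_decaying (u : Zn -> R[i]) :=
  forall N : nat, exists c : R, forall k,
    (1 + enorm (zvec R k)) ^+ N * nrm (u k) <= c.

Definition is_Cinf : set T :=
  [set a | exists2 u : Zn -> R[i], rapidly_decaying u &
                                   zsums_to (fun k => u k *: U^ k) a].

(* the coefficients u_k of a = \sum_k u_k U^k *)
Definition coef (a : T) (k : Zn) : R[i] := nc_tr (a ** star (U^ k)).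

Definition delta (j : 'I_n) (a : T) : T :=
  zsum (fun k => ((k ord0 j)%:~R * coef a k) *: U^ k).

Definition Cinf : gauged R := @Gauged R T is_Cinf
  [set p | exists b : 'I_n -> nat,
     p = fun a => (nrm (multi_iter delta b a))%:E].

(* D'(T_theta) is the domain of [Lin Cinf scalars] *)
Definition distr : gauged R := Lin Cinf (scalars R).

Definition fourier (u : distr) (k : Zn) : R[i] := u (star (U^ k)).

(* the inclusion of C^oo in D', <a, v> = tau (a v) *)
Definition distr_of (a : T) : distr :=
  patch (fun=> 0) is_Cinf (fun v => nc_tr (a ** v)).

Definition sobolev_sq (s : R) (u : distr) : \bar R :=
  (\esum_(k in [set: Zn])
    (((1 + enorm (zvec R k) ^+ 2) `^ s) * nrm (fourier u k) ^+ 2)%:E)%E.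

Definition sobolev (s : R) : gauged R := @Gauged R distr
  [set u | gdom distr u /\ (sobolev_sq s u < +oo)%E]
  [set (fun u => (sobolev_sq s u `^ 2^-1)%E)].

Definition homogeneous_symbol (q : R[i]) (rho : 'rV[R]_n -> T) :=
  gdom (Csmooth Cinf (~` [set 0])) rho /\
  forall (t : R) xi, 0 < t -> xi != 0 -> rho (t *: xi) = cpow t q *: rho xi.

(* || delta^a d_xi^b (rho - \sum_(j < N) rhoj_j)(xi) || *)
Definition remainder_norm (rho : 'rV[R]_n -> T) (rhoj : nat -> 'rV[R]_n -> T)
    (N : nat) (a b : 'I_n -> nat) (xi : 'rV[R]_n) : R :=
  nrm (multi_iter delta a
    (multi_iter (@pderiv R n Cinf) b
      (fun eta => rho eta - \sum_(j < N) rhoj j eta) xi)).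

Definition order_bound (m : R) (N : nat) (b : 'I_n -> nat)
    (xi : 'rV[R]_n) : R :=
  enorm xi `^ (m - N%:R - (\sum_(j < n) b j)%N%:R).

Definition classical_symbol (q : R[i]) (rho : 'rV[R]_n -> T) :=
  gdom (Csmooth Cinf [set: 'rV[R]_n]) rho /\
  exists rhoj : nat -> 'rV[R]_n -> T,
    (forall j, homogeneous_symbol (q - j%:R) (rhoj j)) /\
    forall (N : nat) (a b : 'I_n -> nat), exists c : R,
      forall xi, 1 <= enorm xi ->
        remainder_norm rho rhoj N a b xi
          <= c * order_bound (complex.Re q) N b xi.

Definition holomorphic_symbols (Om : set R[i]) (w : R[i] -> R[i])
    (rho : R[i] -> 'rV[R]_n -> T) :=
  [/\ @holomorphic R Om (scalars R) w,
      forall z, Om z -> classical_symbol (w z) (rho z),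
      @holomorphic R Om (Csmooth Cinf [set: 'rV[R]_n]) rho &
      exists rhoj : nat -> R[i] -> 'rV[R]_n -> T,
        (forall j z, Om z -> homogeneous_symbol (w z - j%:R) (rhoj j z)) /\
        forall (N : nat) (K : set R[i]) (a b : 'I_n -> nat),
          compact K -> K `<=` Om ->
          exists c : R, forall z xi, K z -> 1 <= enorm xi ->
            remainder_norm (rho z) (fun j => rhoj j z) N a b xi
              <= c * order_bound (complex.Re (w z)) N b xi].

(* P_rho (\sum_k u_k U^k) = \sum_k u_k rho(k) U^k on C^oo *)
Definition psido (rho : 'rV[R]_n -> T) : T -> T :=
  patch (fun=> 0) is_Cinf
    (fun a => zsum (fun k => coef a k *: (rho (zvec R k) ** U^ k))).

Definition holomorphic_psidos (Om : set R[i]) (w : R[i] -> R[i])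
    (P : R[i] -> T -> T) :=
  exists2 rho, holomorphic_symbols Om w rho &
               forall z, Om z -> P z = psido (rho z).

End Torus.

Section Schatten.
Variables (R : realType) (H : hilbertType R).
Implicit Types (T : H -> H) (mu : nat -> R).

Definition compact_op T :=
  [/\ forall (a : R[i]) x y, T (a *: x + y) = a *: T x + T y,
      continuous T &
      precompact (T @` [set x | `|x| <= 1])].

(* x lies in the kernel of T^* T - l^2, i.e. of |T| - l when l >= 0; stated
   weakly: (T x | T y) = l^2 (x | y) for all y. *)
Definition abs_eigen T (l : R) : set H :=
  [set x | forall y, hdot (T x) (T y) = (l ^+ 2)%:C%C * hdot x y].

(* mu lists the positive eigenvalues of |T| with multiplicity, in nonincreasing
   order, followed by zeros when there are only finitely many: the e_j with
   mu_j = l form an orthonormal basis of ker (|T| - l), for every l > 0. *)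
Definition is_singular_values T mu :=
  [/\ forall j, 0 <= mu j,
      forall i j, (i <= j)%N -> mu j <= mu i &
      exists e : nat -> H,
        [/\ forall i j, 0 < mu i -> 0 < mu j ->
              hdot (e i) (e j) = (i == j)%:R,
            forall j, 0 < mu j -> abs_eigen T (mu j) (e j) &
            forall l x, 0 < l -> abs_eigen T l x ->
              exists N : nat, exists c : nat -> R[i],
                x = \sum_(j < N | mu j == l) c j *: e j]].

(* such a sequence exists and is unique when T is compact *)
Definition singular_value T : nat -> R :=
  xget (fun=> 0) [set mu | is_singular_values T mu].

Definition schatten_sum (p : R) T : \bar R :=
  (\sum_(0 <= j <oo) ((singular_value T j) `^ p)%:E)%E.

Definition schatten (p : R) : gauged R := @Gauged R (H -> H)
  [set T | compact_op T /\ (schatten_sum p T < +oo)%E]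
  [set (fun T => (schatten_sum p T `^ p^-1)%E)].

Definition weak_schatten (p : R) : gauged R := @Gauged R (H -> H)
  [set T | compact_op T /\ exists c : R, forall j, (0 < j)%N ->
     singular_value T j <= c * j%:R `^ (- p^-1)]
  [set (fun T => ereal_sup
     [set ((j.+1%:R `^ p^-1) * singular_value T j)%:E | j in [set: nat]])].

End Schatten.

(* Main.v *)
Require Import Defs.
Set Warnings "-all".
From mathcomp Require Import all_boot all_order all_algebra finmap complex.
From mathcomp Require Import all_classical all_reals all_analysis.
From mathcomp Require Import zify ring lra.

Import Order.TTheory GRing.Theory Num.Theory.
Import numFieldNormedType.Exports.
Local Open Scope classical_set_scope.
Local Open Scope ring_scope.

Set Implicit Arguments.
Unset Strict Implicit.
Unset Printing Implicit Defensive.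

(* Only the values of a symbol on Z^n enter its operator, which acts on Fourier
   coefficients by the matrix with entries (S(k) U^k)_r; when S has order m, this
   matrix is O(|r - k|^-N |k|^m) for every N, and by Schur's test the operator
   norms are bounded by finitely many of these constants.  The values rho(z)(k)
   are holomorphic in z with symbol bounds uniform on compact sets, so Cauchy's
   estimate bounds the second-order Taylor remainder in z in the same symbol
   seminorms; the operator of the derived symbol is then the derivative of the
   family, whatever the topology.  For the Schatten classes, the operator
   is O(L^m) on the orthogonal complement of the (2L + 1)^n monomials with all
   |k_j| <= L, so the min-max principle gives mu_j = O(j^(m/n)); under the strict
   inequality, Re w stays below some m' < m near each point and the series
   of the mu_j^p converges. *)

(** Holomorphy in the space of smooth symbols controls difference quotients in z only for xi in
    compact sets, while the expansion estimates bound rho(z) at infinity but say nothing of its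
    derivative in z. Cauchy's estimate closes this gap because it is linear in the bound: each
    Fourier coefficient of rho(z)(k) is a scalar function of z, bounded near z0 by a constant times
    a weight in k and in the index, and its derivative and Taylor remainder inherit that weight.
    Hence only scalar functions of z are ever integrated.

    Contour integrals are replaced by real primitives along horizontal and vertical segments. In the
    coordinate s = log (z - z0) a circle becomes a vertical segment and an annulus becomes a
    rectangle, to which Goursat's bisection applies.

    The weights are powers of 1 + |k|^2, so that order m appears as the exponent m / 2. In (1) there
    is no global bound on Re w; near z0 the order Re w(z0) + 1 is used. *)

Section Nrm.
Variable R : realType.

Lemma nrmE (V : normedModType R[i]) (x : V) : (nrm x)%:C%C = `|x|.
Proof. by rewrite /nrm; apply/RRe_real/ger0_real. Qed.

Lemma nrm_ge0 (V : normedModType R[i]) (x : V) : 0 <= nrm x.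
Proof. by rewrite -lecR nrmE normr_ge0. Qed.

Lemma nrm_eq0 (V : normedModType R[i]) (x : V) : (nrm x == 0) = (x == 0).
Proof. by rewrite -[RHS]normr_eq0 -nrmE -(inj_eq (@complexI R)). Qed.

Lemma nrm0 (V : normedModType R[i]) : nrm (0 : V) = 0.
Proof. by apply/eqP; rewrite nrm_eq0. Qed.

Lemma nrmD (V : normedModType R[i]) (x y : V) : nrm (x + y) <= nrm x + nrm y.
Proof. by rewrite -lecR rmorphD /= !nrmE ler_normD. Qed.

Lemma nrmN (V : normedModType R[i]) (x : V) : nrm (- x) = nrm x.
Proof. by rewrite /nrm normrN. Qed.

Lemma nrm_sub (V : normedModType R[i]) (x y : V) : nrm (x - y) = nrm (y - x).
Proof. by rewrite -nrmN opprB. Qed.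

Lemma nrmB (V : normedModType R[i]) (x y : V) : nrm (x - y) <= nrm x + nrm y.
Proof. by rewrite -(nrmN y) nrmD. Qed.

Lemma nrm_sum (V : normedModType R[i]) I (r : seq I) (P : pred I) (F : I -> V) :
  nrm (\sum_(i <- r | P i) F i) <= \sum_(i <- r | P i) nrm (F i).
Proof.
elim/big_rec2: _ => [|i y x _ h]; first by rewrite nrm0.
by apply: (le_trans (nrmD _ _)); rewrite lerD2l.
Qed.

Lemma nrmZ (V : normedModType R[i]) (a : R[i]) (x : V) :
  nrm (a *: x) = nrm a * nrm x.
Proof. by apply: (@complexI R); rewrite rmorphM /= !nrmE normrZ. Qed.

Lemma nrmM (a b : R[i]) : nrm (a * b) = nrm a * nrm b.
Proof. by apply: (@complexI R); rewrite rmorphM /= !nrmE normrM. Qed.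

Lemma nrmV (a : R[i]) : nrm a^-1 = (nrm a)^-1.
Proof. by apply: (@complexI R); rewrite fmorphV /= !nrmE normfV. Qed.

Lemma nrm_real (x : R) : nrm (x%:C%C) = `|x|.
Proof. by apply: (@complexI R); rewrite nrmE normc_def /= expr0n addr0 sqrtr_sqr. Qed.

Lemma nrm_sqrE (z : R[i]) : nrm z ^+ 2 = complex.Re z ^+ 2 + complex.Im z ^+ 2.
Proof.
case: z => x y; rewrite /nrm normc_def /= sqr_sqrtr // addr_ge0 ?sqr_ge0 //.
Qed.

Lemma abs_Re_le (z : R[i]) : `|complex.Re z| <= nrm z.
Proof.
rewrite -(ler_pXn2r (ltn0Sn 1)) ?nnegrE ?nrm_ge0 //.
by rewrite real_normK ?num_real // nrm_sqrE lerDl sqr_ge0.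
Qed.

Lemma abs_Im_le (z : R[i]) : `|complex.Im z| <= nrm z.
Proof.
rewrite -(ler_pXn2r (ltn0Sn 1)) ?nnegrE ?nrm_ge0 //.
by rewrite real_normK ?num_real // nrm_sqrE lerDr sqr_ge0.
Qed.

Lemma nrm_le_ReIm (z : R[i]) : nrm z <= `|complex.Re z| + `|complex.Im z|.
Proof.
rewrite -(ler_pXn2r (ltn0Sn 1)) ?nnegrE ?nrm_ge0 ?addr_ge0 //.
rewrite nrm_sqrE sqrrD !real_normK ?num_real //.
by rewrite lerD2r lerDl mulrn_wge0 ?mulr_ge0.
Qed.

Lemma nrm_lt (V : normedModType R[i]) (x : V) (e : R) : (`|x| < e%:C%C) = (nrm x < e).
Proof. by rewrite -nrmE ltcR. Qed.

Lemma nrm_le (V : normedModType R[i]) (x : V) (e : R) : (`|x| <= e%:C%C) = (nrm x <= e).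
Proof. by rewrite -nrmE lecR. Qed.

Lemma pos_complexP (e : R[i]) : 0 < e -> exists2 d : R, 0 < d & e = d%:C%C.
Proof.
move=> e0; exists (complex.Re e); last by rewrite RRe_real // gtr0_real.
by rewrite -ltcR RRe_real // gtr0_real.
Qed.

Lemma cvg_nrmP (V : normedModType R[i]) (T : Type) (F : set_system T)
    {FF : Filter F} (f : T -> V) (a : V) :
  (f @ F --> a) <-> (forall e : R, 0 < e -> \forall t \near F, nrm (f t - a) < e).
Proof.
split=> [/cvgrPdist_lt h e e0|h].
  have := h e%:C%C; rewrite ltcR => /(_ e0).
  by apply: filterS => t; rewrite nrm_lt nrm_sub.
apply/cvgrPdist_lt => e /pos_complexP[d d0 ->].
by apply: filterS (h d d0) => t; rewrite nrm_lt nrm_sub.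
Qed.

Lemma nbhs_nrmP (V : normedModType R[i]) (x : V) (A : set V) :
  nbhs x A <-> exists2 d : R, 0 < d & forall y, nrm (y - x) < d -> A y.
Proof.
split=> [/nbhs_normP[_/=/pos_complexP[d d0 ->]] h|[d d0 h]].
  by exists d => // y hy; apply: h => /=; rewrite nrm_lt nrm_sub.
apply/nbhs_normP; exists d%:C%C => /=; first by rewrite ltcR.
by move=> y /=; rewrite nrm_lt nrm_sub; exact: h.
Qed.

Lemma dnbhs_nrmP (x : R[i]) (A : set R[i]) :
  x^' A <-> exists2 d : R, 0 < d & forall y, nrm (y - x) < d -> y != x -> A y.
Proof.
split=> [/nbhs_nrmP[d d0 h]|[d d0 h]]; first by exists d => // y yd yx; exact: h.
by apply/nbhs_nrmP; exists d.
Qed.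

Lemma nrm_cst1 : nrm (1 : R[i]) = 1.
Proof. by rewrite (_ : 1 = 1%:C%C) // nrm_real normr1. Qed.

Lemma cvg_nrm (V : normedModType R[i]) (X : Type) (F : set_system X) (f : X -> V) (a : V) :
  Filter F -> f @ F --> a -> (fun z => nrm (f z)) @ F --> nrm a.
Proof.
move=> FF /cvg_nrmP h; apply/cvgrPdist_lt => e e0.
apply: filterS (h e e0) => z; apply: le_lt_trans.
rewrite ler_norml; have := nrmD (f z - a) a; rewrite subrK.
have := nrmD (a - f z) (f z); rewrite subrK (nrm_sub a); lra.
Qed.

End Nrm.

(** * Cauchy's estimate *)

Section RealDerivatives.
Variable R : realType.
Implicit Types (x y t l : R).

(** Without division by [h] the increment [h = 0] is allowed, and such remainders can be added and
    composed directly; [cdiff] has the same form. *)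
Lemma is_derive_epsP (G : R -> R) x l :
  is_derive x 1 G l <->
  forall e : R, 0 < e -> exists2 d : R, 0 < d &
    forall h, `|h| < d -> `|G (x + h) - G x - l * h| <= e * `|h|.
Proof.
split=> [|H].
  move=> [dG <-] e e0.
  have /cvgrPdist_le/(_ e e0)/nbhs_normP[d /= d0 hd] := dG.
  exists d => // h hlt; have [->|h0] := eqVneq h 0.
    by rewrite addr0 subrr mulr0 subr0 normr0 mulr0.
  have := hd h; rewrite /= sub0r normrN => /(_ hlt h0).
  rewrite -[_%:A]/(h * 1) mulr1 [h + x]addrC => hb.
  have -> : G (x + h) - G x - 'D_1 G x * h
      = - (h * ('D_1 G x - h^-1 * (G (x + h) - G x))).
    by rewrite mulrBr mulrA divff // mul1r opprB mulrC addrC addrA; ring.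
  by rewrite normrN normrM mulrC ler_wpM2r.
have key : (h^-1 *: ((G \o shift x) (h *: 1) - G x)) @[h --> (0 : R)^'] --> l.
  apply/cvgrPdist_le => e e0; have [d d0 hd] := H e e0.
  apply/nbhs_normP; exists d => //= h; rewrite /= sub0r normrN => hlt h0.
  have := hd h hlt; rewrite -[_%:A]/(h * 1) mulr1 [h + x]addrC.
  have -> : l - h^-1 *: (G (x + h) - G x) = - (h^-1 * (G (x + h) - G x - l * h)).
    by rewrite mulrBr mulrCA mulVf // mulr1 opprB.
  rewrite normrN normrM normfV => hb.
  by rewrite mulrC ler_pdivrMr ?normr_gt0.
by apply: DeriveDef; [apply/cvg_ex; exists l|exact/cvg_lim].
Qed.

Lemma derive_bound (G g : R -> R) (a b K : R) : a <= b ->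
  (forall t, a <= t <= b -> is_derive t 1 G (g t)) ->
  (forall t, a <= t <= b -> `|g t| <= K) -> `|G b - G a| <= K * (b - a).
Proof.
move=> ab dG gK.
have [||c] := @MVT_segment _ G g _ _ ab.
- by move=> t /[!in_itv]/= /andP[/ltW ? /ltW ?]; apply: dG; apply/andP.
- apply: derivable_within_continuous => t /[!in_itv]/= tab.
  exact: (ex_derive (is_derive := dG t tab)).
by rewrite in_itv /= => cab ->; rewrite normrM (ger0_norm (x := b - a)) ?subr_ge0 //
  ler_wpM2r ?subr_ge0 ?gK.
Qed.

Lemma primitive_exists (f : R -> R) (A B : R) : A <= B ->
  (forall x, A <= x <= B -> {for x, continuous f}) ->
  exists G : R -> R, forall x, A <= x <= B -> is_derive x 1 G (f x).
Proof.
move=> AB cf.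
(* Clamping the argument to [A, B] extends [f] continuously to the line, so the integral from
   [A - 1] has a two-sided derivative at [A] and [B] too. *)
pose g x := f (Num.max A (Num.min B x)).
have cg : continuous g.
  move=> x; apply: (@continuous_comp _ _ _ (fun x => Num.max A (Num.min B x)) f).
    apply: (@continuous_max _ _ (cst A) (fun x => Num.min B x)); first exact: cvg_cst.
    by apply: (@continuous_min _ _ (cst B) id); [exact: cvg_cst|exact: cvg_id].
  by apply: cf; rewrite le_max lexx /= ge_max AB ge_min lexx.
pose G x := (\int[lebesgue_measure]_(t in `[A - 1, x]) g t)%R.
exists G => x /andP[Ax xB].
have xB1 : x < B + 1 by apply: le_lt_trans xB _; rewrite ltrDl.
have [|||dG Gx] := @continuous_FTC1_closed _ g (A - 1) x (B + 1) xB1.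
- apply: continuous_compact_integrable; first exact: segment_compact.
  by apply: continuous_subspaceT => ?; exact: cg.
- by apply: lt_le_trans Ax; rewrite gtrBl.
- exact: cg.
apply: DeriveDef; first exact: dG.
by rewrite -derive1E Gx /g (min_idPr xB) (max_idPr Ax).
Qed.

End RealDerivatives.

(** * Goursat's theorem for closed 1-forms on rectangles *)

Section Goursat.
Variables (R : realType) (P Q : R -> R -> R) (H V : R -> R -> R).

(* The circulation of P dx + Q dy around [a, b] x [c, d], H y and V x being
   primitives of P and Q along horizontal and vertical lines. *)
Definition circ (a b c d : R) : R :=
  H c b - H c a + (V b d - V b c) - (H d b - H d a) - (V a d - V a c).

Lemma circ_split a m b c k d :
  circ a b c d = circ a m c k + circ m b c k + circ a m k d + circ m b k d.
Proof. by rewrite /circ; ring. Qed.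

(* On a small square a closed 1-form is an exact quadratic one up to o(diameter). *)
Lemma circ_local (a b c d x0 y0 p q r e : R) : a <= b -> c <= d -> 0 <= e ->
  a <= x0 <= b -> c <= y0 <= d ->
  (forall x y : R, a <= x <= b -> c <= y <= d ->
    [/\ is_derive x 1 (H y) (P x y), is_derive y 1 (V x) (Q x y),
     `|P x y - P x0 y0 - p * (x - x0) - q * (y - y0)| <= e * (`|x - x0| + `|y - y0|) &
     `|Q x y - Q x0 y0 - q * (x - x0) - r * (y - y0)| <= e * (`|x - x0| + `|y - y0|)]) ->
  `|circ a b c d| <= e * 2 * ((b - a) + (d - c)) ^+ 2.
Proof.
move=> ab cd e0 hx0 hy0 h.
(* [phi] is a potential of the linearized form; it exists because [P] and [Q] share the coefficient
   [q]. Its circulation vanishes, so only the linearization errors along the four sides remain. *)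
pose phi x y := P x0 y0 * x + Q x0 y0 * y + p * (x - x0) ^+ 2 / 2
   + q * (x - x0) * (y - y0) + r * (y - y0) ^+ 2 / 2.
have sz x y : a <= x <= b -> c <= y <= d ->
    e * (`|x - x0| + `|y - y0|) <= e * ((b - a) + (d - c)).
  move=> /andP[? ?] /andP[? ?]; move: hx0 hy0 => /andP[? ?] /andP[? ?].
  by apply: ler_wpM2l => //; apply: lerD; rewrite ler_norml; lra.
have hor y : c <= y <= d -> `|(H y b - phi b y) - (H y a - phi a y)|
    <= e * ((b - a) + (d - c)) * (b - a).
  move=> hy; apply: (derive_bound (G := fun x => H y x - phi x y)
    (g := fun x => P x y - (P x0 y0 + p * (x - x0) + q * (y - y0)))) => // x hx.
    have [? _ _ _] := h x y hx hy.
    by apply: is_derive_eq; rewrite /GRing.scale /=; field.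
  have [_ _ + _] := h x y hx hy.
  move=> hb; apply: le_trans (sz x y hx hy); apply: le_trans hb.
  by rewrite !opprD !addrA.
have ver x : a <= x <= b -> `|(V x d - phi x d) - (V x c - phi x c)|
    <= e * ((b - a) + (d - c)) * (d - c).
  move=> hx; apply: (derive_bound (G := fun y => V x y - phi x y)
    (g := fun y => Q x y - (Q x0 y0 + q * (x - x0) + r * (y - y0)))) => // y hy.
    have [_ ? _ _] := h x y hx hy.
    by apply: is_derive_eq; rewrite /GRing.scale /=; field.
  have [_ _ _] := h x y hx hy.
  move=> hb; apply: le_trans (sz x y hx hy); apply: le_trans hb.
  by rewrite !opprD !addrA.
have aI : a <= a <= b by rewrite lexx.
have bI : a <= b <= b by rewrite lexx ab.
have cI : c <= c <= d by rewrite lexx.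
have dI : c <= d <= d by rewrite lexx cd.
have := hor c cI; have := hor d dI; have := ver a aI; have := ver b bI.
rewrite /circ !ler_norml.
by move=> /andP[? ?] /andP[? ?] /andP[? ?] /andP[? ?]; apply/andP; split; lra.
Qed.

(** Circulation is additive over the four quarters, so they cannot all fall below a fourth of the
    total. *)
Lemma circ_quarter (K a c l w : R) : K <= `|circ a (a + 2 * l) c (c + 2 * w)| ->
  exists s : R * R, [/\ s.1 = a \/ s.1 = a + l, s.2 = c \/ s.2 = c + w &
    K / 4 <= `|circ s.1 (s.1 + l) s.2 (s.2 + w)|].
Proof.
rewrite (circ_split a (a + l) _ c (c + w)).
have -> : a + 2 * l = a + l + l by ring.
have -> : c + 2 * w = c + w + w by ring.
move=> hK; apply: contrapT => hn.
have B s1 s2 : s1 = a \/ s1 = a + l -> s2 = c \/ s2 = c + w ->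
    `|circ s1 (s1 + l) s2 (s2 + w)| < K / 4.
  by move=> ? ?; rewrite ltNge; apply/negP => ?; apply: hn; exists (s1, s2).
have /lt_le_trans := B a c (or_introl erefl) (or_introl erefl).
have h1 := B a c (or_introl erefl) (or_introl erefl).
have h2 := B (a + l) c (or_intror erefl) (or_introl erefl).
have h3 := B a (c + w) (or_introl erefl) (or_intror erefl).
have h4 := B (a + l) (c + w) (or_intror erefl) (or_intror erefl).
have := le_trans hK (ler_normD _ _).
have := ler_normD (circ a (a + l) c (c + w) + circ (a + l) (a + l + l) c (c + w))
  (circ a (a + l) (c + w) (c + w + w)).
have := ler_normD (circ a (a + l) c (c + w)) (circ (a + l) (a + l + l) c (c + w)).
move=> ? ? ?; lra.
Qed.

(** Left endpoints increase and right endpoints decrease, so the supremum of the left ones lies in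
    every interval. *)
Lemma nested_point (a : nat -> R) (L : R) : 0 <= L ->
  (forall k, a k.+1 = a k \/ a k.+1 = a k + L / 2 ^+ k.+1) ->
  exists x, forall k, a k <= x <= a k + L / 2 ^+ k.
Proof.
move=> L0 ha.
have pos k : 0 <= L / 2 ^+ k by rewrite divr_ge0 ?exprn_ge0.
have half k : L / 2 ^+ k = L / 2 ^+ k.+1 + L / 2 ^+ k.+1.
  by rewrite exprS invfM; field; rewrite expf_neq0.
have st k : a k <= a k.+1 /\ a k.+1 + L / 2 ^+ k.+1 <= a k + L / 2 ^+ k.
  by have := half k; have := pos k.+1; case: (ha k) => ->; lra.
have up i k : a k <= a (k + i)%N /\ a (k + i)%N + L / 2 ^+ (k + i) <= a k + L / 2 ^+ k.
  elim: i => [|i [IH1 IH2]]; first by rewrite addn0 !lexx.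
  by rewrite addnS; have [? ?] := st (k + i)%N; split; lra.
have bd i k : a i <= a k + L / 2 ^+ k.
  have [/subnKC <-|/ltnW/subnKC <-] := leqP k i.
    by have [_] := up (i - k)%N k; apply: le_trans; rewrite lerDl.
  have [] := up (k - i)%N i; set j := (i + _)%N => h _.
  by apply: le_trans h _; rewrite lerDl.
have hs : has_sup (range a).
  by split; [exists (a 0%N), 0%N|exists (a 0%N + L / 2 ^+ 0) => _ [i _ <-]].
exists (sup (range a)) => k; apply/andP; split.
  by apply: ub_le_sup; [case: hs|exists k].
by apply: ge_sup; [case: hs|move=> _ [i _ <-]].
Qed.

(** Bisection: a circulation of modulus K > 0 would leave nested rectangles with circulation at
    least K / 4^k. At their common point [circ_local] bounds it by an arbitrarily small multiple of
    the squared diameter, which is also of size 4^-k. *)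
Lemma goursat (a L c W : R) : 0 < L -> 0 < W ->
  (forall x y : R, a <= x <= a + L -> c <= y <= c + W ->
    is_derive x 1 (H y) (P x y) /\ is_derive y 1 (V x) (Q x y)) ->
  (forall x0 y0 : R, a <= x0 <= a + L -> c <= y0 <= c + W ->
    exists p q r : R, forall e : R, 0 < e -> exists2 d : R, 0 < d &
     forall x y : R, `|x - x0| < d -> `|y - y0| < d ->
     `|P x y - P x0 y0 - p * (x - x0) - q * (y - y0)| <= e * (`|x - x0| + `|y - y0|) /\
     `|Q x y - Q x0 y0 - q * (x - x0) - r * (y - y0)| <= e * (`|x - x0| + `|y - y0|)) ->
  circ a (a + L) c (c + W) = 0.
Proof.
move=> L0 W0 hder hdif; apply/eqP; rewrite -normr_le0 leNgt; apply/negP => K0.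
set K := `|_| in K0.
pose l k := L / 2 ^+ k; pose w k := W / 2 ^+ k.
pose good k (s s' : R * R) := [/\ s'.1 = s.1 \/ s'.1 = s.1 + l k.+1,
  s'.2 = s.2 \/ s'.2 = s.2 + w k.+1 &
  K / 4 ^+ k.+1 <= `|circ s'.1 (s'.1 + l k.+1) s'.2 (s'.2 + w k.+1)|].
pose fix S k : R * R := if k is k'.+1 then xget (S k') [set s' | good k' (S k') s'] else (a, c).
have half (M : R) k : 2 * (M / 2 ^+ k.+1) = M / 2 ^+ k.
  by rewrite exprS invfM; field; rewrite expf_neq0.
have SP k : K / 4 ^+ k <= `|circ (S k).1 ((S k).1 + l k) (S k).2 ((S k).2 + w k)|
    /\ good k (S k) (S k.+1).
  suff stp k' : K / 4 ^+ k' <= `|circ (S k').1 ((S k').1 + l k') (S k').2 ((S k').2 + w k')| ->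
      good k' (S k') (S k'.+1).
    elim: k => [|k [IH1 IH2]].
      have h0 : K / 4 ^+ 0 <= `|circ (S 0%N).1 ((S 0%N).1 + l 0%N) (S 0%N).2 ((S 0%N).2 + w 0%N)|.
        by rewrite /l /w !expr0 !divr1.
      by split=> //; exact: stp.
    have IH3 : K / 4 ^+ k.+1 <=
      `|circ (S k.+1).1 ((S k.+1).1 + l k.+1) (S k.+1).2 ((S k.+1).2 + w k.+1)| by case: IH2.
    by split => //; exact: stp.
  move=> hk; rewrite [S k'.+1]/=.
  have [|s [s1 s2 s3]] := @circ_quarter (K / 4 ^+ k') (S k').1 (S k').2 (l k'.+1) (w k'.+1).
    by rewrite !half.
  have hg : good k' (S k') s.
    by split => //; move: s3; rewrite -mulrA -invfM -exprSr.
  by case: xgetP => [s' _ //|/(_ s)].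
have [x0 hx0] : exists x : R, forall k, (S k).1 <= x <= (S k).1 + l k.
  by apply: nested_point (ltW L0) _ => k; have [_ []] := SP k.
have [y0 hy0] : exists x : R, forall k, (S k).2 <= x <= (S k).2 + w k.
  by apply: nested_point (ltW W0) _ => k; have [_ []] := SP k.
have inS k : [/\ a <= (S k).1, (S k).1 + l k <= a + L, c <= (S k).2 & (S k).2 + w k <= c + W].
  elim: k => [|k [i1 i2 i3 i4]]; first by rewrite /= /l /w !expr0 !divr1 !lexx.
  have [_ [s1 s2 _]] := SP k.
  have l0 : 0 <= l k.+1 by rewrite divr_ge0 ?exprn_ge0 ?ltW.
  have w0 : 0 <= w k.+1 by rewrite divr_ge0 ?exprn_ge0 ?ltW.
  have := half L k; have := half W k; rewrite -/(l k) -/(w k) -/(l k.+1) -/(w k.+1).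
  case: s1 => ->; case: s2 => ->; move: i1 i2 i3 i4 l0 w0; clear => *; split; lra.
have aL : a <= a + L by lra.
have [p [q [r hpqr]]] : exists p q r : R, forall e : R, 0 < e -> exists2 d : R, 0 < d &
     forall x y : R, `|x - x0| < d -> `|y - y0| < d ->
     `|P x y - P x0 y0 - p * (x - x0) - q * (y - y0)| <= e * (`|x - x0| + `|y - y0|) /\
     `|Q x y - Q x0 y0 - q * (x - x0) - r * (y - y0)| <= e * (`|x - x0| + `|y - y0|).
  apply: hdif.
    by have := hx0 0%N; rewrite /l /= expr0 divr1.
  by have := hy0 0%N; rewrite /w /= expr0 divr1.
(* With this [e] the bound of [circ_local] on the k-th rectangle is exactly half of K / 4^k. *)
pose e := K / (4 * (L + W) ^+ 2).
have LW0 : 0 < L + W by lra.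
have e0 : 0 < e by rewrite divr_gt0 // mulr_gt0 ?exprn_gt0.
have [d d0 hd] := hpqr e e0.
have [k hk] : exists k, l k + w k < d.
  have : (fun k => (L + W) * 2^-1 ^+ k) @ \oo --> (L + W) * 0.
    by apply: cvgM; [exact: cvg_cst|apply: cvg_expr; rewrite ger0_norm; lra].
  rewrite mulr0 => /cvgrPdist_lt/(_ d d0)[k _ /(_ k (leqnn k))] /=.
  rewrite sub0r normrN exprVn ger0_norm ?divr_ge0 ?exprn_ge0 ?ltW // => h.
  by exists k; rewrite /l /w -mulrDl.
have l0 : 0 < l k by rewrite divr_gt0 ?exprn_gt0.
have w0 : 0 < w k by rewrite divr_gt0 ?exprn_gt0.
have [i1 i2 i3 i4] := inS k.
have [] := SP k; move=> + _.
apply/negP; rewrite -ltNge.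
apply: (le_lt_trans (@circ_local _ _ _ _ x0 y0 p q r e _ _ (ltW e0) (hx0 k) (hy0 k) _)); [lra|lra| |].
  move=> x y hx hy; have [||? ?] := hder x y.
  - by move: hx i1 i2; clear => *; lra.
  - by move: hy i3 i4; clear => *; lra.
  have [||? ?] := hd x y; last by split.
    by rewrite ltr_norml; have := hx0 k; lra.
  by rewrite ltr_norml; have := hy0 k; lra.
have -> : (S k).1 + l k - (S k).1 + ((S k).2 + w k - (S k).2) = (L + W) / 2 ^+ k.
  by rewrite /l /w; field; rewrite expf_neq0.
have t0 : (2 : R) ^+ k != 0 by rewrite expf_neq0.
have s0 : L + W != 0 by rewrite gt_eqF.
have -> : e * 2 * ((L + W) / 2 ^+ k) ^+ 2 = K / 4 ^+ k / 2.
  rewrite /e (_ : 4 ^+ k = (2 ^+ k) ^+ 2 :> R); last first.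
    by rewrite -exprM mulnC exprM (_ : 2 ^+ 2 = 4 :> R) //; ring.
  by field; rewrite t0 s0.
by rewrite ltr_pdivrMr // ltr_pMr ?divr_gt0 ?exprn_gt0 // ltr1n.
Qed.

End Goursat.

(** * Complex derivatives, Cauchy's inequality and the second-order remainder *)

Section ComplexDerivative.
Variable R : realType.
Implicit Types (f g : R[i] -> R[i]) (z l : R[i]).

Definition cdiff f z l := forall e : R, 0 < e -> exists2 d : R, 0 < d &
  forall h : R[i], nrm h < d -> nrm (f (z + h) - f z - l * h) <= e * nrm h.

Lemma cdiff_lip f z l : cdiff f z l -> exists2 d : R, 0 < d &
  forall h : R[i], nrm h < d -> nrm (f (z + h) - f z) <= (nrm l + 1) * nrm h.
Proof.
move=> /(_ 1 ltr01)[d d0 hd]; exists d => // h hh.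
rewrite -[f _ - f z](subrK (l * h)); apply: le_trans (nrmD _ _) _.
by rewrite mulrDl mul1r nrmM addrC lerD2l -[leRHS]mul1r hd.
Qed.

Lemma cdiffB f g z l l' : cdiff f z l -> cdiff g z l' ->
  cdiff (fun s => f s - g s) z (l - l').
Proof.
move=> df dg e e0; have e20 : 0 < e / 2 by rewrite divr_gt0.
have [d1 d10 h1] := df _ e20; have [d2 d20 h2] := dg _ e20.
exists (Num.min d1 d2); first by rewrite lt_min d10.
move=> h; rewrite lt_min => /andP[hd1 hd2].
have -> : f (z + h) - g (z + h) - (f z - g z) - (l - l') * h
  = (f (z + h) - f z - l * h) - (g (z + h) - g z - l' * h) by ring.
apply: le_trans (nrmB _ _) _.
by have := h1 h hd1; have := h2 h hd2; lra.
Qed.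

Lemma cdiff_cst c z : cdiff (fun=> c) z 0.
Proof.
by move=> e e0; exists 1 => // h _; rewrite mul0r subr0 subrr nrm0 mulr_ge0 ?nrm_ge0 // ltW.
Qed.

Lemma cdiff_linear c z : cdiff (fun s => c * s) z c.
Proof.
move=> e e0; exists 1 => // h _.
by rewrite mulrDr [c * z + _]addrC addrK subrr nrm0 mulr_ge0 ?nrm_ge0 // ltW.
Qed.

Lemma cdiff_eq f z l l' : cdiff f z l -> l = l' -> cdiff f z l'.
Proof. by move=> + <-. Qed.

Lemma cdiff_comp f g z l l' : cdiff f (g z) l -> cdiff g z l' ->
  cdiff (fun s => f (g s)) z (l * l').
Proof.
move=> df dg e e0.
have l0 := nrm_ge0 l; have l0' := nrm_ge0 l'.
have e20 : 0 < e / 2 by rewrite divr_gt0.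
have p1 : 0 < nrm l + 1 by lra.
have p2 : 0 < nrm l' + 1 by lra.
have [d1 d10 h1] := df (e / 2 / (nrm l' + 1)) (divr_gt0 e20 p2).
have [d2 d20 h2] := dg (e / 2 / (nrm l + 1)) (divr_gt0 e20 p1).
have [d3 d30 h3] := cdiff_lip dg.
exists (Num.min (Num.min d2 d3) (d1 / (nrm l' + 1))).
  by rewrite !lt_min d20 d30 divr_gt0.
move=> h; rewrite !lt_min -andbA ltr_pdivlMr // => /and3P[hd2 hd3 hd1].
set k := g (z + h) - g z; have hk : nrm k <= (nrm l' + 1) * nrm h := h3 h hd3.
have -> : f (g (z + h)) - f (g z) - l * l' * h
  = (f (g z + k) - f (g z) - l * k) + l * (k - l' * h).
  by rewrite /k [g z + _]addrC subrK; ring.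
apply: le_trans (nrmD _ _) _; rewrite nrmM.
have hk1 : nrm k < d1 by apply: le_lt_trans hk _; rewrite mulrC.
have e2' : 0 <= e / 2 / (nrm l' + 1) by rewrite !divr_ge0 ?ltW.
have b1 : nrm (f (g z + k) - f (g z) - l * k) <= e / 2 * nrm h.
  apply: le_trans (h1 k hk1) _; apply: le_trans (ler_wpM2l e2' hk) _.
  by rewrite mulrA divfK ?gt_eqF.
have b2 : nrm l * nrm (k - l' * h) <= e / 2 * nrm h.
  apply: le_trans (ler_wpM2l l0 (h2 h hd2)) _.
  rewrite mulrA; apply: ler_wpM2r; first exact: nrm_ge0.
  rewrite mulrA ler_pdivrMr // [leRHS]mulrC ler_wpM2r //; [by rewrite divr_ge0 ?ltW|lra].
by lra.
Qed.

Lemma cdiff_sqr z : cdiff (fun s => s ^+ 2) z (2 * z).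
Proof.
move=> e e0; exists e => // h he.
have -> : (z + h) ^+ 2 - z ^+ 2 - 2 * z * h = h * h by ring.
by rewrite nrmM ler_wpM2r ?nrm_ge0 // ltW.
Qed.

(** Polarization: the product is a quarter of (f + g)^2 - (f - g)^2, so the chain rule and the
    derivative of the square suffice. *)
Lemma cdiffM f g z l l' : cdiff f z l -> cdiff g z l' ->
  cdiff (fun s => f s * g s) z (l * g z + f z * l').
Proof.
have cdiffN g' l1 : cdiff g' z l1 -> cdiff (fun s => 0 - g' s) z (0 - l1).
  exact: cdiffB (cdiff_cst 0 z).
move=> df dg; have df' := cdiffB df (cdiffN _ _ dg).
have := cdiff_comp (cdiff_linear 4^-1 _)
  (cdiffB (cdiff_comp (cdiff_sqr _) df') (cdiff_comp (cdiff_sqr _) (cdiffB df dg))).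
rewrite (_ : (fun s => 4^-1 * _) = (fun s => f s * g s)); last first.
  by apply/funext => s; field.
by move=> /cdiff_eq; apply; field.
Qed.

Definition cexp (s : R[i]) : R[i] := (expR (complex.Re s))%:C%C * expi (complex.Im s).

Lemma expiD (s t : R) : expi (s + t) = expi s * expi t.
Proof. by rewrite /expi cosD sinD; apply/eqP; rewrite eq_complex /= eqxx /= addrC. Qed.

Lemma nrm_expi (t : R) : nrm (expi t) = 1.
Proof.
apply/eqP; rewrite -(@eqrXn2 _ 2) ?nrm_ge0 // nrm_sqrE /= expr1n.
by rewrite cos2Dsin2.
Qed.

Lemma cexpD s t : cexp (s + t) = cexp s * cexp t.
Proof.
rewrite /cexp (_ : complex.Re (s + t) = complex.Re s + complex.Re t); last by case: s; case: t.
rewrite (_ : complex.Im (s + t) = complex.Im s + complex.Im t); last by case: s; case: t.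
by rewrite expRD expiD rmorphM /=; ring.
Qed.

Lemma nrm_cexp s : nrm (cexp s) = expR (complex.Re s).
Proof. by rewrite nrmM nrm_expi mulr1 nrm_real ger0_norm ?expR_ge0. Qed.

Lemma cexp0 : cexp 0 = 1.
Proof. by rewrite /cexp /= expR0 mul1r /expi cos0 sin0. Qed.

Lemma cexp_neq0 s : cexp s != 0.
Proof. by rewrite -nrm_eq0 nrm_cexp gt_eqF ?expR_gt0. Qed.

Lemma cexpN s : cexp (- s) = (cexp s)^-1.
Proof.
by apply: (mulfI (cexp_neq0 s)); rewrite -cexpD subrr cexp0 divff ?cexp_neq0.
Qed.

Lemma cdiff_cexp0 : cdiff cexp 0 1.
Proof.
(* The real and imaginary parts will cost 3 and 5 times (e / 8) t, hence the 8. *)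
move=> e e0; pose e1 := Num.min (e / 8) 1.
have e10 : 0 < e1 by rewrite lt_min ltr01 divr_gt0.
have [e18 e11] : e1 <= e / 8 /\ e1 <= 1 by split; rewrite ge_min lexx ?orbT.
have [d1 d10 h1] := (is_derive_epsP _ _ _).1 (@is_derive_expR R 0) _ e10.
have [d2 d20 h2] := (is_derive_epsP _ _ _).1 (@is_derive_cos R 0) _ e10.
have [d3 d30 h3] := (is_derive_epsP _ _ _).1 (@is_derive_sin R 0) _ e10.
exists (Num.min (Num.min d1 d2) (Num.min d3 (Num.min 2^-1 (e / 8)))).
  by rewrite !lt_min d10 d20 d30 invr_gt0 ltr0n /= divr_gt0.
case=> a b; rewrite !lt_min -!andbA => /and5P[hd1 hd2 hd3 hd4 hd5].
rewrite cexp0 mul1r /cexp add0r /=.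
set t := nrm _ in hd1 hd2 hd3 hd4 hd5; rewrite -/t.
have at' : `|a| <= t := abs_Re_le (Complex a b).
have bt : `|b| <= t := abs_Im_le (Complex a b).
have := h1 a (le_lt_trans at' hd1); have := h2 b (le_lt_trans bt hd2).
have := h3 b (le_lt_trans bt hd3).
rewrite !add0r expR0 cos0 sin0 !mul1r oppr0 mul0r !subr0 !addr0 => kb kc ka.
set w := (X in nrm X).
have -> : w = Complex ((expR a - 1 - a) + expR a * (cos b - 1))
   ((expR a - 1) * sin b + (sin b - b)).
  by rewrite /w /expi; apply/eqP; rewrite eq_complex /=; apply/andP; split; apply/eqP; ring.
apply: le_trans (nrm_le_ReIm _) _ => /=.
have t0 : 0 <= t := nrm_ge0 _.
have e1t (x : R) : `|x| <= t -> e1 * `|x| <= t /\ e1 * `|x| <= e / 8 * t.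
  move=> hx; split; last by apply: ler_pM => //; exact: ltW.
  by rewrite -[leRHS]mul1r ler_pM // ltW.
have [ka1 ka2] := e1t _ at'; have [kb1 kb2] := e1t _ bt.
have ea : `|expR a - 1| <= 2 * t.
  have -> : expR a - 1 = (expR a - 1 - a) + a by ring.
  by apply: le_trans (ler_normD _ _) _; lra.
have eb : `|sin b| <= 2 * t.
  have -> : sin b = (sin b - b) + b by ring.
  by apply: le_trans (ler_normD _ _) _; lra.
have ea2 : `|expR a| <= 2.
  have -> : expR a = (expR a - 1) + 1 by ring.
  by apply: le_trans (ler_normD _ _) _; rewrite normr1; lra.
have r1 : `|expR a - 1 - a + expR a * (cos b - 1)| <= 3 * (e / 8 * t).
  apply: le_trans (ler_normD _ _) _; rewrite normrM.
  have : `|expR a| * `|cos b - 1| <= 2 * (e / 8 * t) by apply: ler_pM => //; lra.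
  by lra.
have r2 : `|(expR a - 1) * sin b + (sin b - b)| <= 5 * (e / 8 * t).
  apply: le_trans (ler_normD _ _) _; rewrite normrM.
  have h4 : `|expR a - 1| * `|sin b| <= (2 * t) * (2 * t) by apply: ler_pM.
  have h5 : t * t <= e / 8 * t by apply: ler_wpM2r => //; exact: ltW.
  by lra.
by lra.
Qed.

Lemma cdiff_cexp s : cdiff cexp s (cexp s).
Proof.
have : cdiff (fun u => cexp s * cexp (u - s)) s (cexp s * (1 * (1 - 0))).
  apply: cdiff_comp (cdiff_linear _ _) _.
  apply: cdiff_comp; first by rewrite subrr; exact: cdiff_cexp0.
  apply: cdiffB (cdiff_cst _ _).
  by move: (cdiff_linear 1 s); rewrite (_ : (fun u => 1 * u) = id) //; apply/funext => u; rewrite mul1r.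
rewrite (_ : (fun u => _) = cexp) ?subr0 ?mulr1 //.
by apply/funext => u; rewrite -cexpD addrC subrK.
Qed.

Lemma cdiff_cexpN s : cdiff (fun u => cexp (- u)) s (- cexp (- s)).
Proof.
have := cdiff_comp (g := fun u => -1 * u) (cdiff_cexp _) (cdiff_linear (-1) s).
rewrite (_ : (fun u => _) = fun u => cexp (- u)); last by apply/funext => u; rewrite mulN1r.
by rewrite mulN1r mulrN1.
Qed.

Lemma cdiff_line f (a d : R[i]) (t : R) l : cdiff f (a + t%:C%C * d) l ->
  is_derive t 1 (fun t : R => complex.Re (f (a + t%:C%C * d))) (complex.Re (l * d)) /\
  is_derive t 1 (fun t : R => complex.Im (f (a + t%:C%C * d))) (complex.Im (l * d)).
Proof.
move=> df.
have key (e : R) : 0 < e -> exists2 r : R, 0 < r & forall h : R, `|h| < r ->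
    nrm (f (a + (t + h)%:C%C * d) - f (a + t%:C%C * d) - h%:C%C * (l * d)) <= e * `|h|.
  move=> e0; have d0 : 0 < nrm d + 1 by have := nrm_ge0 d; lra.
  have [r r0 hr] := df _ (divr_gt0 e0 d0).
  exists (r / (nrm d + 1)); first by rewrite divr_gt0.
  move=> h; rewrite ltr_pdivlMr // => hh.
  have hhd : `|h| * nrm d <= `|h| * (nrm d + 1) by rewrite ler_wpM2l // lerDl.
  have := hr (h%:C%C * d); rewrite nrmM nrm_real => /(_ (le_lt_trans hhd hh)).
  rewrite rmorphD /= mulrDl addrA [l * _]mulrCA => /le_trans; apply.
  rewrite [leLHS](_ : _ = e * `|h| * (nrm d / (nrm d + 1))); last by ring.
  rewrite -[leRHS]mulr1 ler_wpM2l ?mulr_ge0 ?(ltW e0) //.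
  by rewrite ler_pdivrMr // mul1r lerDl.
have ReB (x y : R[i]) : complex.Re (x - y) = complex.Re x - complex.Re y by case: x; case: y.
have ImB (x y : R[i]) : complex.Im (x - y) = complex.Im x - complex.Im y by case: x; case: y.
have ReZ (x : R) (y : R[i]) : complex.Re (x%:C%C * y) = x * complex.Re y.
  by case: y => ? ? /=; rewrite mul0r subr0.
have ImZ (x : R) (y : R[i]) : complex.Im (x%:C%C * y) = x * complex.Im y.
  by case: y => ? ? /=; rewrite mul0r addr0.
split; apply/is_derive_epsP => e e0; have [r r0 hr] := key e e0; exists r => // h hh.
  apply: le_trans (hr h hh); apply: le_trans (abs_Re_le _).
  by rewrite !ReB ReZ [complex.Re (l * d) * h]mulrC.
apply: le_trans (hr h hh); apply: le_trans (abs_Im_le _).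
by rewrite !ImB ImZ [complex.Im (l * d) * h]mulrC.
Qed.

Lemma is_derive_continuous (G : R -> R) (x l : R) : is_derive x 1 G l -> {for x, continuous G}.
Proof. by move=> dG; apply/differentiable_continuous/derivable1_diffP. Qed.

(** The mean value theorem is real; applying it to the real and imaginary parts separately costs the
    factor 2. *)
Lemma segment_bound f f' (z d : R[i]) (K : R) :
  (forall t : R, 0 <= t <= 1 -> cdiff f (z + t%:C%C * d) (f' (z + t%:C%C * d)) /\
     nrm (f' (z + t%:C%C * d)) <= K) ->
  nrm (f (z + d) - f z) <= 2 * K * nrm d.
Proof.
move=> h; apply: le_trans (nrm_le_ReIm _) _.
have bd t : 0 <= t <= 1 -> nrm (f' (z + t%:C%C * d) * d) <= K * nrm d.
  by move=> ht; rewrite nrmM ler_wpM2r ?nrm_ge0 //; case: (h t ht).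
have e1 : f (z + d) = f (z + 1%:C%C * d) by rewrite mul1r.
have e0 : f z = f (z + 0%:C%C * d) by rewrite mul0r addr0.
have hR : `|complex.Re (f (z + d)) - complex.Re (f z)| <= K * nrm d * (1 - 0).
  rewrite e1 e0; apply: (derive_bound (G := fun t => complex.Re (f (z + t%:C%C * d)))
    (g := fun t => complex.Re (f' (z + t%:C%C * d) * d))) => // t ht.
    by case: (cdiff_line (h t ht).1).
  exact: le_trans (abs_Re_le _) (bd t ht).
have hI : `|complex.Im (f (z + d)) - complex.Im (f z)| <= K * nrm d * (1 - 0).
  rewrite e1 e0; apply: (derive_bound (G := fun t => complex.Im (f (z + t%:C%C * d)))
    (g := fun t => complex.Im (f' (z + t%:C%C * d) * d))) => // t ht.
    by case: (cdiff_line (h t ht).1).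
  exact: le_trans (abs_Im_le _) (bd t ht).
move: hR hI; case: (f (z + d)) => ? ?; case: (f z) => ? ? /=.
by rewrite subr0 mulr1 => ? ?; lra.
Qed.

(* The integral of s |-> (f (z + e^s) - f z) e^-s over a vertical period does
   not depend on Re s, and tends to 2 pi f'(z) as Re s -> -oo. *)
Lemma cauchy_Re f z l (r rho K : R) : 0 < rho -> rho < r ->
  (forall s, nrm (s - z) < r -> exists l, cdiff f s l) -> cdiff f z l ->
  (forall s, nrm (s - z) = rho -> nrm (f s - f z) <= K) ->
  `|complex.Re l| <= K / rho.
Proof.
move=> rho0 rhor df dfz hK.
pose h (s : R[i]) := (f (z + cexp s) - f z) * cexp (- s).
have pi0 : 0 < 2 * pi :> R by rewrite mulr_gt0 // pi_gt0.
have dh s : complex.Re s < ln r -> exists l, cdiff h s l.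
  move=> sr.
  have [|l1 hl1] := df (z + cexp s).
    by rewrite addrC addKr nrm_cexp -ltr_ln ?posrE ?expR_gt0 ?expRK // (lt_trans rho0).
  eexists; apply: cdiffM; last exact: cdiff_cexpN.
  apply: cdiffB; last exact: cdiff_cst.
  apply: (cdiff_comp (g := fun s => z + cexp s) hl1).
  have := cdiffB (cdiff_cexp s) (cdiff_cst (- z) s).
  rewrite (_ : (fun u => cexp u - - z) = fun u => z + cexp u); first exact.
  by apply/funext => u; rewrite opprK addrC.
pose c (x y : R) := Complex x y.
(* The form [v dx + u dy] is the imaginary part of [h ds]; it is closed by the Cauchy-Riemann
   equations, and along vertical sides it integrates Re h. *)
pose u x y := complex.Re (h (c x y)); pose v x y := complex.Im (h (c x y)).
have cx x y : c x y = 'i%C * y%:C%C + x%:C%C * 1.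
  by apply/eqP; rewrite eq_complex /=; apply/andP; split; apply/eqP; ring.
have cy x y : c x y = x%:C%C + y%:C%C * 'i%C.
  by apply/eqP; rewrite eq_complex /=; apply/andP; split; apply/eqP; ring.
have u_per x : u x (2 * pi) = u x 0 /\ v x (2 * pi) = v x 0.
  rewrite /u /v; suff -> : h (c x (2 * pi)) = h (c x 0) by [].
  have e2 : cexp (c x (2 * pi)) = cexp (c x 0).
    by rewrite /cexp /= /expi mulr_natl cos2pi sin2pi cos0 sin0.
  by rewrite /h !cexpN e2.
suff main e : 0 < e -> `|complex.Re l| <= K / rho + e.
  by apply/ler_addgt0Pr => e e0; exact: main.
move=> e0.
have [d d0 hd] := dfz e e0.
(* The side over [x2] is the circle of radius [rho]. The side over [x1] is a circle inside the disc
   of radius [d], where difference quotients at [z] are within [e] of [l]. *)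
pose x2 := ln rho; pose x1 := ln (Num.min d rho / 2).
have m0 : 0 < Num.min d rho by rewrite lt_min d0.
have x12 : x1 < x2.
  rewrite ltr_ln ?posrE ?divr_gt0 // ltr_pdivrMr //.
  have : Num.min d rho <= rho by rewrite ge_min lexx orbT.
  by lra.
have x2r : x2 < ln r by rewrite ltr_ln ?posrE // (lt_trans rho0).
have dhc x y : x <= x2 -> exists l, cdiff h (c x y) l.
  by move=> xx; apply: dh => /=; exact: le_lt_trans x2r.
have hp (y : R) : exists G : R -> R, forall x : R, x1 <= x <= x2 -> is_derive x 1 G (v x y).
  apply: (@primitive_exists R (v^~ y)) (ltW x12) _ => x /andP[_ xx].
  have [l1 hl1] := dhc x y xx; rewrite cx in hl1.
  have [_ /is_derive_continuous] := cdiff_line hl1.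
  by rewrite (_ : (fun t : R => _) = v^~ y) //; apply/funext => t; rewrite /v cx.
have [H hH] := choice hp.
have vp (x : R) : exists G : R -> R, forall y : R, x1 <= x <= x2 -> 0 <= y <= 2 * pi ->
    is_derive y 1 G (u x y).
  have [xx|xx] := boolP (x1 <= x <= x2); last by exists (fun=> 0).
  suff [G hG] : exists G : R -> R, forall y : R, 0 <= y <= 2 * pi -> is_derive y 1 G (u x y).
    by exists G => y _; exact: hG.
  apply: (@primitive_exists R (u x)) (ltW pi0) _ => y _.
  have [l1 hl1] := dhc x y (andP xx).2; rewrite cy in hl1.
  have [/is_derive_continuous + _] := cdiff_line hl1.
  by rewrite (_ : (fun t : R => _) = u x) //; apply/funext => t; rewrite /u cy.
have [V hV] := choice vp.
have := @goursat _ v u H V x1 (x2 - x1) 0 (2 * pi).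
rewrite subr_gt0 add0r [x1 + _]addrC subrK => /(_ x12 pi0) gs.
have circ0 : circ H V x1 x2 0 (2 * pi) = 0.
  apply: gs => [x y hx hy|x y /andP[_ hx] _]; first by split; [exact: hH|exact: hV].
  have [l1 hl1] := dhc x y hx; exists (complex.Im l1), (complex.Re l1), (- complex.Im l1).
  move=> e' e'0; have [d' d'0 hd'] := hl1 e' e'0.
  exists (d' / 2) => [|x' y' hx' hy']; first by rewrite divr_gt0.
  have sz : nrm (c (x' - x) (y' - y)) <= `|x' - x| + `|y' - y| := nrm_le_ReIm _.
  have := hd' (c (x' - x) (y' - y)).
  have -> : c x y + c (x' - x) (y' - y) = c x' y'.
    by apply/eqP; rewrite eq_complex /=; apply/andP; split; apply/eqP; ring.
  move=> hb.
  have {}hb : nrm (h (c x' y') - h (c x y) - l1 * c (x' - x) (y' - y)) <= e' * (`|x' - x| + `|y' - y|).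
    by apply: le_trans (hb _) _; [lra|rewrite ler_wpM2l // ltW].
  split.
    apply: le_trans hb; apply: le_trans (abs_Im_le _); rewrite /v.
    case: (h (c x' y')) => ? ?; case: (h (c x y)) => ? ?; case: l1 {hl1 hd'} => ? ? /=.
    by rewrite le_eqVlt; apply/orP; left; apply/eqP; congr `| _ |; ring.
  apply: le_trans hb; apply: le_trans (abs_Re_le _); rewrite /u.
  case: (h (c x' y')) => ? ?; case: (h (c x y)) => ? ?; case: l1 {hl1 hd'} => ? ? /=.
  by rewrite le_eqVlt; apply/orP; left; apply/eqP; congr `| _ |; ring.
(* By periodicity both primitives have the same derivative, so the two horizontal sides cancel. *)
have hor : H 0 x2 - H 0 x1 = H (2 * pi) x2 - H (2 * pi) x1.
  apply/eqP; rewrite -subr_eq0 -normr_le0.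
  have -> : H 0 x2 - H 0 x1 - (H (2 * pi) x2 - H (2 * pi) x1)
    = (H 0 x2 - H (2 * pi) x2) - (H 0 x1 - H (2 * pi) x1) by ring.
  rewrite -[leRHS](mul0r (x2 - x1)).
  apply: (derive_bound (G := fun x => H 0 x - H (2 * pi) x) (g := fun=> 0)) (ltW x12) _ _.
    move=> t ht; have h1 := hH 0 t ht; have h2 := hH (2 * pi) t ht.
    by apply: is_derive_eq; rewrite (u_per t).2 subrr.
  by move=> t _; rewrite normr0.
have {circ0}hVe : V x2 (2 * pi) - V x2 0 = V x1 (2 * pi) - V x1 0.
  by move: circ0; rewrite /circ hor; move=> ?; lra.
(* Over [x2] the integrand is at most K / rho since |e^-s| = 1 / rho there; over [x1] it is within
   [e] of Re l. By [hVe] the two integrals are equal. *)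
have b2 : `|V x2 (2 * pi) - V x2 0| <= K / rho * (2 * pi - 0).
  apply: (derive_bound (g := u x2)) (ltW pi0) _ _ => t ht.
    by apply: hV => //; rewrite lexx ltW.
  apply: le_trans (abs_Re_le _) _; rewrite /h nrmM nrm_cexp /= expRN lnK ?posrE //.
  apply: ler_wpM2r; first by rewrite invr_ge0 ltW.
  by apply: hK; rewrite addrC addKr nrm_cexp /= lnK ?posrE.
have b1 : `|(V x1 (2 * pi) - complex.Re l * (2 * pi)) - (V x1 0 - complex.Re l * 0)|
     <= e * (2 * pi - 0).
  apply: (derive_bound (G := fun y => V x1 y - complex.Re l * y)
     (g := fun y => u x1 y - complex.Re l)) (ltW pi0) _ _ => t ht.
    have h1 : is_derive t 1 (V x1) (u x1 t) by apply: hV => //; rewrite lexx ltW.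
    by apply: is_derive_eq; rewrite /GRing.scale /= mulr1.
  pose s := c x1 t; have sd : nrm (cexp s) < d.
    rewrite nrm_cexp /= lnK ?posrE ?divr_gt0 // ltr_pdivrMr //.
    have : Num.min d rho <= d by rewrite ge_min lexx.
    by lra.
  have -> : u x1 t - complex.Re l = complex.Re (h s - l).
    by rewrite /u -/s; case: (h s) => ? ?; case: (l).
  apply: le_trans (abs_Re_le _) _.
  have -> : h s - l = (f (z + cexp s) - f z - l * cexp s) * cexp (- s).
    by rewrite /h cexpN; field; exact: cexp_neq0.
  have := hd _ sd; rewrite nrmM cexpN nrmV => hb.
  by rewrite ler_pdivrMr // nrm_cexp expR_gt0.
move: b1 b2; rewrite !subr0 mulr0 !subr0 => b1 b2.
rewrite hVe in b2.
rewrite -(ler_pM2r pi0) -[X in _ * X](gtr0_norm pi0) -normrM [leRHS]mulrDl.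
have -> : complex.Re l * (2 * pi) = (V x1 (2 * pi) - V x1 0)
  - (V x1 (2 * pi) - complex.Re l * (2 * pi) - V x1 0) by ring.
by apply: le_trans (ler_normB _ _) _; apply: lerD.
Qed.

(** [cauchy_Re] applied to [f] and to [-i f] bounds the real and the imaginary part of [l]; adding
    them gives the 2. *)
Lemma cauchy_derivative f z l (r rho K : R) : 0 < rho -> rho < r ->
  (forall s, nrm (s - z) < r -> exists l, cdiff f s l) -> cdiff f z l ->
  (forall s, nrm (s - z) = rho -> nrm (f s - f z) <= K) ->
  nrm l <= 2 * (K / rho).
Proof.
move=> rho0 rhor df dfz hK; apply: le_trans (nrm_le_ReIm _) _.
have hR := cauchy_Re rho0 rhor df dfz hK.
have hI : `|complex.Re (- 'i%C * l)| <= K / rho.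
  apply: (@cauchy_Re (fun s => - 'i%C * f s) z _ r) => // [s /df[l1 hl1]||s hs].
  - by eexists; apply: cdiff_comp (cdiff_linear _ _) hl1.
  - exact: cdiff_comp (cdiff_linear _ _) dfz.
  rewrite -mulrBr nrmM nrmN; suff -> : nrm ('i%C : R[i]) = 1 by rewrite mul1r; exact: hK.
  by apply/eqP; rewrite -(@eqrXn2 _ 2) ?nrm_ge0 // nrm_sqrE /= expr0n expr1n add0r.
move: hI; case: (l) hR => p q /=.
by rewrite (_ : - 0 * p - -1 * q = q); [lra|ring].
Qed.

Lemma cauchy_taylor f f' z0 (r M : R) : 0 < r ->
  (forall s, nrm (s - z0) < 4 * r -> cdiff f s (f' s) /\ nrm (f s) <= M) ->
  nrm (f' z0) <= 8 * (M / r) /\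
  forall z, nrm (z - z0) < r ->
   nrm (f z - f z0 - f' z0 * (z - z0)) <= 128 * (M / r ^+ 2) * nrm (z - z0) ^+ 2.
Proof.
move=> r0 hf.
have r20 : 0 < r / 2 by rewrite divr_gt0.
have M0 : 0 <= M.
  have [|_] := hf z0; first by rewrite subrr nrm0 mulr_gt0.
  by apply: le_trans; exact: nrm_ge0.
have near s t (a b : R) : nrm (s - t) < a -> nrm (t - z0) < b -> nrm (s - z0) < a + b.
  move=> h1 h2; rewrite (_ : s - z0 = (s - t) + (t - z0)); last by ring.
  exact: le_lt_trans (nrmD _ _) (ltrD h1 h2).
have fb s : nrm (s - z0) < 3 * r -> nrm (f' s) <= 8 * (M / r).
  move=> hs.
  have -> : 8 * (M / r) = 2 * (2 * M / (r / 2)) by field; rewrite gt_eqF.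
  apply: (@cauchy_derivative f s _ r) => //; first by lra.
  - by move=> t ht; exists (f' t); apply: (hf t _).1; have := near t s _ _ ht hs; lra.
  - by apply: (hf s _).1; lra.
  move=> t ht; apply: le_trans (nrmB _ _) _; rewrite mulr2n mulrDl mul1r.
  apply: lerD; last by apply: (hf s _).2; lra.
  by apply: (hf t _).2; have := near t s r _ _ hs; rewrite ht; lra.
split; first by apply: fb; rewrite subrr nrm0 mulr_gt0.
have f'b d : nrm d < r -> nrm (f' (z0 + d) - f' z0) <= 64 * (M / r ^+ 2) * nrm d.
  move=> dr.
  have -> : 64 * (M / r ^+ 2) * nrm d = 2 * (2 * (2 * (8 * (M / r)) * nrm d) / r).
    by field; rewrite gt_eqF.
  have dn s : nrm (s - z0) < 2 * r -> nrm (s + d - z0) < 3 * r.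
    move=> hs; rewrite addrAC; apply: le_lt_trans (nrmD _ _) _; lra.
  have gb s : nrm (s - z0) < 2 * r -> nrm (f (s + d) - f s) <= 2 * (8 * (M / r)) * nrm d.
    move=> hs; apply: (@segment_bound f f') => t /andP[t0 t1].
    have td : nrm (t%:C%C * d) <= nrm d.
      by rewrite nrmM nrm_real ger0_norm // ler_piMl ?nrm_ge0.
    have hst : nrm (s + t%:C%C * d - z0) < 3 * r.
      rewrite addrAC; apply: le_lt_trans (nrmD _ _) _; lra.
    by split; [apply: (hf _ _).1; lra|exact: fb].
  apply: (@cauchy_derivative (fun s => f (s + d) - f s) z0 _ (2 * r)) => //; first by lra.
  - move=> s hs; exists (f' (s + d) - f' s); apply: cdiffB; last by apply: (hf s _).1; lra.
    have sd : cdiff f (s + d) (f' (s + d)) by apply: (hf _ _).1; have := dn s hs; lra.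
    have := cdiff_comp (g := fun s => s + d) sd; move=> /(_ 1); rewrite mulr1; apply.
    have := cdiffB (cdiff_linear 1 s) (cdiff_cst (- d) s); rewrite subr0.
    by rewrite (_ : (fun u => _) = fun u => u + d) //; apply/funext => u; rewrite mul1r opprK.
  - apply: cdiffB; last by apply: (hf z0 _).1; rewrite subrr nrm0; lra.
    have sd : cdiff f (z0 + d) (f' (z0 + d)).
      by apply: (hf _ _).1; rewrite addrC addKr; lra.
    have := cdiff_comp (g := fun s => s + d) sd; move=> /(_ 1); rewrite mulr1; apply.
    have := cdiffB (cdiff_linear 1 z0) (cdiff_cst (- d) z0); rewrite subr0.
    by rewrite (_ : (fun u => _) = fun u => u + d) //; apply/funext => u; rewrite mul1r opprK.
  move=> s hs; apply: le_trans (nrmB _ _) _.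
  have h1 := gb s; have h2 := gb z0; rewrite subrr nrm0 hs in h1 h2.
  have {}h1 := h1 ltac:(by rewrite ltr_pMl // ltr1n).
  have {}h2 := h2 ltac:(by rewrite mulr_gt0).
  by rewrite [leRHS](_ : _ = 2 * (8 * (M / r)) * nrm d + 2 * (8 * (M / r)) * nrm d);
    [exact: lerD|ring].
move=> z hz; pose d := z - z0; rewrite -/d.
have -> : f z - f z0 - f' z0 * d = (f (z0 + d) - f' z0 * (z0 + d)) - (f z0 - f' z0 * z0).
  by rewrite /d [z0 + _]addrC subrK; ring.
have -> : 128 * (M / r ^+ 2) * nrm d ^+ 2 = 2 * (64 * (M / r ^+ 2) * nrm d) * nrm d by ring.
apply: (@segment_bound (fun s => f s - f' z0 * s) (fun s => f' s - f' z0)) => t /andP[t0 t1].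
have td : nrm (t%:C%C * d) <= nrm d.
  by rewrite nrmM nrm_real ger0_norm // ler_piMl ?nrm_ge0.
split.
  apply: cdiffB (cdiff_linear _ _); apply: (hf _ _).1.
  rewrite addrC addKr; have : nrm d < r by []. by lra.
apply: le_trans (f'b _ _) _; first exact: le_lt_trans hz.
by rewrite ler_wpM2l // !mulr_ge0 ?invr_ge0 ?exprn_ge0 // ltW.
Qed.

End ComplexDerivative.

(** * Monomials and Fourier coefficients *)

Section CStarBasics.
Variables (R : realType) (A : cstarType R).
Implicit Types x y z u v : A.

Lemma star_cone : star (cone : A) = cone.
Proof. by have := starM (star (cone : A)) cone; rewrite cmulx1 starK cmulx1. Qed.

Lemma nrm_cmul x y : nrm (x ** y) <= nrm x * nrm y.
Proof. by rewrite -lecR rmorphM /= !nrmE cstar_normM. Qed.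

Lemma nrm_star_sqr x : nrm (star x ** x) = nrm x ^+ 2.
Proof. by apply: (@complexI R); rewrite rmorphXn /= !nrmE cstar_norm. Qed.

Lemma nrm_star x : nrm (star x) = nrm x.
Proof.
have le y : nrm y <= nrm (star y).
  have [->|y0] := eqVneq y 0; first by rewrite nrm0 nrm_ge0.
  have ny : 0 < nrm y by rewrite lt_def nrm_ge0 nrm_eq0 y0.
  by rewrite -(ler_pM2r ny) -expr2 -nrm_star_sqr nrm_cmul.
by apply/eqP; rewrite eq_le; have := le x; have := le (star x); rewrite starK => -> ->.
Qed.

(** The C^*-identity leaves the values 0 and 1, the former in the zero algebra. *)
Lemma nrm_cone_le1 : nrm (cone : A) <= 1.
Proof.
have := nrm_star_sqr (cone : A); rewrite star_cone cmulx1 => h.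
have [->//|c0] := eqVneq (nrm (cone : A)) 0.
by rewrite -[leRHS](divff c0) {2}h expr2 mulfK.
Qed.

Definition unitary u := star u ** u = cone /\ u ** star u = cone.

Lemma unitary1 : unitary cone.
Proof. by split; rewrite star_cone cmulx1. Qed.

Lemma unitary_star u : unitary u -> unitary (star u).
Proof. by case=> h1 h2; split; rewrite starK. Qed.

Lemma unitaryM u v : unitary u -> unitary v -> unitary (u ** v).
Proof.
case=> u1 u2 [v1 v2]; split; rewrite starM !cmulA.
  by rewrite -[_ ** star u ** u]cmulA u1 cmulx1.
by rewrite -[u ** v ** _]cmulA v2 cmulx1.
Qed.

Lemma unitary_zpow u m : unitary u -> unitary (zpow u m).
Proof.
move=> hu; have it v p : unitary v -> unitary (iter p (cmul v) cone).
  by move=> hv; elim: p => [|p IH] /=; [exact: unitary1|exact: unitaryM].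
by case: m => p; apply: it => //; exact: unitary_star.
Qed.

Lemma nrm_unitary_le1 u : unitary u -> nrm u <= 1.
Proof.
move=> [h _]; rewrite -(ler_pXn2r (ltn0Sn 1)) ?nnegrE ?nrm_ge0 //.
by rewrite -nrm_star_sqr h expr1n nrm_cone_le1.
Qed.

Lemma zpowS u m : unitary u -> zpow u (m + 1) = u ** zpow u m.
Proof.
case=> h1 h2; case: m => [p|[|p]].
- by rewrite -PoszD addn1.
- by rewrite /= cmulx1 h2.
- rewrite (_ : Negz p.+1 + 1 = Negz p); last by rewrite !NegzE; lia.
  by rewrite /= !cmulA h2 cmul1x.
Qed.

Lemma zpowD u m k : unitary u -> zpow u (m + k) = zpow u m ** zpow u k.
Proof.
move=> hu; elim/int_rec: m => [|p IH|p IH]; first by rewrite add0r cmul1x.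
  by rewrite -addn1 PoszD addrAC !zpowS // IH cmulA.
have h := zpowS (- p.+1%:Z) hu.
have hk := zpowS (- p.+1%:Z + k) hu.
have e : - p.+1%:Z + 1 = - p%:Z by lia.
rewrite addrAC e IH in hk; rewrite e in h.
rewrite h -cmulA in hk.
have inj x y : u ** x = u ** y -> x = y.
  by move=> /(congr1 (cmul (star u))); rewrite !cmulA hu.1 !cmul1x.
by have := inj _ _ hk => <-.
Qed.

(** Reordering generators produces scalars of modulus 1. The estimates see only moduli of
    coefficients, so these cocycles never have to be computed. *)
Definition phase_eq x y := exists2 c : R[i], nrm c = 1 & x = c *: y.

Lemma phase_eq_refl x : phase_eq x x.
Proof. by exists 1; rewrite ?nrm_cst1 ?scale1r. Qed.

Lemma phase_eq_sym x y : phase_eq x y -> phase_eq y x.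
Proof.
case=> c c1 ->; exists c^-1; first by rewrite nrmV c1 invr1.
by rewrite scalerA mulVf ?scale1r // -nrm_eq0 c1 oner_eq0.
Qed.

Lemma phase_eq_trans y x z : phase_eq x y -> phase_eq y z -> phase_eq x z.
Proof.
by case=> c c1 -> [d d1 ->]; exists (c * d); rewrite ?scalerA // nrmM c1 d1 mulr1.
Qed.

Lemma phase_eqM x x' y y' : phase_eq x x' -> phase_eq y y' ->
  phase_eq (x ** y) (x' ** y').
Proof.
case=> c c1 -> [d d1 ->]; exists (c * d); first by rewrite nrmM c1 d1 mulr1.
by rewrite cmulZl cmulZr scalerA.
Qed.

Definition phase_comm x y := phase_eq (x ** y) (y ** x).

Lemma phase_comm_sym x y : phase_comm x y -> phase_comm y x.
Proof. exact: phase_eq_sym. Qed.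

Lemma phase_comm1 x : phase_comm x cone.
Proof. by rewrite /phase_comm cmulx1 cmul1x; exact: phase_eq_refl. Qed.

Lemma phase_commM x y z : phase_comm x y -> phase_comm x z -> phase_comm x (y ** z).
Proof.
move=> hy hz; rewrite /phase_comm cmulA.
apply: (phase_eq_trans (phase_eqM hy (phase_eq_refl z))).
by rewrite -!cmulA; exact: phase_eqM (phase_eq_refl y) hz.
Qed.

Lemma phase_comm_iter x y p : phase_comm x y -> phase_comm x (iter p (cmul y) cone).
Proof.
by move=> h; elim: p => [|p IH] /=; [exact: phase_comm1|exact: phase_commM].
Qed.

Lemma phase_comm_star x y : unitary x -> phase_comm x y -> phase_comm (star x) y.
Proof.
case=> h1 h2 [c c1 e]; apply: phase_eq_sym; exists c => //.
have := congr1 (fun t => star x ** t ** star x) e.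
rewrite /= cmulA h1 cmul1x => ->.
by rewrite cmulZr cmulZl !cmulA -[_ ** x ** star x]cmulA h2 cmulx1.
Qed.

Lemma phase_comm_zpow x y m k : unitary x -> unitary y -> phase_comm x y ->
  phase_comm (zpow x m) (zpow y k).
Proof.
move=> hx hy h.
have aux z j : phase_comm z y -> phase_comm z (zpow y j).
  case: j => p hz; first exact: phase_comm_iter.
  apply: (@phase_comm_iter _ _ p.+1).
  by apply/phase_comm_sym/phase_comm_star => //; exact: phase_comm_sym.
apply: aux; apply: phase_comm_sym; case: m => p.
  by apply: phase_comm_iter; exact: phase_comm_sym.
by apply: (@phase_comm_iter _ _ p.+1); apply/phase_comm_sym/phase_comm_star.
Qed.

End CStarBasics.

Section Monomials.
Variables (R : realType) (n : nat) (theta : 'M[R]_n) (T : nctorus theta).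
Local Notation Zn := 'rV[int]_n.
Local Notation U k := (mono (@nc_gen R n theta T) k).
Implicit Types (k l r : Zn) (x y : T).

Lemma gen_unitary j : unitary (@nc_gen R n theta T j).
Proof. by have [h _] := @nc_rel R n theta T; exact: h. Qed.

Lemma gen_phase_comm i j : phase_comm (nc_gen T i) (nc_gen T j).
Proof.
have [_ h] := @nc_rel R n theta T; rewrite /phase_comm h.
by exists (expi (2 * pi * theta j i)); rewrite ?nrm_expi.
Qed.

Lemma mono_unitary k : unitary (U k).
Proof.
rewrite /mono; apply: big_ind => [||j _]; [exact: unitary1|exact: unitaryM|].
exact/unitary_zpow/gen_unitary.
Qed.

Lemma mono0 : U 0 = cone.
Proof.
rewrite /mono; elim: (index_enum _) => [|j s IH]; first by rewrite big_nil.
by rewrite big_cons IH mxE /= cmulx1.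
Qed.

Lemma monoM k l : phase_eq (U k ** U l) (U (k + l)).
Proof.
rewrite /mono; elim: (index_enum _) => [|j s IH].
  by rewrite !big_nil cmulx1; exact: phase_eq_refl.
rewrite !big_cons mxE zpowD; last exact: gen_unitary.
set a := zpow _ _; set b := zpow _ _; set p := bigop.body _ _ _; set q := bigop.body _ _ _.
(* To join [a], the power [b] of the same generator must pass the remaining powers [p] of the first
   monomial. *)
have pb : phase_comm b p.
  rewrite /p; elim: (s) => [|i s' IH']; first by rewrite big_nil; exact: phase_comm1.
  rewrite big_cons; apply: phase_commM => //.
  by apply: phase_comm_zpow; [exact: gen_unitary|exact: gen_unitary|exact: gen_phase_comm].
have -> : a ** p ** (b ** q) = a ** (p ** b) ** q by rewrite !cmulA.
apply: (@phase_eq_trans _ _ (a ** (b ** p) ** q)).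
  apply: phase_eqM (phase_eq_refl _); apply: phase_eqM (phase_eq_refl _) _.
  exact: phase_comm_sym.
rewrite -[a ** (b ** p) ** q]cmulA -[b ** p ** q]cmulA cmulA.
exact: phase_eqM (phase_eq_refl _) IH.
Qed.

Lemma star_mono k : phase_eq (star (U k)) (U (- k)).
Proof.
have h : phase_eq cone (U k ** U (- k)).
  by apply: phase_eq_sym; have := monoM k (- k); rewrite subrr mono0.
have := phase_eqM (phase_eq_refl (star (U k))) h.
by rewrite cmulx1 cmulA (mono_unitary k).1 cmul1x.
Qed.

Lemma mono_star k : phase_eq (U k) (star (U (- k))).
Proof. by apply: phase_eq_sym; have := star_mono (- k); rewrite opprK. Qed.

Lemma mono_mul_star k r : phase_eq (U k ** star (U r)) (star (U (r - k))).
Proof.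
apply: (phase_eq_trans (phase_eqM (phase_eq_refl _) (star_mono r))).
apply: (phase_eq_trans (monoM _ _)).
by have := mono_star (k - r); rewrite opprB.
Qed.

Lemma nrm_mono_le1 k : nrm (U k) <= 1.
Proof. exact/nrm_unitary_le1/mono_unitary. Qed.

Lemma tr0 : nc_tr (0 : T) = 0.
Proof. by have := nc_tr_linear (-1) (0 : T) 0; rewrite scaler0 addr0 mulN1r addNr. Qed.

Lemma trD x y : nc_tr (x + y) = nc_tr x + nc_tr y.
Proof. by rewrite -[x]scale1r nc_tr_linear mul1r scale1r. Qed.

Lemma trZ a x : nc_tr (a *: x) = a * nc_tr x.
Proof. by rewrite -[a *: x]addr0 nc_tr_linear tr0 addr0. Qed.

Lemma nrm_tr x : nrm (nc_tr x) <= nrm x.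
Proof. by rewrite -lecR !nrmE nc_tr_norm. Qed.

Lemma tr_mono_star k r : nc_tr (U k ** star (U r)) = (k == r)%:R.
Proof.
have [->|kr] := eqVneq k r.
  by rewrite (mono_unitary r).2 -mono0 nc_tr_mono eqxx.
have [c _ ->] := phase_eq_trans (mono_mul_star k r) (star_mono (r - k)).
by rewrite trZ nc_tr_mono opprB subr_eq0 (negbTE kr) mulr0.
Qed.

Lemma fcoefD x y k : coef (x + y) k = coef x k + coef y k.
Proof. by rewrite /coef cmulDl trD. Qed.

Lemma fcoefZ a x k : coef (a *: x) k = a * coef x k.
Proof. by rewrite /coef cmulZl trZ. Qed.

Lemma fcoefB x y k : coef (x - y) k = coef x k - coef y k.
Proof. by rewrite fcoefD -scaleN1r fcoefZ mulN1r. Qed.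

Lemma fcoef0 k : coef (0 : T) k = 0.
Proof. by rewrite -(scale0r (0 : T)) fcoefZ mul0r. Qed.

Lemma fcoef_sum I (s : seq I) (F : I -> T) k :
  coef (\sum_(i <- s) F i) k = \sum_(i <- s) coef (F i) k.
Proof. by elim: s => [|i s IH]; rewrite ?big_nil ?fcoef0 // !big_cons fcoefD IH. Qed.

Lemma nrm_coef x k : nrm (coef x k) <= nrm x.
Proof.
apply: le_trans (nrm_tr _) _; apply: le_trans (nrm_cmul _ _) _.
by rewrite nrm_star -[leRHS]mulr1 ler_wpM2l ?nrm_ge0 ?nrm_mono_le1.
Qed.

Lemma coef_mono k r : coef (U k) r = (k == r)%:R.
Proof. exact: tr_mono_star. Qed.

Lemma nrm_coefM x k r : nrm (coef (x ** U k) r) = nrm (coef x (r - k)).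
Proof.
rewrite /coef -cmulA; have [c c1 ->] := mono_mul_star k r.
by rewrite cmulZr trZ nrmM c1 mul1r.
Qed.

Lemma nrm_tr_mono x r : nrm (nc_tr (U r ** x)) = nrm (coef x (- r)).
Proof.
rewrite nc_tr_tracial /coef; have [c c1 ->] := mono_star r.
by rewrite cmulZr trZ nrmM c1 mul1r.
Qed.

End Monomials.

(** * Weighted square-summable sequences *)

Section FiniteSums.
Variable R : realType.

Lemma sum_subset (I : eqType) (s s' : seq I) (F : I -> R) :
  (forall i, 0 <= F i) -> uniq s -> {subset s <= s'} ->
  \sum_(i <- s) F i <= \sum_(i <- s') F i.
Proof.
move=> F0; elim: s s' => [|x s IH] s' /=; first by rewrite big_nil sumr_ge0.
move=> /andP[xs us] sub; have xs' : x \in s' by apply: sub; rewrite mem_head.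
rewrite big_cons (big_rem x xs') /= lerD2l; apply: IH => // y ys.
have yx : y != x by apply: contraNneq xs => <-.
by have := sub y; rewrite inE ys orbT (perm_mem (perm_to_rem xs')) inE (negbTE yx); exact.
Qed.

Lemma sum_fset_seq (V : nmodType) (I : choiceType) (s : seq I) (F : I -> V) : uniq s ->
  \sum_(i <- [fset i in s]%fset) F i = \sum_(i <- s) F i.
Proof. by move=> us; apply: perm_big; apply: uniq_perm => // x; rewrite !inE. Qed.

Lemma sum_fsetU (V : nmodType) (I : choiceType) (J K : {fset I}) (F : I -> V) :
  [disjoint J & K]%fset ->
  \sum_(i <- (J `|` K)%fset) F i = \sum_(i <- J) F i + \sum_(i <- K) F i.
Proof.
move=> JK; rewrite -big_cat; apply: perm_big; apply: uniq_perm => //.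
  rewrite cat_uniq !fset_uniq andbT /=; apply/hasPn => x xK.
  by apply: contraTN xK => /(fdisjointP JK).
by move=> x; rewrite mem_cat inE.
Qed.

Lemma cauchy_schwarz_sum I (s : seq I) (g d : I -> R) : (forall i, 0 <= g i) ->
  (\sum_(i <- s) g i * d i) ^+ 2 <= (\sum_(i <- s) g i) * \sum_(i <- s) g i * d i ^+ 2.
Proof.
move=> g0; suff [] : [/\ 0 <= \sum_(i <- s) g i, 0 <= \sum_(i <- s) g i * d i ^+ 2 &
  (\sum_(i <- s) g i * d i) ^+ 2 <= (\sum_(i <- s) g i) * \sum_(i <- s) g i * d i ^+ 2] by [].
elim: s => [|i s [a0 c0 IH]]; first by rewrite !big_nil expr0n mulr0.
rewrite !big_cons; set a := \sum_(j <- s) g j in a0 IH *.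
set c := \sum_(j <- s) g j * d j ^+ 2 in c0 IH *.
set b := \sum_(j <- s) g j * d j in IH *.
split; [by rewrite addr_ge0|by rewrite addr_ge0 // mulr_ge0 ?sqr_ge0|].
(* This bounds the cross term of the induction step: the quadratic polynomial a t^2 - 2 b t + c is
   nonnegative because b^2 <= a c. *)
have key : 2 * b * d i <= a * d i ^+ 2 + c.
  have [a00|a1] := eqVneq a 0.
    have b0 : b = 0.
      by apply/eqP; rewrite -sqrf_eq0 eq_le sqr_ge0 andbT; move: IH; rewrite a00 mul0r.
    by rewrite b0 a00 mulr0 !mul0r add0r.
  have ap : 0 < a by rewrite lt_def a1.
  rewrite -(ler_pM2l ap) -subr_ge0.
  have -> : a * (a * d i ^+ 2 + c) - a * (2 * b * d i)
    = (a * d i - b) ^+ 2 + (a * c - b ^+ 2) by ring.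
  by rewrite addr_ge0 ?sqr_ge0 // subr_ge0.
have := ler_wpM2l (g0 i) key; rewrite -subr_ge0 => h.
rewrite -subr_ge0 (_ : _ - _ = (a * c - b ^+ 2) +
   (g i * (a * d i ^+ 2 + c) - g i * (2 * b * d i))); last by ring.
by rewrite addr_ge0 // subr_ge0.
Qed.

(** Schur's test for a convolution kernel: weighted Cauchy-Schwarz uses the row sums of [g (r - k)],
    exchanging the summations uses the column sums, and [G] bounds both. *)
Lemma young_sum (I : zmodType) (g d : I -> R) (G : R) (s t : seq I) :
  (forall i, 0 <= g i) ->
  (forall u : seq I, uniq u -> \sum_(i <- u) g i <= G) -> uniq s -> uniq t ->
  \sum_(r <- s) (\sum_(k <- t) g (r - k) * d k) ^+ 2 <= G ^+ 2 * \sum_(k <- t) d k ^+ 2.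
Proof.
move=> g0 hG us ut.
have G0 : 0 <= G by have := hG [::] erefl; rewrite big_nil.
have h1 r : \sum_(k <- t) g (r - k) <= G.
  rewrite -(big_map (fun k => r - k) xpredT g); apply: hG.
  by rewrite map_inj_uniq // => k l /addrI/oppr_inj.
have h2 k : \sum_(r <- s) g (r - k) <= G.
  rewrite -(big_map (fun r => r - k) xpredT g); apply: hG.
  by rewrite map_inj_uniq // => r l /addIr.
apply: (@le_trans _ _ (\sum_(r <- s) G * \sum_(k <- t) g (r - k) * d k ^+ 2)).
  apply: ler_sum => r _; apply: le_trans (cauchy_schwarz_sum _ _ _) _ => //.
  by rewrite ler_wpM2r ?sumr_ge0 // => k _; rewrite mulr_ge0 ?sqr_ge0.
rewrite -mulr_sumr expr2 -mulrA ler_wpM2l // exchange_big /= mulr_sumr.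
by apply: ler_sum => k _; rewrite -mulr_suml ler_wpM2r ?sqr_ge0.
Qed.

End FiniteSums.

(** * Polynomial weights on the lattice and Schur's test *)

Section Weights.
Variables (R : realType) (n : nat).
Local Notation Zn := 'rV[int]_n.
Implicit Types (k l r : Zn) (s m N : R).

(** The square of the Japanese bracket: order m corresponds to the exponent m / 2. *)
Definition jap k : R := 1 + enorm (zvec R k) ^+ 2.

Lemma enorm_sqr (x : 'rV[R]_n) : enorm x ^+ 2 = \sum_(j < n) (x ord0 j) ^+ 2.
Proof. by rewrite sqr_sqrtr // sumr_ge0 // => j _; exact: sqr_ge0. Qed.

Lemma japE k : jap k = 1 + \sum_(j < n) (k ord0 j)%:~R ^+ 2.
Proof. by rewrite /jap enorm_sqr; congr (_ + _); apply: eq_bigr => j _; rewrite mxE. Qed.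

Lemma jap_ge1 k : 1 <= jap k.
Proof. by rewrite lerDl sqr_ge0. Qed.

Lemma jap_gt0 k : 0 < jap k. Proof. exact: lt_le_trans (jap_ge1 k). Qed.
Hint Resolve jap_gt0 jap_ge1 : core.

Lemma japN k : jap (- k) = jap k.
Proof. by rewrite !japE; congr (_ + _); apply: eq_bigr => j _; rewrite mxE rmorphN sqrrN. Qed.

Lemma japD k l : jap (k + l) <= 2 * jap k * jap l.
Proof.
rewrite !japE; set a := \sum_(j < n) (k ord0 j)%:~R ^+ 2; set b := \sum_(j < n) (l ord0 j)%:~R ^+ 2.
have a0 : 0 <= a by apply: sumr_ge0 => j _; exact: sqr_ge0.
have b0 : 0 <= b by apply: sumr_ge0 => j _; exact: sqr_ge0.
have : \sum_(j < n) ((k + l) ord0 j)%:~R ^+ 2 <= 2 * a + 2 * b.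
  rewrite /a /b !mulr_sumr -big_split /=; apply: ler_sum => j _; rewrite mxE rmorphD /=.
  rewrite -subr_ge0 (_ : _ - _ = ((k ord0 j)%:~R - (l ord0 j)%:~R) ^+ 2); last by ring.
  exact: sqr_ge0.
have ab : 0 <= a * b by rewrite mulr_ge0.
by rewrite (_ : 2 * (1 + a) * (1 + b) = 2 + 2 * a + 2 * b + 2 * (a * b)); [lra|ring].
Qed.

Lemma jap_powRD k s m : jap k `^ (s + m) = jap k `^ s * jap k `^ m.
Proof. by rewrite powRD // (gt_eqF (jap_gt0 k)) implybT. Qed.

Lemma jap_powR_sqr k s : (jap k `^ (s / 2)) ^+ 2 = jap k `^ s.
Proof. by rewrite -powR_mulrn ?powR_ge0 // -powRrM divfK. Qed.

Lemma jap_powR_le k s m : s <= m -> jap k `^ s <= jap k `^ m.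
Proof. by move=> sm; apply: ler_powR. Qed.

(** Peetre's inequality. For s >= 0 it is a power of [japD]; for s < 0 the case -s is used with [k]
    and [l] exchanged, and inverted. *)
Lemma peetre s k l : jap k `^ s <= 2 `^ `|s| * jap l `^ s * jap (k - l) `^ `|s|.
Proof.
have j0 k' : jap k' \in Num.nneg by rewrite nnegrE ltW.
have aux p q (t : R) : 0 <= t -> jap p `^ t <= 2 `^ t * jap q `^ t * jap (p - q) `^ t.
  move=> t0; rewrite -!powRM ?mulr_ge0 ?(ltW (jap_gt0 _)) //.
  apply: ge0_ler_powR => //; first by rewrite nnegrE !mulr_ge0 // ltW.
  by rewrite -[X in jap X <= _](subrK q p) addrC japD.
have [s0|s0] := leP 0 s; first by rewrite ger0_norm // aux.
have t0 : 0 <= - s by lra.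
rewrite ltr0_norm //; have := aux l k _ t0; rewrite -(japN (l - k)) opprB.
have ek p : jap p `^ s = (jap p `^ (- s))^-1 by rewrite powRN invrK.
rewrite (ek k) (ek l).
have := powR_gt0 (- s) (jap_gt0 k); have := powR_gt0 (- s) (jap_gt0 l).
move: (jap k `^ (- s)) (jap l `^ (- s)) (jap (k - l) `^ (- s)) (2 `^ (- s)) => x y z c y0 x0 h.
rewrite -(ler_pM2l (mulr_gt0 x0 y0)) mulrAC divff ?gt_eqF // mul1r.
by apply: le_trans h _; rewrite le_eqVlt; apply/orP; left; apply/eqP; field; rewrite gt_eqF.
Qed.

(** The correction 6 / (L + 2) makes the induction telescope: raising L by one adds two equal terms,
    each at most 3 / (L + 2) - 3 / (L + 3). *)
Lemma inv_sqr_sum (L : nat) :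
  \sum_(i < (L + L).+1) (1 + ((i%:Z - L%:Z)%:~R : R) ^+ 2)^-1 <= 6 - 6 / (L%:R + 2).
Proof.
elim: L => [|L IH].
  by rewrite big_ord_recl big_ord0 addr0 /= subrr expr0n addr0 invr1 add0r; lra.
rewrite addSn addnS big_ord_recl big_ord_recr /=.
have -> : \sum_(i < (L + L).+1) (1 + ((bump 0 (widen_ord (leqnSn (L + L).+1) i))%:Z - L.+1%:Z)%:~R ^+ 2 : R)^-1
   = \sum_(i < (L + L).+1) (1 + ((i%:Z - L%:Z)%:~R : R) ^+ 2)^-1.
  apply: eq_bigr => i _; congr (_^-1); congr (1 + _ ^+ 2); congr (_%:~R).
  by rewrite /bump /=; lia.
have e1 : (0%:Z - L.+1%:Z)%:~R ^+ 2 = (L%:R + 1) ^+ 2 :> R.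
  by rewrite sub0r rmorphN sqrrN /= -addn1 PoszD rmorphD.
have e2 : ((bump 0 (L + L).+1)%:Z - L.+1%:Z)%:~R ^+ 2 = (L%:R + 1) ^+ 2 :> R.
  congr (_ ^+ 2); rewrite /bump /= (_ : _ - _ = L%:Z + 1); last by lia.
  by rewrite rmorphD.
rewrite e1 e2 -(natr1 L).
set x : R := L%:R in IH *; have x0 : 0 <= x by rewrite /x ler0n.
have tail : (1 + (x + 1) ^+ 2)^-1 <= 3 / (x + 2) - 3 / (x + 3).
  have -> : 3 / (x + 2) - 3 / (x + 3) = 3 / ((x + 2) * (x + 3)).
    by field; apply/andP; split; rewrite gt_eqF //; lra.
  rewrite -[leLHS]mul1r ler_pdivrMr; last by nra.
  rewrite mulrAC ler_pdivlMr; last by nra.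
  have [x00|x1] : x = 0 \/ 1 <= x.
    by rewrite /x; case: (L) => [|L']; [left|right; rewrite ler1n].
    by rewrite x00; lra.
  by nra.
have -> : x + 1 + 2 = x + 3 by ring.
by move: IH tail; lra.
Qed.

(** Indexing the cube by functions lets sums of products over coordinates factor. *)
Definition box_row (L : nat) (f : {ffun 'I_n -> 'I_(L + L).+1}) : Zn :=
  \row_j ((f j)%:Z - L%:Z).

Definition box (L : nat) : seq Zn := [seq box_row f | f : {ffun 'I_n -> 'I_(L + L).+1}].

Lemma mem_box L k : (forall j, (`|k ord0 j| <= L)%N) -> k \in box L.
Proof.
move=> h; have hj j : (absz (k ord0 j + L%:Z)%R < (L + L).+1)%N by have := h j; lia.
apply/mapP; exists [ffun j => Ordinal (hj j)]; first by rewrite mem_enum.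
apply/rowP => j; rewrite mxE ffunE /= [k _ _](_ : _ = k ord0 j) //.
by have := h j; lia.
Qed.

Lemma size_box L : size (box L) = ((L + L).+1 ^ n)%N.
Proof. by rewrite size_map -cardE card_ffun !card_ord. Qed.

(** The n-th power of [jap k] dominates the product of the 1 + k_j^2, so over a box containing [s]
    the sum is bounded by a product of n one-dimensional sums, each at most 6. *)
Lemma jap_sum (s : seq Zn) : uniq s -> \sum_(k <- s) jap k `^ (- n%:R) <= 6 ^+ n.
Proof.
move=> us; pose L := (\sum_(k <- s) \sum_(j < n) `|k ord0 j|)%N.
pose a (i : int) : R := (1 + i%:~R ^+ 2)^-1.
have a0 i : 0 <= a i by rewrite invr_ge0 addr_ge0 ?sqr_ge0.
have sub : {subset s <= box L}.
  move=> k ks; apply: mem_box => j; rewrite /L (big_rem k ks) /= (bigD1 j) //=.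
  by rewrite -addnA leq_addr.
have b k : jap k `^ (- n%:R) <= \prod_(j < n) a (k ord0 j).
  rewrite powRN powR_mulrn ?(ltW (jap_gt0 _)) // /a prodfV.
  have p j : 0 < 1 + (k ord0 j)%:~R ^+ 2 :> R by rewrite ltr_wpDr ?sqr_ge0.
  rewrite lef_pV2 ?posrE ?exprn_gt0 //; last by apply: prodr_gt0.
  rewrite -[n in _ ^+ n]card_ord -prodr_const.
  apply: ler_prod => j _; rewrite ltW //= japE lerD2l (bigD1 j) //= lerDl sumr_ge0 // => i _; exact: sqr_ge0.
apply: le_trans (ler_sum _ (fun k _ => b k)) _.
apply: (le_trans (@sum_subset R _ s (box L) (fun k => \prod_(j < n) a (k ord0 j)) _ us sub)).
  by move=> k; apply: prodr_ge0.
rewrite /box big_image /=.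
under eq_bigr do under eq_bigr do rewrite mxE.
rewrite -(bigA_distr_bigA (fun (j : 'I_n) (i : 'I_(L + L).+1) => a (i%:Z - L%:Z))) /=.
rewrite -[n in _ ^+ n]card_ord -prodr_const; apply: ler_prod => j _.
rewrite sumr_ge0 //=; apply: le_trans (inv_sqr_sum L) _.
by rewrite gerBl divr_ge0 // addr_ge0.
Qed.

(** For B >= 0, the W_2^s norm of the coefficients [c] is at most [B]. Quantifying over finite sets
    makes convergence part of the statement. *)
Definition wb s (c : Zn -> R[i]) (B : R) := forall K : {fset Zn},
  \sum_(k <- K) jap k `^ s * nrm (c k) ^+ 2 <= B ^+ 2.

Lemma wb_le s c B B' : 0 <= B -> B <= B' -> wb s c B -> wb s c B'.
Proof.
move=> B0 BB h K; apply: le_trans (h K) _.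
by rewrite ler_pXn2r ?nnegrE // (le_trans B0).
Qed.

Lemma wb_point s c B k : 0 <= B -> wb s c B -> jap k `^ (s / 2) * nrm (c k) <= B.
Proof.
move=> B0 /(_ [fset k]%fset); rewrite big_seq_fset1 => h.
rewrite -(ler_pXn2r (ltn0Sn 1)) ?nnegrE ?mulr_ge0 ?nrm_ge0 ?powR_ge0 //.
by rewrite exprMn jap_powR_sqr.
Qed.

Lemma wb_weaken s s' c B : s' <= s -> wb s c B -> wb s' c B.
Proof.
move=> ss h K; apply: le_trans (h K); apply: ler_sum => k _.
by rewrite ler_wpM2r ?sqr_ge0 // jap_powR_le.
Qed.

Lemma wb_lin s c c' B B' (a : R[i]) : 0 <= B -> 0 <= B' -> wb s c B -> wb s c' B' ->
  wb s (fun k => a * c k + c' k) (2 * (nrm a * B + B')).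
Proof.
move=> B0 B0' h h' K.
apply: (@le_trans _ _ (\sum_(k <- K) (2 * nrm a ^+ 2 * (jap k `^ s * nrm (c k) ^+ 2)
   + 2 * (jap k `^ s * nrm (c' k) ^+ 2)))).
  apply: ler_sum => k _; set w := _ `^ _.
  have w0 : 0 <= w by rewrite powR_ge0.
  apply: (@le_trans _ _ (w * (nrm a * nrm (c k) + nrm (c' k)) ^+ 2)).
    rewrite ler_wpM2l // ler_pXn2r ?nnegrE ?addr_ge0 ?mulr_ge0 ?nrm_ge0 //.
    by rewrite -nrmM nrmD.
  set x := nrm a * _; set y := nrm (c' k).
  have -> : 2 * nrm a ^+ 2 * (w * nrm (c k) ^+ 2) = 2 * (w * x ^+ 2) by rewrite /x; ring.
  rewrite -subr_ge0 (_ : _ - _ = w * (x - y) ^+ 2); last by ring.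
  by rewrite mulr_ge0 ?sqr_ge0.
rewrite big_split /= -!mulr_sumr.
apply: (@le_trans _ _ (2 * nrm a ^+ 2 * B ^+ 2 + 2 * B' ^+ 2)).
  by rewrite lerD // ler_wpM2l // mulr_ge0 ?sqr_ge0.
have p : 0 <= nrm a * B * B' by rewrite !mulr_ge0 ?nrm_ge0.
rewrite -subr_ge0 (_ : _ - _ = 2 * (nrm a * B) ^+ 2 + 2 * B' ^+ 2 + 8 * (nrm a * B * B')); last by ring.
by have := sqr_ge0 (nrm a * B); have := sqr_ge0 B'; lra.
Qed.

(** Cauchy-Schwarz against the summable weight [jap k ^ -n]: absolute summability costs n / 2 in the
    exponent of [jap]. *)
Lemma wb_l1 s c B (K : seq Zn) : 0 <= B -> uniq K -> wb s c B ->
  \sum_(k <- K) jap k `^ ((s - n%:R) / 2) * nrm (c k) <= 6 ^+ n * B.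
Proof.
move=> B0 uK h; have h6 : (1 : R) <= 6 ^+ n by rewrite exprn_ege1 // ler1n.
rewrite -(ler_pXn2r (ltn0Sn 1)) ?nnegrE; last 2 first.
- by rewrite sumr_ge0 // => k _; rewrite mulr_ge0 ?powR_ge0 ?nrm_ge0.
- by rewrite mulr_ge0 // (le_trans _ h6).
pose g k := jap k `^ (- n%:R); pose d k := jap k `^ ((s + n%:R) / 2) * nrm (c k).
have -> : \sum_(k <- K) jap k `^ ((s - n%:R) / 2) * nrm (c k) = \sum_(k <- K) g k * d k.
  apply: eq_bigr => k _; rewrite /g /d mulrA -jap_powRD; by congr (_ `^ _ * _); field.
apply: (le_trans (cauchy_schwarz_sum _ _ _)); first by move=> k; exact: powR_ge0.
have hd : \sum_(k <- K) g k * d k ^+ 2 <= B ^+ 2.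
  have := h [fset k in K]%fset; rewrite sum_fset_seq // => hK.
  apply: le_trans hK; apply: ler_sum => k _.
  by rewrite /d exprMn jap_powR_sqr mulrA -jap_powRD addrC addrK.
rewrite exprMn; apply: ler_pM => //.
- by rewrite sumr_ge0 // => k _; exact: powR_ge0.
- by rewrite sumr_ge0 // => k _; rewrite mulr_ge0 ?sqr_ge0 ?powR_ge0.
apply: le_trans (jap_sum uK) _.
by rewrite expr2 -[leLHS]mulr1 ler_wpM2l // (le_trans _ h6).
Qed.

Definition schur_const s : R := 2 `^ (`|s| / 2) * 6 ^+ n.

Lemma schur_const_ge0 s : 0 <= schur_const s.
Proof. by rewrite mulr_ge0 ?powR_ge0 ?exprn_ge0. Qed.

(** Peetre's inequality moves the weight from [r] to [k] at the price of [jap (r - k)] to the power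
    |s| / 2. The decay N absorbs this and leaves the summable convolution kernel [jap ^ -n]. The
    factors of [schur_const] are Peetre's constant and the bound of [jap_sum]. *)
Lemma schur s m N A B (M : Zn -> Zn -> R[i]) (c : Zn -> R[i]) (K : {fset Zn}) :
  0 <= A -> 0 <= B -> `|s| / 2 + n%:R <= N ->
  (forall r k, nrm (M r k) <= A * jap (r - k) `^ (- N) * jap k `^ (m / 2)) ->
  wb (s + m) c B ->
  wb s (fun r => \sum_(k <- K) M r k * c k) (schur_const s * A * B).
Proof.
move=> A0 B0 hN hM hc Rs.
pose g l := jap l `^ (- n%:R); pose d k := jap k `^ ((s + m) / 2) * nrm (c k).
pose D := 2 `^ (`|s| / 2) * A.
have D0 : 0 <= D by rewrite mulr_ge0 ?powR_ge0.
have entry r k : jap r `^ (s / 2) * nrm (M r k * c k) <= D * (g (r - k) * d k).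
  rewrite nrmM.
  apply: (@le_trans _ _ ((2 `^ (`|s| / 2) * jap k `^ (s / 2) * jap (r - k) `^ (`|s| / 2))
     * ((A * jap (r - k) `^ (- N) * jap k `^ (m / 2)) * nrm (c k)))).
    apply: ler_pM; rewrite ?powR_ge0 ?mulr_ge0 ?nrm_ge0 //.
      by have := peetre (s / 2) r k; rewrite normrM (ger0_norm (x := 2^-1)).
    by rewrite ler_wpM2r ?nrm_ge0.
  have : jap (r - k) `^ (`|s| / 2) * jap (r - k) `^ (- N) <= g (r - k).
    by rewrite -jap_powRD; apply: jap_powR_le; lra.
  rewrite /d mulrDl jap_powRD /D.
  have := nrm_ge0 (c k).
  have := powR_ge0 (jap k) (s / 2); have := powR_ge0 (jap k) (m / 2).
  have := powR_ge0 2 (`|s| / 2).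
  move: (2 `^ (`|s| / 2)) (jap k `^ (s / 2)) (jap k `^ (m / 2)) (jap (r - k) `^ (`|s| / 2))
    (jap (r - k) `^ (- N)) (g (r - k)) (nrm (c k)).
  clear -A0 => c2 x1 x2 y1 y2 G C c20 x20 x10 C0 hG.
  rewrite [leLHS](_ : _ = (c2 * A * x1 * x2 * C) * (y1 * y2)); last by ring.
  rewrite [leRHS](_ : _ = (c2 * A * x1 * x2 * C) * G); last by ring.
  by apply: ler_wpM2l => //; rewrite !mulr_ge0.
apply: (@le_trans _ _ (\sum_(r <- Rs) (D * \sum_(k <- K) g (r - k) * d k) ^+ 2)).
  apply: ler_sum => r _; rewrite -jap_powR_sqr -exprMn.
  rewrite ler_pXn2r ?nnegrE ?mulr_ge0 ?nrm_ge0 ?powR_ge0 //; last first.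
    by rewrite sumr_ge0 // => k _; rewrite !mulr_ge0 ?nrm_ge0 ?powR_ge0.
  apply: le_trans (ler_wpM2l (powR_ge0 _ _) (nrm_sum _ _ _)) _.
  by rewrite !mulr_sumr; apply: ler_sum.
under eq_bigr do rewrite exprMn.
rewrite -mulr_sumr.
apply: (@le_trans _ _ (D ^+ 2 * ((6 ^+ n) ^+ 2 * \sum_(k <- K) d k ^+ 2))).
  rewrite ler_wpM2l ?sqr_ge0 //; apply: young_sum; rewrite ?fset_uniq //.
    by move=> k; exact: powR_ge0.
  by move=> u uu; exact: jap_sum.
rewrite [leRHS](_ : _ = D ^+ 2 * ((6 ^+ n) ^+ 2 * B ^+ 2)); last first.
  by rewrite /schur_const /D; ring.
rewrite !ler_wpM2l ?sqr_ge0 //.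
apply: le_trans (hc K); apply: ler_sum => k _.
by rewrite /d exprMn jap_powR_sqr.
Qed.

(** A finite set whose partial sum is within [e] of the supremum leaves at most [e] for anything
    disjoint from it. *)
Lemma wb_tail s c B (e : R) : 0 < e -> wb s c B -> exists J : {fset Zn},
  forall K : {fset Zn}, [disjoint J & K]%fset ->
    \sum_(k <- K) jap k `^ s * nrm (c k) ^+ 2 <= e.
Proof.
move=> e0 h; pose F k := jap k `^ s * nrm (c k) ^+ 2.
have F0 k : 0 <= F k by rewrite mulr_ge0 ?powR_ge0 ?sqr_ge0.
pose E := [set x | exists K : {fset Zn}, x = \sum_(k <- K) F k].
have hs : has_sup E.
  split; first by exists (\sum_(k <- fset0) F k), fset0.
  by exists (B ^+ 2) => _ [K ->]; exact: h.
have [_ [J ->] hJ] := sup_adherent e0 hs.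
exists J => K JK.
have : \sum_(k <- (J `|` K)%fset) F k <= sup E.
  by apply: ub_le_sup; [case: hs|exists (J `|` K)%fset].
have -> : \sum_(k <- (J `|` K)%fset) F k = \sum_(k <- J) F k + \sum_(k <- K) F k.
  by rewrite sum_fsetU.
by move: hJ; rewrite -/F; lra.
Qed.

End Weights.
#[export] Hint Resolve jap_gt0 jap_ge1 : core.

(** * Unconditional summation over the lattice *)

Section Summation.
Variables (R : realType) (n : nat).
Local Notation Zn := 'rV[int]_n.

#[export] Instance zfilter_proper : ProperFilter (zfilter (n := n)).
Proof.
split; first by move=> [J] /(_ J (fsubset_refl J)).
split; first by exists fset0.
- move=> P Q [J hJ] [J' hJ']; exists (J `|` J')%fset => K.
  by rewrite fsubUset => /andP[? ?]; split; [exact: hJ|exact: hJ'].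
- by move=> P Q PQ [J hJ]; exists J => K /hJ /PQ.
Qed.

(** [zsums_to] with an arbitrary target, so that it also serves scalars and L_2. *)
Definition hsum (V : normedModType R[i]) (f : Zn -> V) (a : V) :=
  ((fun K : {fset Zn} => \sum_(k <- K) f k) @ zfilter (n := n)) --> a.

Variables (V : normedModType R[i]).
Implicit Types (f g : Zn -> V) (a b : V).

Lemma hsumP f a : hsum f a <-> forall e : R, 0 < e ->
  exists J : {fset Zn}, forall K : {fset Zn}, (J `<=` K)%fset ->
    nrm (\sum_(k <- K) f k - a) < e.
Proof. exact: cvg_nrmP. Qed.

Lemma hsum_unique f a b : hsum f a -> hsum f b -> a = b.
Proof. exact: cvg_unique. Qed.

Lemma hsum_lin c f g a b : hsum f a -> hsum g b ->
  hsum (fun k => c *: f k + g k) (c *: a + b).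
Proof.
move=> fa gb; rewrite /hsum.
under eq_fun do rewrite big_split /= -scaler_sumr.
by apply: cvgD => //; apply: cvgZr.
Qed.

Lemma hsum_bound f a (B : R) : hsum f a ->
  (forall K : {fset Zn}, nrm (\sum_(k <- K) f k) <= B) -> nrm a <= B.
Proof.
move=> /hsumP h hB; apply/ler_addgt0Pr => e e0.
have [J hJ] := h e e0; have := hJ J (fsubset_refl J).
rewrite nrm_sub => hj; rewrite -[a](subrK (\sum_(k <- J) f k)).
by apply: le_trans (nrmD _ _) _; rewrite addrC lerD // ltW.
Qed.

Lemma hsum_ext f g a : f =1 g -> hsum f a -> hsum g a.
Proof. by move=> /funext ->. Qed.

Lemma sum_fset_sub (J K : {fset Zn}) f : (J `<=` K)%fset ->
  \sum_(k <- K) f k = \sum_(k <- J) f k + \sum_(k <- (K `\` J)%fset) f k.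
Proof.
move=> JK; rewrite -sum_fsetU; last first.
  by apply/fdisjointP => x xJ; rewrite inE xJ.
congr (\sum_(k <- _) _); apply/congr1/fsetP => x; rewrite !inE.
by case xJ : (x \in J) => //=; rewrite (fsubsetP JK).
Qed.

Lemma hsum_fin (J : {fset Zn}) f : (forall k, k \notin J -> f k = 0) ->
  hsum f (\sum_(k <- J) f k).
Proof.
move=> h; apply/hsumP => e e0; exists J => K JK.
rewrite (sum_fset_sub _ JK) addrC addKr big1_fset ?nrm0 // => k.
by rewrite inE => /andP[kJ _] _; exact: h.
Qed.

Lemma hsum_reindex (s t : Zn -> Zn) f a : cancel s t -> cancel t s ->
  hsum f a -> hsum (fun k => f (s k)) a.
Proof.
move=> st ts /hsumP h; apply/hsumP => e e0; have [J hJ] := h e e0.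
exists [fset t k | k in J]%fset => K JK.
have <- : \sum_(k <- [fset s k | k in K]%fset) f k = \sum_(k <- K) f (s k).
  by rewrite big_imfset //= => x y _ _; exact: can_inj st _ _.
apply: hJ; apply/fsubsetP => k kJ; apply/imfsetP; exists (t k); rewrite ?ts //=.
by apply: (fsubsetP JK); apply: in_imfset.
Qed.

End Summation.

Section CompleteSummation.
Variables (R : realType) (n : nat).
Local Notation Zn := 'rV[int]_n.

Lemma hsum_linear (V W : normedModType R[i]) (phi : V -> W) (C : R)
    (f : Zn -> V) (a : V) :
  (forall c x y, phi (c *: x + y) = c *: phi x + phi y) ->
  (forall x, nrm (phi x) <= C * nrm x) ->
  hsum f a -> hsum (fun k => phi (f k)) (phi a).
Proof.
move=> lin bd /hsumP h; apply/hsumP => e e0.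
have C0 : 0 < `|C| + 1 by rewrite ltr_wpDl.
have [J hJ] := h (e / (`|C| + 1)) (divr_gt0 e0 C0).
have phi0 : phi 0 = 0.
  by have := lin (-1) 0 0; rewrite scaler0 addr0 scaleN1r addNr.
have phiB x y : phi (x - y) = phi x - phi y.
  by rewrite -[y in LHS]scale1r -scaleNr addrC lin scaleNr scale1r addrC.
have phis (s : seq Zn) : phi (\sum_(k <- s) f k) = \sum_(k <- s) phi (f k).
  elim: s => [|k s IH]; first by rewrite !big_nil.
  by rewrite !big_cons -IH -[f k]scale1r lin !scale1r.
exists J => K JK; rewrite -phis -phiB.
apply: le_lt_trans (bd _) _.
apply: (@le_lt_trans _ _ ((`|C| + 1) * nrm (\sum_(k <- K) f k - a))).
  rewrite ler_wpM2r ?nrm_ge0 //; apply: le_trans (ler_norm _) _; by rewrite lerDl.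
by rewrite mulrC -ltr_pdivlMr // hJ.
Qed.

Lemma hsum_cauchy (V : completeNormedModType R[i]) (f : Zn -> V) :
  (forall e : R, 0 < e -> exists J : {fset Zn}, forall K : {fset Zn},
    [disjoint J & K]%fset -> nrm (\sum_(k <- K) f k) < e) ->
  exists a, hsum f a.
Proof.
move=> H; suff : cvg ((fun K : {fset Zn} => \sum_(k <- K) f k) @ zfilter (n := n)).
  by move=> /cvg_ex[a ha]; exists a.
apply: cauchy_cvg; apply: cauchy_exP => _ /pos_complexP[d d0 ->].
have [J hJ] := H d d0; exists (\sum_(k <- J) f k), J => K JK.
rewrite -ball_normE /= nrm_lt nrm_sub (sum_fset_sub _ JK) addrC addKr.
by apply: hJ; apply/fdisjointP => x xJ; rewrite inE xJ.
Qed.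

Lemma sum_tail (g : Zn -> R) (B e : R) : 0 < e -> (forall k, 0 <= g k) ->
  (forall K : {fset Zn}, \sum_(k <- K) g k <= B) ->
  exists J : {fset Zn}, forall K : {fset Zn}, [disjoint J & K]%fset ->
    \sum_(k <- K) g k < e.
Proof.
move=> e0 g0 hB.
(* Square roots turn a summable family into a square-summable one, to which [wb_tail] applies. *)
have h : wb 0 (fun k => (Num.sqrt (g k))%:C%C) (Num.sqrt B).
  move=> K; have B0 : 0 <= B by apply: le_trans (hB fset0); rewrite big_seq_fset0.
  rewrite sqr_sqrtr //; apply: le_trans (hB K); apply: ler_sum => k _.
  by rewrite powRr0 mul1r nrm_real ger0_norm ?sqrtr_ge0 // sqr_sqrtr.
have [J hJ] := wb_tail (divr_gt0 e0 (ltr0Sn R 1)) h.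
exists J => K /hJ hK; apply: (@le_lt_trans _ _ (e / 2)).
  apply: le_trans hK; apply: ler_sum => k _.
  by rewrite powRr0 mul1r nrm_real ger0_norm ?sqrtr_ge0 // sqr_sqrtr.
by rewrite ltr_pdivrMr // ltr_pMr // ltr1n.
Qed.

Lemma hsum_abs (V : completeNormedModType R[i]) (f : Zn -> V) (g : Zn -> R) (B : R) :
  (forall k, nrm (f k) <= g k) -> (forall K : {fset Zn}, \sum_(k <- K) g k <= B) ->
  exists2 a, hsum f a & nrm a <= B.
Proof.
move=> fg hB.
have g0 k : 0 <= g k by apply: le_trans (fg k); exact: nrm_ge0.
have [|a ha] := @hsum_cauchy V f.
  move=> e e0; have [J hJ] := sum_tail e0 g0 hB; exists J => K /hJ.
  apply: le_lt_trans; apply: le_trans (nrm_sum _ _ _) _.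
  by apply: ler_sum.
exists a => //; apply: hsum_bound ha _ => K.
by apply: le_trans (nrm_sum _ _ _) _; apply: le_trans (hB K); exact: ler_sum.
Qed.

(** Each inequality in [wb] involves finitely many coordinates, hence survives coordinatewise
    limits. *)
Lemma wb_hsum (s : R) (F : Zn -> Zn -> R[i]) (d : Zn -> R[i]) (B : R) :
  (forall K : {fset Zn}, wb s (fun r => \sum_(k <- K) F r k) B) ->
  (forall r, hsum (V := R[i]) (F r) (d r)) -> wb s d B.
Proof.
move=> hB hd Rs.
pose G (K : {fset Zn}) := \sum_(r <- Rs) jap R r `^ s * nrm (\sum_(k <- K) F r k) ^+ 2.
have key : G @ zfilter (n := n) --> \sum_(r <- Rs) jap R r `^ s * nrm (d r) ^+ 2.
  rewrite /G; apply: cvg_big => [|r _]; first exact: (@add_continuous R).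
  apply: cvgM; first exact: cvg_cst.
  rewrite expr2; under eq_fun do rewrite expr2.
  have hn : nrm (\sum_(k <- K) F r k) @[K --> zfilter (n := n)] --> nrm (d r).
    apply/cvgrPdist_lt => e e0; have [J hJ] := (hsumP _ _).1 (hd r) e e0.
    exists J => K /hJ; apply: le_lt_trans.
    rewrite ler_norml; set x := \sum_(k <- K) F r k.
    have := nrmD (x - d r) (d r); rewrite subrK.
    have := nrmD (d r - x) x; rewrite subrK (nrm_sub (d r)); lra.
  by apply: cvgM; exact: hn.
apply: (closed_cvg (fun x => x <= B ^+ 2)) key; first exact: closed_le.
by exists fset0 => K _; exact: hB.
Qed.

End CompleteSummation.

(** * Smooth elements and their coefficients *)

Section Smooth.
Variables (R : realType) (n : nat) (theta : 'M[R]_n) (T : nctorus theta).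
Local Notation Zn := 'rV[int]_n.
Local Notation U k := (mono (@nc_gen R n theta T) k).
Implicit Types (k l r : Zn) (x y a : T) (c : Zn -> R[i]).

(** Completeness is borrowed from the algebra: the multiples [f k *: cone] are summed there, and the
    trace, equal to 1 at [cone], brings the sum back. *)
Lemma hsum_absC (f : Zn -> R[i]) (g : Zn -> R) (B : R) :
  (forall k, nrm (f k) <= g k) -> (forall K : {fset Zn}, \sum_(k <- K) g k <= B) ->
  exists2 a : R[i], hsum (V := R[i]) f a & nrm a <= B.
Proof.
move=> fg hB.
have [|a ha _] := @hsum_abs R n T (fun k => f k *: cone) g B _ hB.
  move=> k; rewrite nrmZ; apply: le_trans (fg k).
  by rewrite -[leRHS]mulr1 ler_wpM2l ?nrm_ge0 ?nrm_cone_le1.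
have tc : nc_tr (cone : T) = 1 by rewrite -(mono0 T) nc_tr_mono eqxx.
have h : hsum (V := R[i]) f (nc_tr a).
  apply: hsum_ext (hsum_linear (W := R[i]) (phi := @nc_tr _ _ _ T) (C := 1) _ _ ha).
  - by move=> k; rewrite trZ tc mulr1.
  - exact: nc_tr_linear.
  - by move=> z; rewrite mul1r nrm_tr.
exists (nc_tr a) => //; apply: hsum_bound h _ => K.
by apply: le_trans (nrm_sum _ _ _) _; apply: le_trans (hB K); exact: ler_sum.
Qed.

Lemma hsum_coef (f : Zn -> T) x r : hsum f x -> hsum (V := R[i]) (fun k => coef (f k) r) (coef x r).
Proof.
apply: (@hsum_linear R n T R[i] (fun y => coef y r) 1) => [a y z|y].
  by rewrite fcoefD fcoefZ.
by rewrite mul1r nrm_coef.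
Qed.

Lemma coef_hsum c x : hsum (fun k => c k *: U k) x -> coef x = c.
Proof.
move=> hx; apply/funext => r; apply: (hsum_unique (hsum_coef (r := r) hx)).
have := @hsum_fin R n R[i] [fset r]%fset (fun k => coef (c k *: U k) r).
rewrite big_seq_fset1 fcoefZ coef_mono eqxx mulr1; apply => k.
by rewrite inE fcoefZ coef_mono => /negbTE ->; rewrite mulr0.
Qed.

Lemma zsum_eq (f : Zn -> T) x : hsum f x -> zsum f = x.
Proof.
by move=> hx; rewrite /zsum; case: xgetP => [y _ hy|/(_ x)//]; exact: hsum_unique hy hx.
Qed.

(** Rapid decay in the form that Schur's test preserves; see [rapidly_decayingP]. *)
Definition smooth_coef c := forall s : R, exists2 B : R, 0 <= B & wb s c B.

(** A converse of [wb_point]; the loss of n / 2 in the exponent pays for [jap_sum]. *)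
Lemma point_wb c (s C : R) : 0 <= C ->
  (forall k, jap R k `^ ((s + n%:R) / 2) * nrm (c k) <= C) -> wb s c (6 ^+ n * C).
Proof.
move=> C0 h K; have h6 : (1 : R) <= 6 ^+ n by rewrite exprn_ege1 // ler1n.
apply: (@le_trans _ _ (\sum_(k <- K) jap R k `^ (- n%:R) * C ^+ 2)).
  apply: ler_sum => k _.
  have -> : jap R k `^ s = jap R k `^ (- n%:R) * jap R k `^ (s + n%:R).
    by rewrite -jap_powRD; congr (_ `^ _); ring.
  rewrite -mulrA ler_wpM2l ?powR_ge0 //.
  rewrite -jap_powR_sqr -exprMn ler_pXn2r ?nnegrE ?mulr_ge0 ?powR_ge0 ?nrm_ge0 //.
rewrite -mulr_suml exprMn ler_wpM2r ?sqr_ge0 //.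
apply: le_trans (jap_sum _ (fset_uniq K)) _.
by rewrite expr2 -[leLHS]mulr1 ler_wpM2l // (le_trans _ h6).
Qed.

Lemma enorm_pow_le k N : (1 + enorm (zvec R k)) ^+ N <= 2 ^+ N * jap R k `^ N%:R.
Proof.
have e0 : 0 <= enorm (zvec R k) by exact: sqrtr_ge0.
rewrite powR_mulrn ?(ltW (jap_gt0 _ _)) // -exprMn; apply: lerXn2r.
- by rewrite nnegrE addr_ge0.
- by rewrite nnegrE mulr_ge0 // ltW // jap_gt0.
by rewrite /jap; nra.
Qed.

Lemma rapidly_decayingP c : rapidly_decaying c <-> smooth_coef c.
Proof.
have e0 k : 0 <= enorm (zvec R k) by exact: sqrtr_ge0.
split=> [h s|h N].
  have [N hN] : exists N : nat, (s + n%:R) / 2 <= N%:R.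
    by exists (Num.truncn `|(s + n%:R) / 2|).+1; rewrite ltW // (le_lt_trans (ler_norm _)) // truncnS_gt.
  have [C hC] := h (2 * N)%N; exists (6 ^+ n * `|C|); first by rewrite mulr_ge0.
  apply: point_wb => // k; apply: le_trans (ler_norm C); apply: le_trans (hC k).
  rewrite ler_wpM2r ?nrm_ge0 //; apply: le_trans (jap_powR_le k hN) _.
  rewrite powR_mulrn ?(ltW (jap_gt0 _ _)) // exprM; apply: lerXn2r.
  - by rewrite nnegrE; exact/ltW/jap_gt0.
  - by rewrite nnegrE sqr_ge0.
  by rewrite /jap; have := e0 k; nra.
have [B B0 hB] := h (2 * N%:R); exists (2 ^+ N * B) => k.
have hk := wb_point k B0 hB.
rewrite (_ : 2 * N%:R / 2 = N%:R) in hk; last by field.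
apply: le_trans (ler_wpM2r (nrm_ge0 _) (enorm_pow_le k N)) _.
by rewrite -mulrA ler_wpM2l // exprn_ge0.
Qed.

Lemma wb_hsum_mono c (B : R) : 0 <= B -> wb n%:R c B ->
  exists2 x : T, hsum (fun k => c k *: U k) x & nrm x <= 6 ^+ n * B.
Proof.
move=> B0 h; apply: (@hsum_abs R n T _ (fun k => nrm (c k))).
  move=> k; rewrite nrmZ -[leRHS]mulr1.
  by rewrite ler_wpM2l ?nrm_ge0 ?nrm_mono_le1.
move=> K; have := wb_l1 B0 (fset_uniq K) h.
by under eq_bigr do rewrite subrr mul0r powRr0 mul1r.
Qed.

Lemma CinfP x : is_Cinf x <-> smooth_coef (coef x) /\ hsum (fun k => coef x k *: U k) x.
Proof.
split=> [[u hu hx]|[h1 h2]]; last by exists (coef x) => //; exact/rapidly_decayingP.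
by rewrite (coef_hsum hx); split => //; exact/rapidly_decayingP.
Qed.

Lemma Cinf_make c : smooth_coef c -> exists x : T, is_Cinf x /\ coef x = c.
Proof.
move=> hc; have [B B0 hB] := hc n%:R; have [x hx _] := wb_hsum_mono B0 hB.
have cx := coef_hsum hx.
by exists x; split => //; apply/CinfP; rewrite cx.
Qed.

Lemma Cinf_ext x y : is_Cinf x -> is_Cinf y -> coef x = coef y -> x = y.
Proof.
move=> /CinfP[_ hx] /CinfP[_ hy] e; rewrite -e in hy; exact: hsum_unique hx hy.
Qed.

Lemma Cinf_nrm x (B : R) : 0 <= B -> is_Cinf x -> wb n%:R (coef x) B -> nrm x <= 6 ^+ n * B.
Proof.
move=> B0 /CinfP[_ hx] h; have [y hy hb] := wb_hsum_mono B0 h.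
by rewrite (hsum_unique hx hy).
Qed.

Lemma smooth_coef_lin c c' (z : R[i]) : smooth_coef c -> smooth_coef c' ->
  smooth_coef (fun k => z * c k + c' k).
Proof.
move=> h h' s; have [B B0 hB] := h s; have [B' B0' hB'] := h' s.
exists (2 * (nrm z * B + B')); first by rewrite mulr_ge0 ?addr_ge0 ?mulr_ge0 ?nrm_ge0.
exact: wb_lin.
Qed.

Lemma Cinf_lin x y (z : R[i]) : is_Cinf x -> is_Cinf y -> is_Cinf (z *: x + y).
Proof.
move=> /CinfP[hx1 hx2] /CinfP[hy1 hy2]; apply/CinfP; split.
  rewrite (_ : coef (z *: x + y) = fun k => z * coef x k + coef y k).
    exact: smooth_coef_lin.
  by apply/funext => k; rewrite fcoefD fcoefZ.
apply: hsum_ext (hsum_lin (c := z) hx2 hy2) => k.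
by rewrite fcoefD fcoefZ scalerA scalerDl.
Qed.

Lemma smooth_coef_fin (J : {fset Zn}) c : (forall k, k \notin J -> c k = 0) -> smooth_coef c.
Proof.
move=> h s; pose S := \sum_(k <- J) jap R k `^ s * nrm (c k) ^+ 2.
have S0 : 0 <= S by apply: sumr_ge0 => k _; rewrite mulr_ge0 ?powR_ge0 ?sqr_ge0.
exists (Num.sqrt S) => [|K]; first exact: sqrtr_ge0.
rewrite sqr_sqrtr // /S.
rewrite (bigID (mem J)) /= [X in _ + X]big1 ?addr0; last first.
  by move=> k /h ->; rewrite nrm0 expr0n mulr0.
rewrite -big_filter; apply: sum_subset.
- by move=> k; rewrite mulr_ge0 ?powR_ge0 ?sqr_ge0.
- by rewrite filter_uniq ?fset_uniq.
by move=> k; rewrite mem_filter => /andP[].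
Qed.

Lemma Cinf0 : is_Cinf (0 : T).
Proof.
apply/CinfP; split; first by apply: (@smooth_coef_fin fset0) => k _; rewrite fcoef0.
apply/hsumP => e e0; exists fset0 => K _.
by rewrite big1 ?subrr ?nrm0 // => k _; rewrite fcoef0 scale0r.
Qed.

Lemma CinfZ z x : is_Cinf x -> is_Cinf (z *: x).
Proof. by move=> hx; rewrite -[_ *: _]addr0; apply: Cinf_lin => //; exact: Cinf0. Qed.

Lemma CinfD x y : is_Cinf x -> is_Cinf y -> is_Cinf (x + y).
Proof. by move=> hx hy; rewrite -[x]scale1r; exact: Cinf_lin. Qed.

Lemma Cinf_sum (s : seq Zn) (F : Zn -> T) : (forall k, is_Cinf (F k)) ->
  is_Cinf (\sum_(k <- s) F k).
Proof. by move=> h; elim/big_ind: _ => [||k _]; [exact: Cinf0|exact: CinfD|exact: h]. Qed.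

Lemma Cinf_mono k : is_Cinf (U k).
Proof.
apply/CinfP; split.
  by apply: (@smooth_coef_fin [fset k]%fset) => l; rewrite inE coef_mono eq_sym => /negbTE ->.
have := @hsum_fin R n T [fset k]%fset (fun l => coef (U k) l *: U l).
rewrite big_seq_fset1 coef_mono eqxx scale1r; apply => l.
by rewrite inE coef_mono eq_sym => /negbTE ->; rewrite scale0r.
Qed.

Lemma Cinf_star_mono k : is_Cinf (star (U k)).
Proof. by have [z _ ->] := star_mono T k; apply/CinfZ/Cinf_mono. Qed.

(** By Peetre's inequality the weights at [k] and [k - l] differ by a factor depending on [l]
    alone. *)
Lemma smooth_coef_shift c c' l : (forall r, nrm (c' r) = nrm (c (r - l))) ->
  smooth_coef c -> smooth_coef c'.
Proof.
move=> h hc; apply/rapidly_decayingP => N.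
have [B B0 hB] := hc (2 * N%:R).
pose D : R := 2 ^+ N * (2 `^ N%:R * jap R l `^ N%:R) * B; exists D => k.
have e0 : 0 <= enorm (zvec R k) by exact: sqrtr_ge0.
have hk := wb_point (k - l) B0 hB.
rewrite (_ : 2 * N%:R / 2 = N%:R) in hk; last by field.
have hp := peetre (N%:R : R) k (k - l).
rewrite subKr in hp.
rewrite (ger0_norm (ler0n R N)) in hp.
rewrite h.
apply: le_trans (ler_wpM2r (nrm_ge0 _) (enorm_pow_le k N)) _.
rewrite /D -!mulrA ler_wpM2l ?exprn_ge0 //.
apply: le_trans (ler_wpM2r (nrm_ge0 _) hp) _.
rewrite mulrAC -!mulrA ler_wpM2l ?powR_ge0 // mulrA [leRHS]mulrC.
by rewrite ler_wpM2r ?powR_ge0 // mulrC.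
Qed.

Lemma Cinf_mulmono x k : is_Cinf x -> is_Cinf (x ** U k).
Proof.
move=> /CinfP[h1 h2]; apply/CinfP; split.
  by apply: smooth_coef_shift h1 => r; exact: nrm_coefM.
have hx : hsum (fun l => coef x l *: (U l ** U k)) (x ** U k).
  apply: hsum_ext (hsum_linear (phi := fun z => z ** U k) (C := 1) _ _ h2).
  - by move=> l; rewrite cmulZl.
  - by move=> z y y'; rewrite cmulDl cmulZl.
  move=> y; apply: le_trans (nrm_cmul _ _) _; rewrite mulrC.
  by rewrite ler_wpM2r ?nrm_ge0 ?nrm_mono_le1.
(* [U l ** U k] is a phase times [U (l + k)], so only [l = r - k] contributes. Keeping the phase as
   a coefficient lets it be put back below. *)
have coefE r : coef (x ** U k) r = coef x (r - k) * coef (U (r - k) ** U k) r.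
  apply: (hsum_unique (hsum_coef (r := r) hx)).
  have := @hsum_fin R n R[i] [fset r - k]%fset (fun l => coef (coef x l *: (U l ** U k)) r).
  rewrite big_seq_fset1 fcoefZ; apply => l; rewrite inE => lk.
  have [z _ ->] := monoM T l k; rewrite !fcoefZ coef_mono.
  case: eqVneq => [e|_]; last by rewrite !mulr0.
  by rewrite -e addrK eqxx in lk.
apply: (@hsum_ext _ _ _ (fun r => coef x (r - k) *: (U (r - k) ** U k))).
  move=> r; rewrite coefE -scalerA; congr (_ *: _).
  have [z _ ->] := monoM T (r - k) k.
  by rewrite fcoefZ coef_mono subrK eqxx mulr1.
exact: (hsum_reindex (s := fun r => r - k) (t := fun r => r + k) (subrK k) (addrK k) hx).
Qed.

End Smooth.

(** * Operators from lattice symbols *)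

Section Derivations.
Variables (R : realType) (n : nat) (theta : 'M[R]_n) (T : nctorus theta).
Local Notation Zn := 'rV[int]_n.
Local Notation U k := (mono (@nc_gen R n theta T) k).
Implicit Types (k l r : Zn) (x y a : T) (c : Zn -> R[i]).

Lemma nrm_int (z : int) : nrm (z%:~R : R[i]) = `|z%:~R : R|.
Proof. by rewrite -(rmorph_int (real_complex R)) nrm_real. Qed.

Lemma coord_sqr_le k j : (k ord0 j)%:~R ^+ 2 <= jap R k.
Proof.
rewrite japE (bigD1 j) //= addrCA lerDl addr_ge0 // sumr_ge0 // => i _.
exact: sqr_ge0.
Qed.

Lemma wb_scale (q : Zn -> R[i]) (p : nat) c (s B : R) :
  (forall k, nrm (q k) ^+ 2 <= jap R k ^+ p) -> wb (s + p%:R) c B ->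
  wb s (fun k => q k * c k) B.
Proof.
move=> hq h K; apply: le_trans (h K); apply: ler_sum => k _.
rewrite nrmM exprMn jap_powRD mulrA ler_wpM2r ?sqr_ge0 // ler_wpM2l ?powR_ge0 //.
by rewrite powR_mulrn // ltW // jap_gt0.
Qed.

Lemma delta_Cinf j a : is_Cinf a ->
  is_Cinf (delta j a) /\ forall k, coef (delta j a) k = (k ord0 j)%:~R * coef a k.
Proof.
move=> /CinfP[h1 h2].
have hs : smooth_coef (fun k => (k ord0 j)%:~R * coef a k).
  move=> s; have [B B0 hB] := h1 (s + 1); exists B => //.
  apply: (wb_scale (p := 1)) hB => k.
  by rewrite nrm_int real_normK ?num_real // expr1 coord_sqr_le.
have [x [xC cx]] := Cinf_make T hs.
have [_ hx] := (CinfP x).1 xC; rewrite cx in hx.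
have -> : delta j a = x := zsum_eq hx.
by split => // k; rewrite cx.
Qed.

Definition monomial_factor (b : 'I_n -> nat) (s : seq 'I_n) k : R[i] :=
  \prod_(j <- s) (k ord0 j)%:~R ^+ b j.

Lemma multi_delta b a : is_Cinf a -> is_Cinf (multi_iter (@delta R n theta T) b a) /\
  forall k, coef (multi_iter (@delta R n theta T) b a) k
    = monomial_factor b (enum 'I_n) k * coef a k.
Proof.
move=> ha; rewrite /multi_iter /monomial_factor.
elim: (enum 'I_n) => [|j s [IH1 IH2]] /=.
  by split => // k; rewrite big_nil mul1r.
set y := foldr _ _ _ in IH1 IH2 *.
suff : is_Cinf (iter (b j) (delta j) y) /\
    forall k, coef (iter (b j) (delta j) y) k = (k ord0 j)%:~R ^+ b j * coef y k.
  case=> h1 h2; split => // k; by rewrite big_cons h2 IH2 mulrA.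
elim: (b j) => [|p [h1 h2]] /=; first by split => // k; rewrite mul1r.
have [h3 h4] := delta_Cinf j h1; split => // k.
by rewrite h4 h2 mulrA exprS.
Qed.

Lemma nrm_monomial_factor b (s : seq 'I_n) k :
  nrm (monomial_factor b s k) ^+ 2 <= jap R k ^+ (\sum_(j <- s) b j).
Proof.
rewrite /monomial_factor; elim: s => [|j s IH].
  by rewrite !big_nil nrm_cst1 expr1n expr0.
rewrite !big_cons nrmM exprMn exprD ler_pM ?sqr_ge0 //.
have -> : nrm ((k ord0 j)%:~R ^+ b j : R[i]) ^+ 2 = (nrm ((k ord0 j)%:~R : R[i]) ^+ 2) ^+ b j.
  rewrite -exprM mulnC exprM; congr (_ ^+ 2).
  elim: (b j) => [|p IHp]; first by rewrite !expr0 nrm_cst1.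
  by rewrite !exprS nrmM IHp.
apply: lerXn2r; rewrite ?nnegrE ?sqr_ge0 //; first exact/ltW/jap_gt0.
by rewrite nrm_int real_normK ?num_real // coord_sqr_le.
Qed.

(** Together with [gauge_lower], this makes the seminorms of C^oo equivalent to the weighted l^2
    norms of the coefficients, up to a shift of order. *)
Lemma gauge_upper b : exists s : R, forall a (B : R), 0 <= B -> is_Cinf a ->
  wb s (coef a) B -> nrm (multi_iter (@delta R n theta T) b a) <= 6 ^+ n * B.
Proof.
exists (n%:R + (\sum_(j <- enum 'I_n) b j)%:R) => a B B0 ha hB.
have [h1 h2] := multi_delta b ha; apply: Cinf_nrm => //.
rewrite (_ : coef _ = fun k => monomial_factor b (enum 'I_n) k * coef a k); last exact/funext.
by apply: wb_scale hB => k; exact: nrm_monomial_factor.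
Qed.

Definition axis_order (N : nat) (j : 'I_n) : 'I_n -> nat :=
  fun i => if i == j then (2 * N)%N else 0%N.

(* These n + 1 derivatives control every weight of order N, because jap k is
   comparable to 1 or to some k_j^2. *)
Definition smooth_norm (N : nat) a : R :=
  nrm a + \sum_(j < n) nrm (multi_iter (@delta R n theta T) (axis_order N j) a).

Lemma smooth_norm_ge0 N a : 0 <= smooth_norm N a.
Proof. by rewrite addr_ge0 ?nrm_ge0 // sumr_ge0 // => j _; exact: nrm_ge0. Qed.

Lemma coef_smooth_norm N a k : is_Cinf a ->
  jap R k ^+ N * nrm (coef a k) <= n.+1%:R ^+ N * smooth_norm N a.
Proof.
move=> ha.
have j0 : 0 <= jap R k by exact/ltW/jap_gt0.
have [j1|j1] := leP (jap R k) n.+1%:R.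
  apply: ler_pM; rewrite ?exprn_ge0 ?nrm_ge0 //.
    by apply: lerXn2r; rewrite ?nnegrE.
  apply: le_trans (nrm_coef _ _) _; rewrite lerDl sumr_ge0 // => j _; exact: nrm_ge0.
(* Otherwise all n + 1 summands of [jap R k], the 1 included, would lie below its (n + 1)-th
   part. *)
have [j hj] : exists j, jap R k <= n.+1%:R * (k ord0 j)%:~R ^+ 2.
  apply: contrapT => hn.
  have hlt j : (k ord0 j)%:~R ^+ 2 < jap R k / n.+1%:R.
    rewrite ltNge; apply/negP => h; apply: hn; exists j.
    by rewrite mulrC -ler_pdivrMr.
  suff : jap R k < jap R k by rewrite ltxx.
  rewrite {1}japE.
  apply: (@lt_le_trans _ _ (jap R k / n.+1%:R + \sum_(j < n) jap R k / n.+1%:R)).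
    apply: ltr_leD; first by rewrite ltr_pdivlMr ?mul1r.
    by apply: ler_sum => j _; exact/ltW.
  by rewrite sumr_const card_ord -mulrS -[X in X <= _]mulr_natr divfK // pnatr_eq0.
have [_ h2] := multi_delta (axis_order N j) ha.
have fac : monomial_factor (axis_order N j) (enum 'I_n) k = (k ord0 j)%:~R ^+ (2 * N).
  rewrite /monomial_factor big_enum /= (bigD1 j) //= /axis_order eqxx big1 ?mulr1 //.
  by move=> i /negbTE ->.
have nfac : nrm (monomial_factor (axis_order N j) (enum 'I_n) k) = ((k ord0 j)%:~R ^+ 2) ^+ N.
  rewrite fac -(rmorph_int (real_complex R)) -rmorphXn /= nrm_real exprM.
  by rewrite ger0_norm // exprn_ge0 // sqr_ge0.
apply: (@le_trans _ _ ((n.+1%:R * (k ord0 j)%:~R ^+ 2) ^+ N * nrm (coef a k))).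
  rewrite ler_wpM2r ?nrm_ge0 //; apply: lerXn2r; rewrite ?nnegrE //.
  by rewrite mulr_ge0 // sqr_ge0.
rewrite exprMn -mulrA ler_wpM2l ?exprn_ge0 // -nfac -nrmM -h2.
apply: le_trans (nrm_coef _ _) _; rewrite /smooth_norm (bigD1 j) //= addrCA lerDl.
by rewrite addr_ge0 ?nrm_ge0 // sumr_ge0 // => i _; exact: nrm_ge0.
Qed.

Lemma gauge_lower (s : R) (N : nat) a : (s + n%:R) / 2 <= N%:R -> is_Cinf a ->
  wb s (coef a) (6 ^+ n * (n.+1%:R ^+ N * smooth_norm N a)).
Proof.
move=> hN ha; apply: point_wb.
  by rewrite mulr_ge0 ?exprn_ge0 ?smooth_norm_ge0.
move=> k; apply: le_trans (coef_smooth_norm N k ha).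
rewrite ler_wpM2r ?nrm_ge0 //; apply: le_trans (jap_powR_le k hN) _.
by rewrite powR_mulrn // ltW // jap_gt0.
Qed.

Lemma nat_above (x : R) : exists N : nat, x <= N%:R.
Proof.
by exists (Num.truncn `|x|).+1; rewrite ltW // (le_lt_trans (ler_norm _)) // truncnS_gt.
Qed.

End Derivations.

(** * The action of symbol matrices on coefficient sequences *)

Section MatrixAction.
Variables (R : realType) (n : nat) (theta : 'M[R]_n) (T : nctorus theta).
Local Notation Zn := 'rV[int]_n.
Local Notation U k := (mono (@nc_gen R n theta T) k).
Implicit Types (k l r : Zn) (a : T) (c d : Zn -> R[i]) (S : Zn -> T) (s m N A B : R).

Definition entry S r k : R[i] := coef (S k ** U k) r.

(** Regularity of [S k] in the torus variable is encoded by decay in [l], the order of the symbol by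
    growth in [k]. *)
Definition sb N m A S := forall k l,
  nrm (coef (S k) l) <= A * jap R l `^ (- N) * jap R k `^ (m / 2).

(* Only the values of a symbol on the lattice matter for its operator. *)
Definition sclass m S := (forall k, is_Cinf (S k)) /\
  forall N, exists2 A, 0 <= A & sb N m A S.

Lemma entry_bound N m A S r k : sb N m A S ->
  nrm (entry S r k) <= A * jap R (r - k) `^ (- N) * jap R k `^ (m / 2).
Proof. by move=> h; rewrite /entry nrm_coefM. Qed.

Lemma entry_lin (z : R[i]) S S' r k :
  entry (fun k => z *: S k + S' k) r k = z * entry S r k + entry S' r k.
Proof. by rewrite /entry cmulDl cmulZl fcoefD fcoefZ. Qed.

Lemma sclass_lin (z : R[i]) m S S' : sclass m S -> sclass m S' ->
  sclass m (fun k => z *: S k + S' k).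
Proof.
move=> [h1 h2] [h1' h2']; split=> [k|N]; first exact: Cinf_lin.
have [A A0 hA] := h2 N; have [A' A0' hA'] := h2' N.
exists (nrm z * A + A'); first by rewrite addr_ge0 ?mulr_ge0 ?nrm_ge0.
move=> k l; rewrite fcoefD fcoefZ; apply: le_trans (nrmD _ _) _; rewrite nrmM.
rewrite -mulrA mulrDl lerD //; last by rewrite mulrA.
by rewrite -mulrA ler_wpM2l ?nrm_ge0 // mulrA.
Qed.

(** Schur's bound, applied to the moduli of the entries and of [c] and read at the single index [r],
    bounds the sums of absolute values. *)
Lemma entry_summable N m A S s c B r : 0 <= A -> 0 <= B -> `|s| / 2 + n%:R <= N ->
  sb N m A S -> wb (s + m) c B ->
  exists d : R[i], hsum (V := R[i]) (fun k => entry S r k * c k) d.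
Proof.
move=> A0 B0 hN hS hc.
pose M r' k : R[i] := (nrm (entry S r' k))%:C%C.
pose c' k : R[i] := (nrm (c k))%:C%C.
have hc' : wb (s + m) c' B.
  move=> K; apply: le_trans (hc K); apply: ler_sum => k _.
  by rewrite /c' nrm_real ger0_norm ?nrm_ge0.
have hM r' k : nrm (M r' k) <= A * jap R (r' - k) `^ (- N) * jap R k `^ (m / 2).
  by rewrite /M nrm_real ger0_norm ?nrm_ge0 //; exact: entry_bound.
pose C := schur_const n s * A * B.
have C0 : 0 <= C by rewrite !mulr_ge0 ?schur_const_ge0.
have [||d hd _] := @hsum_absC R n theta T (fun k => entry S r k * c k)
    (fun k => nrm (entry S r k) * nrm (c k)) (C / jap R r `^ (s / 2)).
- by move=> k; rewrite nrmM.
- move=> K; rewrite ler_pdivlMr ?powR_gt0 ?jap_gt0 // mulrC.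
  have := wb_point r C0 (@schur R n s m N A B M c' K A0 B0 hN hM hc').
  rewrite (_ : \sum_(k <- K) M r k * c' k = (\sum_(k <- K) nrm (entry S r k) * nrm (c k))%:C%C).
    by rewrite nrm_real ger0_norm // sumr_ge0 // => k _; rewrite mulr_ge0 ?nrm_ge0.
  by rewrite rmorph_sum /=; apply: eq_bigr => k _; rewrite rmorphM.
by exists d.
Qed.

Definition mact S c r : R[i] :=
  xget 0 [set d : R[i] | hsum (V := R[i]) (fun k => entry S r k * c k) d].

Lemma mact_eq S c r (d : R[i]) : hsum (V := R[i]) (fun k => entry S r k * c k) d -> mact S c r = d.
Proof.
by rewrite /mact => h; case: xgetP => [y _ hy|/(_ d)//]; exact: hsum_unique hy h.
Qed.

Lemma mact_hsum N m A S s c B r : 0 <= A -> 0 <= B -> `|s| / 2 + n%:R <= N ->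
  sb N m A S -> wb (s + m) c B ->
  hsum (V := R[i]) (fun k => entry S r k * c k) (mact S c r).
Proof.
move=> A0 B0 hN hS hc; have [d hd] := entry_summable r A0 B0 hN hS hc.
by rewrite (mact_eq hd).
Qed.

Lemma mact_wb N m A S s c B : 0 <= A -> 0 <= B -> `|s| / 2 + n%:R <= N ->
  sb N m A S -> wb (s + m) c B -> wb s (mact S c) (schur_const n s * A * B).
Proof.
move=> A0 B0 hN hS hc; apply: (wb_hsum (F := fun r k => entry S r k * c k)).
  move=> K.
  exact: (@schur R n s m N A B (entry S) c K A0 B0 hN (fun r k => @entry_bound N m A S r k hS) hc).
by move=> r; exact: (mact_hsum A0 B0 hN hS hc).
Qed.

Lemma sclass_hsum m S s c B r : 0 <= B -> sclass m S -> wb (s + m) c B ->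
  hsum (V := R[i]) (fun k => entry S r k * c k) (mact S c r).
Proof.
by move=> B0 [_ /(_ (`|s| / 2 + n%:R))[A A0 hA]] hc; exact: mact_hsum hA hc.
Qed.

Lemma mact_linr (z : R[i]) m S s c c' B B' r : 0 <= B -> 0 <= B' -> sclass m S ->
  wb (s + m) c B -> wb (s + m) c' B' ->
  mact S (fun k => z * c k + c' k) r = z * mact S c r + mact S c' r.
Proof.
move=> B0 B0' hS hc hc'; apply: mact_eq.
apply: hsum_ext (hsum_lin (c := z) (sclass_hsum (r := r) B0 hS hc) (sclass_hsum (r := r) B0' hS hc')) => k.
by rewrite /= -[_ *: _]/(z * _); ring.
Qed.

Lemma mact_linl (z : R[i]) m S S' s c B r : 0 <= B -> sclass m S -> sclass m S' ->
  wb (s + m) c B ->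
  mact (fun k => z *: S k + S' k) c r = z * mact S c r + mact S' c r.
Proof.
move=> B0 hS hS' hc; apply: mact_eq.
apply: hsum_ext (hsum_lin (c := z) (sclass_hsum (r := r) B0 hS hc) (sclass_hsum (r := r) B0 hS' hc)) => k.
by rewrite /= entry_lin -[_ *: _]/(z * _); ring.
Qed.

Lemma mact_smooth m S c : sclass m S -> smooth_coef c -> smooth_coef (mact S c).
Proof.
move=> [_ hS] hc s; have [A A0 hA] := hS (`|s| / 2 + n%:R).
have [B B0 hB] := hc (s + m).
exists (schur_const n s * A * B); first by rewrite !mulr_ge0 ?schur_const_ge0.
exact: mact_wb hA hB.
Qed.

(** The partial sum over [K] is the matrix applied to the coefficients restricted to [K]. The error
    therefore comes from the rest [c'], small in a weighted norm by [wb_tail]; Schur's test and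
    [Cinf_nrm] turn this into smallness in the norm of the algebra. *)
Lemma op_hsum m S a y : sclass m S -> is_Cinf a -> is_Cinf y ->
  coef y = mact S (coef a) -> hsum (fun k => coef a k *: (S k ** U k)) y.
Proof.
move=> hS ha hy cy; apply/hsumP => e e0.
have [hSC hSb] := hS; have [ca _] := (CinfP a).1 ha.
pose s : R := n%:R.
have [A A0 hA] := hSb (`|s| / 2 + n%:R).
have [B B0 hB] := ca (s + m).
pose C := 6 ^+ n * (schur_const n s * A) + 1.
have C0 : 0 < C by rewrite ltr_wpDl // !mulr_ge0 ?schur_const_ge0 ?exprn_ge0.
pose e1 := e / (2 * C); have e10 : 0 < e1 by rewrite divr_gt0 // mulr_gt0.
have [J hJ] := wb_tail (exprn_gt0 2 e10) hB.
exists J => K JK.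
pose c' k := if k \in K then 0 else coef a k.
have hc' : wb (s + m) c' e1.
  move=> L; rewrite (bigID (mem K)) /= big1 ?add0r; last first.
    by move=> k kK; rewrite /c' kK nrm0 expr0n mulr0.
  rewrite -big_filter.
  have uL : uniq [seq k <- L | k \notin K] by rewrite filter_uniq.
  have hd : [disjoint J & [fset k in [seq k <- L | k \notin K]]]%fset.
    apply/fdisjointP => k kJ; rewrite !inE mem_filter negb_and negbK.
    by rewrite (fsubsetP JK).
  apply: le_trans (hJ _ hd); rewrite sum_fset_seq // !big_filter.
  by apply: ler_sum => k kK; rewrite /c' (negbTE kK).
set x := \sum_(k <- K) _.
have hx : is_Cinf x by apply: Cinf_sum => k; apply/CinfZ/Cinf_mulmono.
have hxy : is_Cinf (x - y) by rewrite -scaleN1r addrC; exact: Cinf_lin.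
have cxy r : coef (y - x) r = mact S c' r.
  apply/esym/mact_eq.
  have h1 := sclass_hsum (r := r) B0 hS hB; rewrite -cy in h1.
  have h2 := @hsum_fin R n R[i] K (fun k => if k \in K then entry S r k * coef a k else 0).
  have {}h2 := h2 (fun k => ifN _ _).
  have h3 := hsum_lin (c := -1) h2 h1.
  have -> : coef (y - x) r = -1 *: (\sum_(k <- K)
      (if k \in K then entry S r k * coef a k else 0)) + coef y r.
    rewrite fcoefB fcoef_sum addrC scaleN1r; congr (- _ + _).
    rewrite [LHS]big_seq [RHS]big_seq; apply: eq_bigr => k ->.
    by rewrite fcoefZ mulrC.
  apply: hsum_ext h3 => k; rewrite /= /c'.
  by rewrite -[_ *: _]/(-1 * _); case: ifP => _; ring.
have hw : wb s (coef (y - x)) (schur_const n s * A * e1).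
  rewrite (_ : coef (y - x) = mact S c'); last exact/funext.
  by apply: mact_wb hA hc' => //; exact: ltW.
apply: (@le_lt_trans _ _ (6 ^+ n * (schur_const n s * A * e1))).
  rewrite nrm_sub; apply: Cinf_nrm hw.
  - by apply: mulr_ge0 (ltW e10); rewrite mulr_ge0 ?schur_const_ge0.
  - by rewrite -scaleN1r addrC; exact: Cinf_lin.
have Ce : C * e1 = e / 2 by rewrite /e1; field; rewrite gt_eqF.
rewrite (_ : _ * _ = C * e1 - e1); last by rewrite /C; ring.
by rewrite Ce; lra.
Qed.

(* [psido rho] is convertible to [lattice_op (rho \o zvec R)]. *)
Definition lattice_op S : T -> T :=
  patch (fun=> 0) (@is_Cinf R n theta T) (fun a => zsum (fun k => coef a k *: (S k ** U k))).

Lemma lattice_opP m S a : sclass m S -> is_Cinf a ->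
  is_Cinf (lattice_op S a) /\ coef (lattice_op S a) = mact S (coef a).
Proof.
move=> hS ha; have [ca _] := (CinfP a).1 ha.
have [y [yC cy]] := Cinf_make T (mact_smooth hS ca).
suff -> : lattice_op S a = y by [].
rewrite /lattice_op patchT ?inE //.
exact: zsum_eq (op_hsum hS ha yC cy).
Qed.

Lemma lattice_op_out S a : ~ is_Cinf a -> lattice_op S a = 0.
Proof. by move=> h; rewrite /lattice_op patchN // notin_setE. Qed.

End MatrixAction.

(** * Holomorphic families of symbols *)

Section GaugedLimits.
Variable R : realType.

Lemma filter_finite (X Y : Type) (F : set_system X) (Q : Y -> X -> Prop) (G : set Y) :
  Filter F -> finite_set G -> (forall p, G p -> F (Q p)) ->
  F [set t | forall p, G p -> Q p t].
Proof.
move=> FF /(@finite_seqP {classic Y})[s ->] h.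
elim: s h => [|p s IH] h; first by apply: filterS filterT => t _ p.
have h1 : F (Q p) by apply: h; rewrite /= mem_head.
have h2 : F [set t | forall p, [set` s] p -> Q p t].
  by apply: IH => q qs; apply: h; rewrite /= inE qs orbT.
apply: filterS2 h1 h2 => t q1 q2 q /=; rewrite inE => /orP[/eqP->//|qs].
exact: q2.
Qed.

Lemma gcvg (X : Type) (E : gauged R) (F : set_system X) (f : X -> E) (l : E) :
  Filter F ->
  (forall p, gauges E p -> forall e : R, 0 < e -> F [set t | (p (f t - l)%R < e%:E)%E]) ->
  f @ F --> gnbhs l.
Proof.
move=> FF h V [G [e [fG Gg e0 GV]]].
have h1 := filter_finite FF fG (fun p Gp => h p (Gg p Gp) e e0).
suff : F (f @^-1` V) by [].
by apply: filterS h1 => t ht; apply: GV => p Gp; exact: ht.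
Qed.

Lemma gcvg_gauge (X : Type) (E : gauged R) (F : set_system X) (f : X -> E) (l : E)
  (p : E -> \bar R) (e : R) : f @ F --> gnbhs l -> gauges E p -> 0 < e ->
  F [set t | (p (f t - l)%R < e%:E)%E].
Proof.
move=> h gp e0; apply: (h [set y | (p (y - l)%R < e%:E)%E]); exists [set p], e; split => //.
- by move=> q ->.
- by move=> y /= hy; exact: hy.
Qed.

End GaugedLimits.

(** * Locally uniform symbol bounds and Taylor remainders *)

Section SymbolFamilies.
Variables (R : realType) (n : nat) (theta : 'M[R]_n) (T : nctorus theta).
Local Notation Zn := 'rV[int]_n.
Implicit Types (k l : Zn) (N m A : R) (z : R[i]).

Lemma multi_delta_lin (b : 'I_n -> nat) (z : R[i]) (x y : T) : is_Cinf x -> is_Cinf y ->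
  multi_iter (@delta R n theta T) b (z *: x + y)
  = z *: multi_iter (@delta R n theta T) b x + multi_iter (@delta R n theta T) b y.
Proof.
move=> hx hy; have hxy := Cinf_lin z hx hy.
have [h1 h2] := multi_delta b hxy; have [h3 h4] := multi_delta b hx; have [h5 h6] := multi_delta b hy.
apply: Cinf_ext => //; first exact: Cinf_lin.
by apply/funext => k; rewrite h2 !fcoefD !fcoefZ h4 h6; ring.
Qed.

Lemma multi_iter_zero (X : Type) (D : 'I_n -> X -> X) (x : X) :
  multi_iter D (fun=> 0%N) x = x.
Proof. by rewrite /multi_iter; elim: (enum 'I_n). Qed.

Lemma enorm_zvec_ge1 k : k != 0 -> 1 <= enorm (zvec R k).
Proof.
move=> k0; have [j kj] : exists j, k ord0 j != 0.
  apply: contrapT => h; move/eqP: k0; apply; apply/rowP => j; rewrite mxE.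
  rewrite [k _ _](_ : _ = k ord0 j) //.
  by have [//|kj] := eqVneq (k ord0 j) 0; case: h; exists j.
rewrite -(ler_pXn2r (ltn0Sn 1)) ?nnegrE ?sqrtr_ge0 // expr1n enorm_sqr (bigD1 j) //=.
apply: ler_wpDr; first by apply: sumr_ge0 => i _; exact: sqr_ge0.
rewrite mxE -real_normK ?num_real // -intr_norm exprn_ege1 // ler1z.
by rewrite -gtz0_ge1 normr_gt0.
Qed.

(** For k <> 0 one has 1 + |k|^2 <= 2 |k|^2, which gives the case m < 0; the case m >= 0 is
    monotonicity. *)
Lemma enorm_powR_le k m : k != 0 ->
  enorm (zvec R k) `^ m <= 2 `^ (`|m| / 2) * jap R k `^ (m / 2).
Proof.
move=> k0; have e1 := enorm_zvec_ge1 k0; set t := enorm _ in e1 *.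
have t0 : 0 < t by exact: lt_le_trans e1.
have tt : t `^ m = (t ^+ 2) `^ (m / 2).
  by rewrite -powR_mulrn ?ltW // -powRrM mulrC divfK.
rewrite tt /jap -/t.
have t21 : 1 <= t ^+ 2 by rewrite exprn_ege1.
have [m0|m0] := leP 0 m.
  rewrite ger0_norm //; apply: (@le_trans _ _ ((1 + t ^+ 2) `^ (m / 2))).
    by apply: ge0_ler_powR; rewrite ?nnegrE ?divr_ge0 ?addr_ge0 ?sqr_ge0 // lerDr.
  rewrite -[leLHS]mul1r ler_wpM2r ?powR_ge0 //.
  by rewrite -[leLHS](powRr0 2); apply: ler_powR; rewrite ?ler1n ?divr_ge0.
rewrite ltr0_norm //.
have -> : (t ^+ 2) `^ (m / 2) = ((t ^+ 2) `^ (- m / 2))^-1.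
  by rewrite -powRN; congr (_ `^ _); ring.
have -> : (1 + t ^+ 2) `^ (m / 2) = ((1 + t ^+ 2) `^ (- m / 2))^-1.
  by rewrite -powRN; congr (_ `^ _); ring.
have p1 : 0 < (t ^+ 2) `^ (- m / 2) by rewrite powR_gt0 // exprn_gt0.
have p2 : 0 < (1 + t ^+ 2) `^ (- m / 2) by rewrite powR_gt0 // ltr_wpDr ?sqr_ge0.
rewrite -[leLHS]mul1r ler_pdivrMr // mulrAC ler_pdivlMr // mul1r.
rewrite -powRM ?sqr_ge0 //; apply: ge0_ler_powR.
- by rewrite divr_ge0 //; lra.
- by rewrite nnegrE addr_ge0 ?sqr_ge0.
- by rewrite nnegrE mulr_ge0 ?sqr_ge0.
by lra.
Qed.

(** Squares rather than discs, since they are continuous images of a product of two segments. *)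
Lemma square_compact (z0 : R[i]) (r : R) :
  compact [set z : R[i] | `|complex.Re (z - z0)| <= r /\ `|complex.Im (z - z0)| <= r].
Proof.
pose f (p : R * R) : R[i] := z0 + Complex p.1 p.2.
have -> : [set z : R[i] | `|complex.Re (z - z0)| <= r /\ `|complex.Im (z - z0)| <= r]
    = f @` (`[- r, r] `*` `[- r, r]).
  apply/seteqP; split=> [z /= [h1 h2]|_ [[x y] [/= h1 h2] <-]].
    exists (complex.Re (z - z0), complex.Im (z - z0)).
      by rewrite /= !in_itv /= -!ler_norml.
    by rewrite /f /=; case: (z - z0) (subrK z0 z) => ? ? /= <-; rewrite addrC.
  rewrite !in_itv /= -!ler_norml in h1 h2 *.
  by rewrite /f addrC addKr.
apply: continuous_compact; last by apply: compact_setX; exact: segment_compact.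
apply: continuous_subspaceT => -[x y]; apply/cvg_nrmP => e e0.
have e20 : 0 < e / 2 by rewrite divr_gt0.
exists (ball x (e / 2), ball y (e / 2)) => /=.
  by split; exact: nbhsx_ballx.
move=> [x' y'] [/=]; rewrite -!ball_normE /= => h1 h2.
have -> : f (x', y') - f (x, y) = Complex (x' - x) (y' - y).
  by rewrite /f opprD addrACA subrr add0r.
apply: le_lt_trans (nrm_le_ReIm _) _ => /=.
by rewrite (distrC x') (distrC y'); lra.
Qed.

Variables (Om : set R[i]) (hOm : open Om) (w : R[i] -> R[i]).
Variables (rho : R[i] -> 'rV[R]_n -> T) (hrho : holomorphic_symbols Om w rho).

Definition lattice_symbol z k : T := rho z (zvec R k).

Lemma open_ball z0 : Om z0 -> exists2 d : R, 0 < d & forall z, nrm (z - z0) < d -> Om z.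
Proof. by move=> h; apply/nbhs_nrmP; exact: open_nbhs_nbhs. Qed.

Lemma symbol_Cinf z xi : Om z -> is_Cinf (rho z xi).
Proof. by case: hrho => _ _ [h _] _ => /h [/(_ 0%N) /= [/(_ xi I)[]]]. Qed.

(** The seminorms over the compact set [[set xi]] make evaluation at [xi] continuous. The radius
    depends on [xi]; uniformity is recovered later by Cauchy's estimate. *)
Lemma symbol_derivative z0 : Om z0 -> exists L : 'rV[R]_n -> T,
  (forall xi, is_Cinf (L xi)) /\
  forall xi (b : 'I_n -> nat) (e : R), 0 < e -> exists2 d : R, 0 < d &
    forall z, nrm (z - z0) < d -> z != z0 ->
      nrm (multi_iter (@delta R n theta T) b
        ((z - z0)^-1 *: (rho z xi - rho z0 xi) - L xi)) < e.
Proof.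
move=> hz0; case: hrho => _ _ [_ /(_ z0 hz0)[L hL hcv]] _.
exists L; split=> [xi|xi b e e0].
  by case: hL => /(_ 0%N) /= [/(_ xi I)[]].
pose p (a : Cinf T) : \bar R := (nrm (multi_iter (@delta R n theta T) b a))%:E.
pose g (f : Csmooth (Cinf T) [set: 'rV[R]_n]) : \bar R :=
  ereal_sup [set p (multi_iter (@pderiv R n (Cinf T)) (fun=> 0%N) f x) | x in [set xi]].
have gg : gauges (Csmooth (Cinf T) [set: 'rV[R]_n]) g.
  exists [set xi], (fun=> 0%N), p; split => //; [exact: compact_set1|by exists b].
have /dnbhs_nrmP[d d0 hd] := gcvg_gauge hcv gg e0.
exists d => // z zd zz0; have := hd z zd zz0; rewrite /g /= multi_iter_zero image_set1 ereal_sup1.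
by rewrite /p lte_fin.
Qed.

Lemma symbol_cdiff z0 : Om z0 -> exists L : Zn -> T, (forall k, is_Cinf (L k)) /\
  forall k l, cdiff (fun z => coef (lattice_symbol z k) l) z0 (coef (L k) l).
Proof.
move=> hz0; have [L [hL hd]] := symbol_derivative hz0.
exists (fun k => L (zvec R k)); split => // k l e e0.
have [d d0 {}hd] := hd (zvec R k) (fun=> 0%N) e e0.
exists d => // h hh; have [->|h0] := eqVneq h 0.
  by rewrite addr0 subrr mulr0 subr0 nrm0 mulr0.
have := hd (z0 + h); rewrite [z0 + h - z0]addrC addKr multi_iter_zero => /(_ hh) hb.
have {}hb : nrm (h^-1 *: (rho (z0 + h) (zvec R k) - rho z0 (zvec R k)) - L (zvec R k)) < e.
  by apply: hb; rewrite -subr_eq0 [z0 + h]addrC addrK.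
have := le_lt_trans (nrm_coef _ l) hb.
rewrite fcoefB fcoefZ fcoefB => {}hb; rewrite /lattice_symbol.
set u := coef _ _ in hb *; set v := coef (rho z0 _) _ in hb *; set q := coef (L _) _ in hb *.
have -> : u - v - q * h = (h^-1 * (u - v) - q) * h by field.
by rewrite nrmM ler_wpM2r ?nrm_ge0 // ltW.
Qed.

(** The expansion estimates concern |xi| >= 1, that is, every lattice point but the origin. There,
    differentiability in z gives local boundedness. *)
Lemma symbol_origin_bounded z0 (b : 'I_n -> nat) : Om z0 -> exists2 C : R, 0 <= C &
  exists2 d : R, 0 < d & forall z, nrm (z - z0) < d ->
    nrm (multi_iter (@delta R n theta T) b (rho z 0)) <= C.
Proof.
move=> hz0; have [L [hL hd]] := symbol_derivative hz0.
have [d d0 {}hd] := hd 0 b 1 ltr01; have [d' d'0 hOm'] := open_ball hz0.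
set D := multi_iter _ _ in hd *.
exists (1 + nrm (D (L 0)) + nrm (D (rho z0 0))); first by rewrite !addr_ge0 ?nrm_ge0.
exists (Num.min 1 (Num.min d d')); first by rewrite !lt_min ltr01 d0.
move=> z; rewrite !lt_min => /and3P[z1 zd zd'].
have [->|zz0] := eqVneq z z0; first by rewrite lerDr addr_ge0 ?nrm_ge0.
have := hd z zd zz0; set q := _ *: _ - _ => hq.
have Oz := hOm' z zd'.
have qC : is_Cinf q.
  rewrite /q -scaleN1r addrC; apply: Cinf_lin => //; apply: CinfZ.
  by rewrite -scaleN1r addrC; apply: Cinf_lin; exact: symbol_Cinf.
have zn : z - z0 != 0 by rewrite subr_eq0.
have -> : rho z 0 = (z - z0) *: (1 *: q + L 0) + rho z0 0.
  by rewrite scale1r /q subrK scalerA divff // scale1r subrK.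
rewrite /D multi_delta_lin; [|exact: Cinf_lin|exact: symbol_Cinf].
rewrite multi_delta_lin // scale1r -/D.
apply: le_trans (nrmD _ _) _; rewrite lerD2r nrmZ.
apply: (@le_trans _ _ (1 * nrm (D q + D (L 0)))); first by rewrite ler_wpM2r ?nrm_ge0 // ltW.
by rewrite mul1r; apply: le_trans (nrmD _ _) _; rewrite lerD2r ltW.
Qed.

(** The estimate with no term subtracted, on a compact square around [z0], is uniform in z. The
    finitely many derivatives in [smooth_norm] convert it into decay of the coefficients. *)
Lemma symbol_bound_near z0 m (d0 : R) N : Om z0 -> 0 < d0 ->
  (forall z, nrm (z - z0) < d0 -> complex.Re (w z) <= m) ->
  exists2 r : R, 0 < r & exists2 A : R, 0 <= A &
    forall z, nrm (z - z0) < r -> Om z /\ sb N m A (lattice_symbol z).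
Proof.
move=> hz0 d00 hw; have [d1 d10 hd1] := open_ball hz0.
have [N' hN'] := nat_above N.
(* Points of the square of half-side [r0] are within 2 r0 of [z0], so a third of the radius keeps
   them inside both discs. *)
pose r0 := Num.min d0 d1 / 3; have r00 : 0 < r0 by rewrite divr_gt0 // lt_min d00.
pose K := [set z : R[i] | `|complex.Re (z - z0)| <= r0 /\ `|complex.Im (z - z0)| <= r0].
have Kd z : K z -> nrm (z - z0) < d0 /\ nrm (z - z0) < d1.
  move=> [h1 h2]; apply/andP; rewrite -lt_min; apply: le_lt_trans (nrm_le_ReIm _) _.
  apply: (@le_lt_trans _ _ (r0 + r0)); first exact: lerD.
  have : 0 < Num.min d0 d1 by rewrite lt_min d00.
  by rewrite /r0; lra.
have KOm : K `<=` Om by move=> z /Kd[_ /hd1].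
case: hrho => _ _ _ [rhoj [_ hrem]].
have one (b : 'I_n -> nat) : exists2 C : R, 0 <= C & exists2 d : R, 0 < d &
    forall z, nrm (z - z0) < d -> forall k,
      nrm (multi_iter (@delta R n theta T) b (lattice_symbol z k)) <= C * jap R k `^ (m / 2).
  have [C1 C10 [d d_0 hC1]] := symbol_origin_bounded b hz0.
  have [c hc] := hrem 0%N K b (fun=> 0%N) (@square_compact z0 r0) KOm.
  exists (C1 + `|c| * 2 `^ (`|m| / 2)); first by rewrite addr_ge0 ?mulr_ge0 ?powR_ge0.
  exists (Num.min d r0); first by rewrite lt_min d_0.
  move=> z; rewrite lt_min => /andP[zd zr] k.
  have zK : K z.
    by split; [exact: le_trans (abs_Re_le _) (ltW zr)|exact: le_trans (abs_Im_le _) (ltW zr)].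
  have [k0|k0] := eqVneq k 0.
    have z00 : zvec R (0 : Zn) = 0 by apply/rowP => j; rewrite !mxE.
    have j1 : jap R k = 1.
      by rewrite japE k0 big1 ?addr0 // => j _; rewrite mxE expr0n.
    rewrite j1 powR1 mulr1 /lattice_symbol k0 z00.
    by apply: le_trans (hC1 z zd) _; rewrite lerDl mulr_ge0 ?powR_ge0.
  have := hc z (zvec R k) zK (enorm_zvec_ge1 k0).
  rewrite /remainder_norm multi_iter_zero big_ord0 subr0 /order_bound.
  rewrite big1 // !subr0 => hb; apply: le_trans hb _.
  have e1 := enorm_zvec_ge1 k0.
  apply: (@le_trans _ _ (`|c| * enorm (zvec R k) `^ m)).
    apply: (@le_trans _ _ (`|c| * enorm (zvec R k) `^ complex.Re (w z))).
      by rewrite ler_wpM2r ?powR_ge0 // ler_norm.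
    by rewrite ler_wpM2l //; apply: ler_powR => //; apply: hw; case: (Kd z zK).
  apply: le_trans (ler_wpM2l (normr_ge0 c) (enorm_powR_le m k0)) _.
  by rewrite mulrA ler_wpM2r ?powR_ge0 // lerDr.
have [C0 C00 [d2 d20 h0]] := one (fun=> 0%N).
have [Cj hCj] := choice (fun j => let: ex_intro2 C c0 H := one (axis_order N' j) in
  ex_intro (fun C => 0 <= C /\ exists2 d : R, 0 < d & forall z, nrm (z - z0) < d -> forall k,
      nrm (multi_iter (@delta R n theta T) (axis_order N' j) (lattice_symbol z k))
        <= C * jap R k `^ (m / 2)) C (conj c0 H)).
have [r r_0 hr] : exists2 r : R, 0 < r & forall j z, nrm (z - z0) < r -> forall k,
      nrm (multi_iter (@delta R n theta T) (axis_order N' j) (lattice_symbol z k))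
        <= Cj j * jap R k `^ (m / 2).
  have [dj hdj] := choice (fun j => let: conj c0 (ex_intro2 d d0 H) := hCj j in
     ex_intro (fun d => 0 < d /\ forall z, nrm (z - z0) < d -> forall k,
      nrm (multi_iter (@delta R n theta T) (axis_order N' j) (lattice_symbol z k))
        <= Cj j * jap R k `^ (m / 2)) d (conj d0 H)).
  exists (\big[Num.min/1]_(j < n) dj j).
    by apply: lt_bigmin => // j _; case: (hdj j).
  move=> j z hz; apply: (hdj j).2; apply: lt_le_trans hz _.
  exact: bigmin_le_cond.
exists (Num.min r (Num.min d1 d2)); first by rewrite !lt_min r_0 d10.
pose A := n.+1%:R ^+ N' * (C0 + \sum_(j < n) Cj j).
exists A.
  by rewrite mulr_ge0 ?exprn_ge0 // addr_ge0 // sumr_ge0 // => j _; case: (hCj j).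
move=> z; rewrite !lt_min => /and3P[zr zd1 zd2]; have Oz := hd1 z zd1; split => // k l.
have hS : is_Cinf (lattice_symbol z k) by exact: symbol_Cinf.
have sn : smooth_norm N' (lattice_symbol z k) <= (C0 + \sum_(j < n) Cj j) * jap R k `^ (m / 2).
  rewrite /smooth_norm mulrDl lerD //.
    by have := h0 z zd2 k; rewrite multi_iter_zero.
  by rewrite mulr_suml; apply: ler_sum => j _; exact: hr.
have := coef_smooth_norm N' l hS => hb.
apply: (@le_trans _ _ (A * jap R l `^ (- N'%:R) * jap R k `^ (m / 2))).
  rewrite powRN powR_mulrn ?(ltW (jap_gt0 _ _)) // mulrAC ler_pdivlMr ?exprn_gt0 ?jap_gt0 //.
  rewrite mulrC; apply: le_trans hb _; rewrite /A -mulrA ler_wpM2l ?exprn_ge0 //.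
apply: ler_wpM2r; first exact: powR_ge0.
apply: ler_wpM2l; last by apply: jap_powR_le; rewrite lerN2.
by rewrite mulr_ge0 ?exprn_ge0 // addr_ge0 // sumr_ge0 // => j _; case: (hCj j).
Qed.

Lemma symbol_sclass z0 m (d0 : R) : Om z0 -> 0 < d0 ->
  (forall z, nrm (z - z0) < d0 -> complex.Re (w z) <= m) -> sclass m (lattice_symbol z0).
Proof.
move=> hz0 d00 hw; split=> [k|N]; first exact: symbol_Cinf.
have [r r0 [A A0 hA]] := symbol_bound_near N hz0 d00 hw.
by exists A => //; apply: (hA z0 _).2; rewrite subrr nrm0.
Qed.

(** [cauchy_taylor] is applied to each scalar function z |-> coef (rho z k) l, bounded by
    [A * W k l] on a disc independent of [k] and [l]; its conclusions carry the same weight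
    [W k l]. *)
Lemma symbol_taylor z0 m (d0 : R) : Om z0 -> 0 < d0 ->
  (forall z, nrm (z - z0) < d0 -> complex.Re (w z) <= m) ->
  exists2 L : Zn -> T, sclass m L &
  forall N, exists2 r : R, 0 < r & exists2 A : R, 0 <= A &
   forall z, nrm (z - z0) < r -> z != z0 ->
    sb N m (A * nrm (z - z0)) (fun k => (z - z0)^-1 *: (lattice_symbol z k - lattice_symbol z0 k) - L k).
Proof.
move=> hz0 d00 hw.
have hL z : exists L : Zn -> T, Om z -> (forall k, is_Cinf (L k)) /\
  forall k l, cdiff (fun z => coef (lattice_symbol z k) l) z (coef (L k) l).
  have [Oz|nOz] := pselect (Om z); last by exists (fun=> 0).
  by have [L hL] := symbol_cdiff Oz; exists L.
(* The derivative is fixed before [N], because one [L] must satisfy the bounds of all orders. *)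
have [L {}hL] := choice hL.
have key N : exists2 r : R, 0 < r & exists2 A : R, 0 <= A & sb N m A (L z0) /\
   forall z, nrm (z - z0) < r -> z != z0 ->
    sb N m (A * nrm (z - z0)) (fun k => (z - z0)^-1 *: (lattice_symbol z k - lattice_symbol z0 k) - L z0 k).
  have [r' r'0 [A A0 hA]] := symbol_bound_near N hz0 d00 hw.
  pose r := r' / 4; have r0 : 0 < r by rewrite divr_gt0.
  (* The sum of the two constants of [cauchy_taylor] serves both the derivative and the
     remainder. *)
  exists r => //; exists (8 * (A / r) + 128 * (A / r ^+ 2)).
    by rewrite addr_ge0 ?mulr_ge0 ?invr_ge0 ?exprn_ge0 // ltW.
  pose W k l := jap R l `^ (- N) * jap R k `^ (m / 2).
  have W0 k l : 0 <= W k l by rewrite mulr_ge0 ?powR_ge0.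
  have ct k l := @cauchy_taylor R (fun z => coef (lattice_symbol z k) l)
    (fun z => coef (L z k) l) z0 r (A * W k l) r0.
  have {}ct k l : nrm (coef (L z0 k) l) <= 8 * (A * W k l / r) /\
    forall z, nrm (z - z0) < r ->
     nrm (coef (lattice_symbol z k) l - coef (lattice_symbol z0 k) l - coef (L z0 k) l * (z - z0))
      <= 128 * (A * W k l / r ^+ 2) * nrm (z - z0) ^+ 2.
    apply: ct => s hs; have [|Os hsb] := hA s; first by move: hs; rewrite /r; lra.
    by split; [exact: (hL s Os).2|rewrite /W mulrA; exact: hsb].
  split=> [k l|z zr zz0 k l].
    have [h _] := ct k l; apply: le_trans h _.
    rewrite [leRHS](_ : _ = 8 * (A * W k l / r) + 128 * (A / r ^+ 2) * W k l).
      by rewrite lerDl mulr_ge0 // mulr_ge0 // divr_ge0 // sqr_ge0.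
    by rewrite /W; ring.
  have [_ /(_ z zr) h] := ct k l.
  have zn : z - z0 != 0 by rewrite subr_eq0.
  have zp : 0 < nrm (z - z0) by rewrite lt_def nrm_ge0 nrm_eq0 zn.
  rewrite fcoefB fcoefZ fcoefB -(ler_pM2r zp) -nrmM.
  have -> : ((z - z0)^-1 * (coef (lattice_symbol z k) l - coef (lattice_symbol z0 k) l)
       - coef (L z0 k) l) * (z - z0) = coef (lattice_symbol z k) l - coef (lattice_symbol z0 k) l
       - coef (L z0 k) l * (z - z0) by field.
  apply: le_trans h _; rewrite expr2 [leLHS]mulrA.
  apply: ler_wpM2r; first exact: nrm_ge0.
  rewrite [leRHS](_ : _ = (128 * (A * W k l / r ^+ 2) + 8 * (A / r) * W k l) * nrm (z - z0)).
    by rewrite ler_wpM2r ?nrm_ge0 // lerDl mulr_ge0 // mulr_ge0 // divr_ge0 // ltW.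
  by rewrite /W; ring.
exists (L z0); last by move=> N; have [r r0 [A A0 [_ h]]] := key N; exists r => //; exists A.
split; first exact: (hL z0 hz0).1.
by move=> N; have [r r0 [A A0 [h _]]] := key N; exists A.
Qed.

(** The common core of all the cases. By linearity, the difference quotient minus [Phi L] is [Phi]
    of the Taylor remainder, whose symbol bound is [A * nrm (z - z0)]; any gauge controlled by
    symbol bounds therefore tends to 0. *)
Lemma holomorphic_quantization (F : gauged R) (Phi : (Zn -> T) -> F) (u : R[i] -> F)
   (z0 : R[i]) (m d0 : R) : Om z0 -> 0 < d0 ->
  (forall z, nrm (z - z0) < d0 -> complex.Re (w z) <= m) ->
  (forall S, sclass m S -> gdom F (Phi S)) ->
  (forall (a : R[i]) S S', sclass m S -> sclass m S' ->
     Phi (fun k => a *: S k + S' k) = a *: Phi S + Phi S') ->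
  (forall p, gauges F p -> exists N, exists2 C : R, 0 <= C & forall S A, 0 <= A ->
     sclass m S -> sb N m A S -> (p (Phi S) <= (C * A)%:E)%E) ->
  (forall z, nrm (z - z0) < d0 -> Om z -> u z = Phi (lattice_symbol z)) ->
  exists2 l : F, gdom F l & ((fun z => (z - z0)^-1 *: (u z - u z0)) @ z0^') --> gnbhs l.
Proof.
move=> hz0 d00 hw Hd Hl Hp hu.
have [L LS hT] := symbol_taylor hz0 d00 hw.
have [d1 d10 hd1] := open_ball hz0.
exists (Phi L); first exact: Hd.
apply: gcvg => p gp e e0; have [N [C C0 hC]] := Hp p gp.
have [r r0 [A A0 hA]] := hT N.
have C1 : 0 < C * A + 1 by rewrite ltr_wpDl ?mulr_ge0.
apply/dnbhs_nrmP; exists (Num.min (Num.min r (e / (C * A + 1))) (Num.min d0 d1)).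
  by rewrite !lt_min r0 d00 d10 divr_gt0.
move=> z; rewrite !lt_min -!andbA => /and4P[zr ze zd0 zd1] zz0 /=.
have Oz := hd1 z zd1.
have S0 : sclass m (lattice_symbol z0) := symbol_sclass hz0 d00 hw.
have Sz : sclass m (lattice_symbol z).
  apply: (@symbol_sclass z m (d0 - nrm (z - z0))) => //; first by rewrite subr_gt0.
  move=> z' hz'; apply: hw; rewrite -[z'](subrK z) -addrA.
  by apply: le_lt_trans (nrmD _ _) _; lra.
rewrite (hu z) // (hu z0) ?subrr ?nrm0 //.
(* Linearity of [Phi] is given in the form [a *: S + S'], so the quotient is assembled from such
   combinations, with the zero symbol for a pure multiple. *)
pose S1 k := (-1 : R[i]) *: lattice_symbol z0 k + lattice_symbol z k.
pose S2 k := (z - z0)^-1 *: S1 k + 0.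
have Sz0 : sclass m (fun k => 0 : T).
  split=> [k|N']; first exact: Cinf0.
  by exists 0 => // k l; rewrite fcoef0 nrm0 !mul0r.
have S1c : sclass m S1 by exact: sclass_lin.
have Phi0 : Phi (fun=> 0) = 0.
  have h := Hl (-1) _ _ Sz0 Sz0.
  transitivity (Phi (fun k : Zn => (-1 : R[i]) *: (0 : T) + 0)).
    by congr Phi; apply/funext => k; rewrite scaler0 addr0.
  by rewrite h scaleN1r addNr.
have PhiE : (z - z0)^-1 *: (Phi (lattice_symbol z) - Phi (lattice_symbol z0)) - Phi L
   = Phi (fun k => (z - z0)^-1 *: (lattice_symbol z k - lattice_symbol z0 k) - L k).
  have -> : (fun k => (z - z0)^-1 *: (lattice_symbol z k - lattice_symbol z0 k) - L k)
      = fun k => (-1 : R[i]) *: L k + S2 k.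
    by apply/funext => k; rewrite /S2 /S1 addr0 !scaleN1r addrC [- _ + lattice_symbol _ _]addrC.
  rewrite Hl //; last exact: sclass_lin.
  rewrite Hl // Phi0 addr0 Hl // !scaleN1r addrC [- _ + Phi (lattice_symbol z)]addrC //.
rewrite PhiE; apply: le_lt_trans (hC _ (A * nrm (z - z0)) _ _ (hA z zr zz0)) _.
- by rewrite mulr_ge0 ?nrm_ge0.
- have -> : (fun k => (z - z0)^-1 *: (lattice_symbol z k - lattice_symbol z0 k) - L k)
      = fun k => (-1 : R[i]) *: L k + S2 k.
    by apply/funext => k; rewrite /S2 /S1 addr0 !scaleN1r addrC [- _ + lattice_symbol _ _]addrC.
  by apply: sclass_lin => //; exact: sclass_lin.
rewrite lte_fin mulrA; apply: (@le_lt_trans _ _ ((C * A + 1) * nrm (z - z0))).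
  by rewrite ler_wpM2r ?nrm_ge0 // lerDl.
by rewrite mulrC -ltr_pdivlMr.
Qed.

End SymbolFamilies.

(** * The three realizations of the operators *)

Section GaugedFilters.
Variable R : realType.

#[export] Instance gnbhs_filter (E : gauged R) (x : E) : Filter (gnbhs x).
Proof.
split.
- by exists set0, 1; split => //; exact: ltr01.
- move=> P Q [G [e [fG Gg e0 GP]]] [G' [e' [fG' Gg' e'0 GQ]]].
  exists (G `|` G'), (Num.min e e'); split => //.
  + by rewrite finite_setU.
  + by move=> p [/Gg|/Gg'].
  + by rewrite lt_min e0.
  move=> y hy; split.
    apply: GP => p Gp; apply: lt_le_trans (hy p (or_introl Gp)) _.
    by rewrite lee_fin ge_min lexx.
  apply: GQ => p Gp; apply: lt_le_trans (hy p (or_intror Gp)) _.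
  by rewrite lee_fin ge_min lexx orbT.
- move=> P Q PQ [G [e [fG Gg e0 GP]]]; exists G, e; split => //.
  exact: subset_trans PQ.
Qed.

Lemma gnbhs_gauge (E : gauged R) (x : E) p (e : R) : gauges E p -> 0 < e ->
  gnbhs x [set y | (p (y - x)%R < e%:E)%E].
Proof.
move=> gp e0; exists [set p], e; split => //; first by move=> q ->.
by move=> y /= hy; exact: hy.
Qed.

Lemma gcontinuous_gauge (E F : gauged R) (f : E -> F) :
  (forall x q (e : R), gdom E x -> gauges F q -> 0 < e ->
    gnbhs x [set y | gdom E y -> (q (f y - f x)%R < e%:E)%E]) ->
  gcontinuous f.
Proof. by move=> h x Ex; apply: gcvg => q gq e e0; exact: h. Qed.

(** Supplies a local order: [eta = 1] where Re w has no global bound, a small [eta] where a strict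
    inequality must be kept. *)
Lemma holomorphic_scalar_bounded (Om : set R[i]) (w : R[i] -> R[i]) z0 (eta : R) :
  @holomorphic R Om (scalars R) w -> Om z0 -> 0 < eta ->
  exists2 d : R, 0 < d & forall z, nrm (z - z0) < d ->
    complex.Re (w z) <= complex.Re (w z0) + eta.
Proof.
move=> [_ hw] Oz0 eta0; have [l _ hcv] := hw z0 Oz0.
have gp : gauges (scalars R) (fun x : R[i]^o => (nrm x)%:E) by [].
have /dnbhs_nrmP[d d0 hd] := gcvg_gauge hcv gp ltr01.
have C0 : 0 < nrm (l : R[i]) + 1 by rewrite ltr_wpDl ?nrm_ge0.
exists (Num.min d (eta / (nrm (l : R[i]) + 1))); first by rewrite lt_min d0 divr_gt0.
move=> z; rewrite lt_min ltr_pdivlMr // => /andP[zd ze].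
have [->|zz0] := eqVneq z z0; first by rewrite lerDl ltW.
have := hd z zd zz0; rewrite /= lte_fin => hb.
have zn : z - z0 != 0 by rewrite subr_eq0.
have e1 : w z - w z0 = (((z - z0)^-1 * (w z - w z0) - l) + l) * (z - z0).
  by rewrite subrK mulrC mulrA divff // mul1r.
have hwz : nrm (w z - w z0) <= eta.
  rewrite e1 nrmM mulrC; apply: le_trans (ltW ze).
  rewrite ler_wpM2l ?nrm_ge0 //; apply: le_trans (nrmD _ _) _.
  by rewrite addrC lerD2l; exact: ltW hb.
have := le_trans (abs_Re_le _) hwz.
have -> : complex.Re (w z - w z0) = complex.Re (w z) - complex.Re (w z0).
  by case: (w z) => ? ?; case: (w z0).
by rewrite ler_norml; lra.
Qed.

End GaugedFilters.

(** * The action on smooth elements *)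

Section SmoothOperators.
Variables (R : realType) (n : nat) (theta : 'M[R]_n) (T : nctorus theta).
Local Notation Zn := 'rV[int]_n.
Implicit Types (k l : Zn) (N m A B : R) (S : Zn -> T).

Lemma lattice_op_linr m S (z : R[i]) (x y : T) : sclass m S -> is_Cinf x -> is_Cinf y ->
  lattice_op S (z *: x + y) = z *: lattice_op S x + lattice_op S y.
Proof.
move=> hS hx hy.
have [h1 e1] := lattice_opP hS hx; have [h2 e2] := lattice_opP hS hy.
have [h3 e3] := lattice_opP hS (Cinf_lin z hx hy).
apply: Cinf_ext => //; first exact: Cinf_lin.
apply/funext => r; rewrite fcoefD fcoefZ e1 e2 e3.
have [B B0 hB] := ((CinfP x).1 hx).1 (0 + m); have [B' B'0 hB'] := ((CinfP y).1 hy).1 (0 + m).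
rewrite -(mact_linr z r B0 B'0 hS hB hB').
by congr mact; apply/funext => k; rewrite fcoefD fcoefZ.
Qed.

Lemma lattice_opB m S (x y : T) : sclass m S -> is_Cinf x -> is_Cinf y ->
  lattice_op S x - lattice_op S y = lattice_op S (x - y).
Proof.
move=> hS hx hy; have := lattice_op_linr (-1) hS hy hx.
by rewrite !scaleN1r ![- _ + _]addrC.
Qed.

Lemma lattice_op_linl m (z : R[i]) S S' : sclass m S -> sclass m S' ->
  lattice_op (fun k => z *: S k + S' k) = z *: lattice_op S + lattice_op S' :> (T -> T).
Proof.
move=> hS hS'; apply/funext => x.
rewrite -[RHS]/(z *: lattice_op S x + lattice_op S' x).
have [hx|hx] := pselect (is_Cinf x); last first.
  by rewrite !lattice_op_out // scaler0 addr0.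
have [h1 e1] := lattice_opP hS hx; have [h2 e2] := lattice_opP hS' hx.
have [h3 e3] := lattice_opP (sclass_lin z hS hS') hx.
apply: Cinf_ext => //; first exact: Cinf_lin.
apply/funext => r; rewrite fcoefD fcoefZ e1 e2 e3.
have [B B0 hB] := ((CinfP x).1 hx).1 (0 + m).
exact: mact_linl hS hS' hB.
Qed.

(** [N], [s] and [C] are independent of the symbol, so one estimate yields both continuity of each
    operator and convergence of the family. *)
Lemma lattice_op_gauge m (b : 'I_n -> nat) : exists N, exists s : R, exists2 C : R, 0 <= C &
  forall S A B (a : T), 0 <= A -> 0 <= B -> sclass m S -> sb N m A S -> is_Cinf a ->
   wb s (coef a) B ->
   nrm (multi_iter (@delta R n theta T) b (lattice_op S a)) <= C * A * B.
Proof.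
have [s hs] := gauge_upper T b.
exists (`|s| / 2 + n%:R), (s + m), (6 ^+ n * schur_const n s).
  by rewrite mulr_ge0 ?schur_const_ge0 ?exprn_ge0.
move=> S A B a A0 B0 hS hA ha hB; have [h1 e1] := lattice_opP hS ha.
rewrite (_ : 6 ^+ n * schur_const n s * A * B = 6 ^+ n * (schur_const n s * A * B)); last by ring.
apply: hs => //; first by rewrite !mulr_ge0 ?schur_const_ge0.
by rewrite e1; exact: mact_wb hB.
Qed.

Lemma gbounded_wb (X : set (Cinf T)) (s : R) : gbounded X ->
  exists2 M : R, 0 <= M & forall a, X a -> wb s (coef a) M.
Proof.
move=> [XC hX]; have [N hN] := @nat_above R ((s + n%:R) / 2).
have g (b : 'I_n -> nat) : gauges (Cinf T)
    (fun a : T => (nrm (multi_iter (@delta R n theta T) b a))%:E) by exists b.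
have hM (b : 'I_n -> nat) : exists M : R, forall a, X a ->
    nrm (multi_iter (@delta R n theta T) b a) <= M.
  by have [M hM] := hX _ (g b); exists M => a /hM; rewrite lee_fin.
have [M0 hM0] := hM (fun=> 0%N).
have [Mj hMj] := choice (fun j => hM (axis_order N j)).
exists `|6 ^+ n * (n.+1%:R ^+ N * (M0 + \sum_(j < n) Mj j))| => // a Xa.
have sn : smooth_norm N a <= M0 + \sum_(j < n) Mj j.
  rewrite /smooth_norm lerD //; last by apply: ler_sum => j _; exact: hMj.
  by have := hM0 a Xa; rewrite multi_iter_zero.
apply: wb_le (gauge_lower hN (XC a Xa)).
  by rewrite !mulr_ge0 ?exprn_ge0 ?smooth_norm_ge0.
apply: le_trans (ler_norm _); rewrite !ler_wpM2l ?exprn_ge0 //.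
Qed.

Lemma gnbhs_smooth_norm (x : Cinf T) (N : nat) (e : R) : 0 < e ->
  gnbhs x [set y : Cinf T | smooth_norm N ((y - x)%R : T) < e].
Proof.
move=> e0; have e1 : 0 < e / n.+1%:R by rewrite divr_gt0.
have g (b : 'I_n -> nat) : gauges (Cinf T)
    (fun a : T => (nrm (multi_iter (@delta R n theta T) b a))%:E) by exists b.
have h0 := gnbhs_gauge x (g (fun=> 0%N)) e1.
have hj : gnbhs x [set y : Cinf T | forall j, [set: 'I_n] j ->
   nrm (multi_iter (@delta R n theta T) (axis_order N j) ((y - x)%R : T)) < e / n.+1%:R].
  apply: (@filter_finite _ _ (gnbhs x) (fun (j : 'I_n) y =>
    nrm (multi_iter (@delta R n theta T) (axis_order N j) ((y - x)%R : T)) < e / n.+1%:R)).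
    exact: finite_finset.
  by move=> j _; apply: filterS (gnbhs_gauge x (g (axis_order N j)) e1) => y; rewrite /= lte_fin.
apply: filterS2 h0 hj => y; rewrite /= lte_fin multi_iter_zero => h0 hj.
rewrite /smooth_norm; apply: (@lt_le_trans _ _ (e / n.+1%:R + \sum_(j < n) e / n.+1%:R)).
  by apply: ltr_leD => //; apply: ler_sum => j _; apply: ltW; exact: hj.
by rewrite sumr_const card_ord -mulrS -[X in X <= _]mulr_natr divfK // pnatr_eq0.
Qed.

Lemma lattice_op_Lin m S : sclass m S -> gdom (Lin (Cinf T) (Cinf T)) (lattice_op S).
Proof.
move=> hS; split.
- by move=> x hx; case: (lattice_opP hS hx).
- by move=> z x y hx hy; exact: lattice_op_linr hS hx hy.
- apply: gcontinuous_gauge => x _ e hx [b ->] e0.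
  have [N [s [C C0 hC]]] := lattice_op_gauge m b.
  have [_ /(_ N)[A A0 hA]] := hS.
  have [N' hN'] := @nat_above R ((s + n%:R) / 2).
  pose D := C * A * (6 ^+ n * n.+1%:R ^+ N') + 1.
  have D0 : 0 < D by rewrite ltr_wpDl // !mulr_ge0 ?exprn_ge0.
  apply: filterS (gnbhs_smooth_norm x N' (divr_gt0 e0 D0)) => y /= hy yC.
  have hyx : is_Cinf (y - x) by rewrite -scaleN1r addrC; exact: Cinf_lin.
  have -> : lattice_op S y - lattice_op S x = lattice_op S (y - x).
    exact: lattice_opB hS yC hx.
  rewrite lte_fin.
  have hb := hC S A _ (y - x) A0 _ hS hA hyx (gauge_lower hN' hyx).
  apply: le_lt_trans (hb _) _.
    by rewrite !mulr_ge0 ?exprn_ge0 ?smooth_norm_ge0.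
  apply: (@le_lt_trans _ _ (D * smooth_norm N' (y - x))).
    rewrite !mulrA ler_wpM2r ?smooth_norm_ge0 // /D !mulrA lerDl //.
  by rewrite mulrC -ltr_pdivlMr.
- by move=> x hx; exact: lattice_op_out.
Qed.

Lemma holomorphic_smooth (Om : set R[i]) (w : R[i] -> R[i]) (P : R[i] -> T -> T) :
  open Om -> holomorphic_psidos Om w P -> @holomorphic R Om (Lin (Cinf T) (Cinf T)) P.
Proof.
move=> hOm [rho hrho hP]; have [hw _ _ _] := hrho.
have PE z : Om z -> P z = lattice_op (lattice_symbol rho z) by move=> /hP.
split=> [z Oz|z0 Oz0].
  have [d d0 hd] := holomorphic_scalar_bounded hw Oz ltr01.
  by rewrite PE //; exact: lattice_op_Lin (symbol_sclass hOm hrho Oz d0 hd).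
have [d d0 hd] := holomorphic_scalar_bounded hw Oz0 ltr01.
apply: (@holomorphic_quantization R n theta T Om hOm w rho hrho (Lin (Cinf T) (Cinf T))
  (@lattice_op R n theta T) P z0 _ d Oz0 d0 hd).
- by move=> S; exact: lattice_op_Lin.
- by move=> a S S' hS hS'; exact: lattice_op_linl hS hS'.
- move=> _ [X [q [bX [b ->] ->]]].
  have [N [s [C C0 hC]]] := lattice_op_gauge (complex.Re (w z0) + 1) b.
  have [M M0 hM] := gbounded_wb s bX.
  exists N, (C * M); first exact: mulr_ge0.
  move=> S A A0 hS hA; apply: ge_ereal_sup => _ [x Xx <-]; rewrite lee_fin mulrAC.
  by apply: hC => //; [exact: bX.1|exact: hM].
- by move=> z _ Oz; exact: PE.
Qed.

End SmoothOperators.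

(** * Distributions and Sobolev spaces *)

Section Distributions.
Variables (R : realType) (n : nat) (theta : 'M[R]_n) (T : nctorus theta).
Local Notation Zn := 'rV[int]_n.
Local Notation U k := (mono (@nc_gen R n theta T) k).
Implicit Types (k l r : Zn) (s m A B : R) (c : Zn -> R[i]) (v : T) (u : distr T).

Lemma wb_opp s c c' B : (forall k, nrm (c' k) = nrm (c (- k))) -> wb s c B -> wb s c' B.
Proof.
move=> h hc K.
have uK : uniq [seq - k | k <- K] by rewrite map_inj_uniq ?fset_uniq //; exact: oppr_inj.
apply: le_trans (hc [fset k in [seq - k | k <- K]]%fset).
rewrite sum_fset_seq // big_map; apply: ler_sum => k _.
by rewrite h japN.
Qed.

(** A right inverse of [fourier] on sequences of polynomial growth, see [fourier_dist_of]. *)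
Definition dist_of c : distr T := patch (fun=> 0) (@is_Cinf R n theta T)
  (fun v => xget 0 [set d : R[i] | hsum (V := R[i]) (fun r => c r * nc_tr (U r ** v)) d]).

(** [c] is bounded pointwise and [v] in l^1, which costs n orders: [v] is measured with weight n - s
    instead of the dual weight -s. *)
Lemma pairing_summable s c B B' v : 0 <= B -> 0 <= B' -> wb s c B ->
  wb (n%:R - s) (coef v) B' ->
  exists2 d : R[i], hsum (V := R[i]) (fun r => c r * nc_tr (U r ** v)) d &
    nrm d <= 6 ^+ n * B * B'.
Proof.
move=> B0 B0' hc hv.
have ht : wb (n%:R - s) (fun r => nc_tr (U r ** v)) B'.
  by apply: wb_opp hv => r; exact: nrm_tr_mono.
apply: (@hsum_absC R n theta T _
  (fun r => B * (jap R r `^ ((n%:R - s - n%:R) / 2) * nrm (nc_tr (U r ** v))))).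
  move=> r; rewrite nrmM mulrA ler_wpM2r ?nrm_ge0 //.
  have -> : (n%:R - s - n%:R) / 2 = - (s / 2) by field.
  by rewrite powRN ler_pdivlMr ?powR_gt0 ?jap_gt0 // mulrC wb_point.
move=> K; rewrite -mulr_sumr (mulrC (6 ^+ n)) -mulrA ler_wpM2l //.
exact: (wb_l1 B0' (fset_uniq K) ht).
Qed.

Lemma dist_of_hsum s c B v : 0 <= B -> wb s c B -> is_Cinf v ->
  hsum (V := R[i]) (fun r => c r * nc_tr (U r ** v)) (dist_of c v : R[i]).
Proof.
move=> B0 hc hv; have [B' B0' hB'] := ((CinfP v).1 hv).1 (n%:R - s).
have [d hd _] := pairing_summable B0 B0' hc hB'.
have -> : dist_of c v = xget 0
    [set d : R[i] | hsum (V := R[i]) (fun r => c r * nc_tr (U r ** v)) d].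
  by rewrite /dist_of patchT //; exact/mem_set.
exact: (@xgetPex R[i] 0
  [set d : R[i] | hsum (V := R[i]) (fun r => c r * nc_tr (U r ** v)) d] (ex_intro _ d hd)).
Qed.

Lemma dist_of_bound s c B B' v : 0 <= B -> 0 <= B' -> wb s c B -> is_Cinf v ->
  wb (n%:R - s) (coef v) B' -> nrm (dist_of c v : R[i]) <= 6 ^+ n * B * B'.
Proof.
move=> B0 B0' hc hv hB'; have [d hd db] := pairing_summable B0 B0' hc hB'.
by rewrite (hsum_unique (dist_of_hsum B0 hc hv) hd).
Qed.

Lemma dist_of_out c v : ~ is_Cinf v -> dist_of c v = 0.
Proof. by move=> h; rewrite /dist_of patchN // notin_setE. Qed.

Lemma dist_of_lin (z : R[i]) s c c' B B' : 0 <= B -> 0 <= B' -> wb s c B -> wb s c' B' ->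
  dist_of (fun k => z * c k + c' k) = z *: dist_of c + dist_of c'.
Proof.
move=> B0 B0' hc hc'; apply/funext => v.
rewrite -[RHS]/(z * (dist_of c v : R[i]) + (dist_of c' v : R[i])).
have [hv|hv] := pselect (is_Cinf v); last first.
  by rewrite !dist_of_out // mulr0 addr0.
have B2 : 0 <= 2 * (nrm z * B + B') by rewrite mulr_ge0 ?addr_ge0 ?mulr_ge0 ?nrm_ge0.
have h := dist_of_hsum B2 (wb_lin z B0 B0' hc hc') hv.
apply: (hsum_unique h).
apply: hsum_ext (hsum_lin (c := z) (dist_of_hsum B0 hc hv) (dist_of_hsum B0' hc' hv)) => r.
by rewrite /= -[_ *: _]/(z * _); ring.
Qed.

Lemma dist_of_linr s c B (z : R[i]) v v' : 0 <= B -> wb s c B -> is_Cinf v -> is_Cinf v' ->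
  dist_of c (z *: v + v') = z * (dist_of c v : R[i]) + (dist_of c v' : R[i]).
Proof.
move=> B0 hc hv hv'.
apply: (hsum_unique (dist_of_hsum B0 hc (Cinf_lin z hv hv'))).
apply: hsum_ext (hsum_lin (c := z) (dist_of_hsum B0 hc hv) (dist_of_hsum B0 hc hv')) => r.
by rewrite /= -[_ *: _]/(z * _) cmulDr cmulZr trD trZ; ring.
Qed.

Lemma dist_of_gdom s c B : 0 <= B -> wb s c B -> gdom (distr T) (dist_of c).
Proof.
move=> B0 hc; split => //; last by move=> v hv; exact: dist_of_out.
- by move=> z v v' hv hv'; exact: dist_of_linr hc hv hv'.
apply: gcontinuous_gauge => x _ e hx -> e0.
have [N hN] := @nat_above R ((n%:R - s + n%:R) / 2).
pose D := 6 ^+ n * B * (6 ^+ n * n.+1%:R ^+ N) + 1.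
have D0 : 0 < D by rewrite ltr_wpDl // !mulr_ge0 ?exprn_ge0.
apply: filterS (gnbhs_smooth_norm x N (divr_gt0 e0 D0)) => y /= hy yC.
have hyx : is_Cinf ((y : T) - (x : T)) by rewrite -scaleN1r addrC; exact: Cinf_lin.
have -> : dist_of c y - dist_of c x = dist_of c ((y : T) - (x : T)).
  have := dist_of_linr (-1) B0 hc hx yC; rewrite scaleN1r mulN1r => h.
  by rewrite [(y : T) - _]addrC h addrC.
rewrite lte_fin; apply: le_lt_trans (dist_of_bound B0 _ hc hyx (gauge_lower hN hyx)) _.
  by rewrite !mulr_ge0 ?exprn_ge0 ?smooth_norm_ge0.
apply: (@le_lt_trans _ _ (D * smooth_norm N ((y : T) - (x : T)))).
  by rewrite !mulrA ler_wpM2r ?smooth_norm_ge0 // /D !mulrA lerDl.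
by rewrite mulrC -ltr_pdivlMr.
Qed.

Lemma fourier_dist_of s c B : 0 <= B -> wb s c B -> fourier (dist_of c) = c.
Proof.
move=> B0 hc; apply/funext => k.
apply: (hsum_unique (dist_of_hsum B0 hc (Cinf_star_mono T k))).
have := @hsum_fin R n R[i] [fset k]%fset (fun r => c r * nc_tr (U r ** star (U k))).
rewrite big_seq_fset1 tr_mono_star eqxx mulr1; apply => r.
by rewrite inE tr_mono_star => /negbTE ->; rewrite mulr0.
Qed.

Lemma dist_of_coef (b : T) : is_Cinf b -> dist_of (coef b) = distr_of b.
Proof.
move=> hb; have [hb1 hb2] := (CinfP b).1 hb; have [B B0 hB] := hb1 0.
apply/funext => v; have [hv|hv] := pselect (is_Cinf v); last first.
  by rewrite dist_of_out // /distr_of patchN // notin_setE.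
rewrite /distr_of patchT; last exact/mem_set.
apply: (hsum_unique (dist_of_hsum B0 hB hv)).
apply: hsum_ext (hsum_linear (phi := fun x : T => nc_tr (x ** v) : R[i]) (C := nrm v) _ _ hb2).
- by move=> r; rewrite cmulZl trZ.
- by move=> a x y; rewrite cmulDl cmulZl trD trZ.
- by move=> x; apply: le_trans (nrm_tr _) _; rewrite mulrC nrm_cmul.
Qed.

Lemma sobolev_sq_le s u B : 0 <= B ->
  (sobolev_sq s u <= (B ^+ 2)%:E)%E <-> wb s (fourier u) B.
Proof.
move=> B0; rewrite /sobolev_sq; split=> [h K|h].
  rewrite -lee_fin; apply: le_trans h; apply: esum_ge; exists [set` K].
    by split => //; exact: finite_fset.
  by rewrite fsbig_finite ?set_fsetK //= ?sumEFin //; exact: finite_fset.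
apply: ge_ereal_sup => _ [K [fK _] <-].
by rewrite fsbig_finite //= sumEFin lee_fin; exact: h.
Qed.

Lemma sqrt_sqr_ereal B : 0 <= B -> ((B ^+ 2)%:E `^ 2^-1)%E = B%:E.
Proof.
by move=> B0; rewrite poweR_EFin -powR_mulrn // -powRrM divff // powRr1.
Qed.

Lemma sobolev_sq_ge0 s u : (0 <= sobolev_sq s u)%E.
Proof. by apply: esum_ge0 => k _; rewrite lee_fin mulr_ge0 ?powR_ge0 ?sqr_ge0. Qed.

Lemma sobolev_gauge_le s u B : 0 <= B -> wb s (fourier u) B ->
  (sobolev_sq s u `^ 2^-1 <= B%:E)%E.
Proof.
move=> B0 /(sobolev_sq_le _ _ B0) h; rewrite -(sqrt_sqr_ereal B0).
apply: gt0_ler_poweR => //; rewrite in_itv /= leey andbT.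
  exact: sobolev_sq_ge0.
by rewrite lee_fin sqr_ge0.
Qed.

Lemma sobolev_norm s u : gdom (sobolev T s) u -> exists2 B, 0 <= B &
  wb s (fourier u) B /\ (sobolev_sq s u `^ 2^-1)%E = B%:E.
Proof.
move=> [_ h]; have h0 := sobolev_sq_ge0 s u.
have hf : sobolev_sq s u \is a fin_num by rewrite ge0_fin_numE.
pose B := Num.sqrt (fine (sobolev_sq s u)).
have B0 : 0 <= B by exact: sqrtr_ge0.
have e : sobolev_sq s u = (B ^+ 2)%:E by rewrite sqr_sqrtr ?fineK // fine_ge0.
exists B => //; split; last by rewrite e sqrt_sqr_ereal.
by apply/(sobolev_sq_le _ _ B0); rewrite e.
Qed.

Lemma distr_gdom_lin (z : R[i]) u u' : gdom (distr T) u -> gdom (distr T) u' ->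
  gdom (distr T) (z *: u + u').
Proof.
move=> [_ lu cu ou] [_ lu' cu' ou'].
have E v : (z *: u + u') v = z * (u v : R[i]) + (u' v : R[i]) :> R[i] by [].
split => //.
- move=> a x y hx hy; rewrite !E lu // lu' // -![_ *: _]/(_ * _ : R[i]).
  by rewrite /=; ring.
- apply: gcontinuous_gauge => x _ e hx -> e0.
  have z0 : 0 < 2 * (nrm z + 1) by rewrite mulr_gt0 // ltr_wpDl ?nrm_ge0.
  have gp : gauges (scalars R) (fun x : R[i]^o => (nrm x)%:E) by [].
  have e1 : 0 < e / (2 * (nrm z + 1)) by rewrite divr_gt0.
  have h1 : gnbhs x [set y : Cinf T | gdom (Cinf T) y ->
      ((nrm (u y - u x : R[i]))%:E < (e / (2 * (nrm z + 1)))%:E)%E].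
    exact: gcvg_gauge (cu x hx) gp e1.
  have h2 : gnbhs x [set y : Cinf T | gdom (Cinf T) y ->
      ((nrm (u' y - u' x : R[i]))%:E < (e / (2 * (nrm z + 1)))%:E)%E].
    exact: gcvg_gauge (cu' x hx) gp e1.
  apply: filterS2 h1 h2 => y /= h1 h2 yC.
  have {}h1 := h1 yC; have {}h2 := h2 yC; rewrite !lte_fin in h1 h2 *.
  rewrite !E -![_ - _]/(_ - _ : R[i]).
  have -> : z * (u y : R[i]) + (u' y : R[i]) - (z * (u x : R[i]) + (u' x : R[i]))
    = z * ((u y : R[i]) - (u x : R[i])) + ((u' y : R[i]) - (u' x : R[i])) by ring.
  apply: le_lt_trans (nrmD _ _) _; rewrite nrmM.
  set a := nrm (_ - _) in h1 *; set b := nrm (_ - _) in h2 *.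
  have a0 : 0 <= a by exact: nrm_ge0.
  have b0 : 0 <= b by exact: nrm_ge0.
  have zz := nrm_ge0 z.
  rewrite ltr_pdivlMr // in h1; rewrite ltr_pdivlMr // in h2.
  by nra.
- by move=> x hx; rewrite E ou // ou' // mulr0 addr0.
Qed.

Lemma fourier_lin (z : R[i]) u u' k :
  fourier (z *: u + u') k = z * fourier u k + fourier u' k.
Proof. by []. Qed.

Lemma sobolev_gdom_lin s (z : R[i]) u u' : gdom (sobolev T s) u -> gdom (sobolev T s) u' ->
  gdom (sobolev T s) (z *: u + u').
Proof.
move=> hu hu'; have [B B0 [hB _]] := sobolev_norm hu; have [B' B0' [hB' _]] := sobolev_norm hu'.
split; first by apply: distr_gdom_lin; [case: hu|case: hu'].
have B2 : 0 <= 2 * (nrm z * B + B') by rewrite mulr_ge0 ?addr_ge0 ?mulr_ge0 ?nrm_ge0.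
apply: (@le_lt_trans _ _ (((2 * (nrm z * B + B')) ^+ 2)%:E)); last exact: ltry.
by apply/(sobolev_sq_le _ _ B2); exact: wb_lin.
Qed.

Lemma dist_of_sobolev s c B : 0 <= B -> wb s c B -> gdom (sobolev T s) (dist_of c).
Proof.
move=> B0 hc; split; first exact: dist_of_gdom hc.
apply: (@le_lt_trans _ _ ((B ^+ 2)%:E)); last exact: ltry.
by apply/(sobolev_sq_le _ _ B0); rewrite (fourier_dist_of B0 hc).
Qed.

Definition sobolev_op s m (S : Zn -> T) : distr T -> distr T :=
  patch (fun=> 0) (gdom (sobolev T (s + m))) (fun u => dist_of (mact S (fourier u))).

Lemma sobolev_opE s m S u : gdom (sobolev T (s + m)) u ->
  sobolev_op s m S u = dist_of (mact S (fourier u)).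
Proof. by move=> hu; rewrite /sobolev_op patchT //; exact/mem_set. Qed.

Lemma sobolev_op_out s m S u : ~ gdom (sobolev T (s + m)) u -> sobolev_op s m S u = 0.
Proof. by move=> hu; rewrite /sobolev_op patchN // notin_setE. Qed.

Lemma mact_sobolev s m A (S : Zn -> T) u B : 0 <= A -> 0 <= B -> sb (`|s| / 2 + n%:R) m A S ->
  wb (s + m) (fourier u) B -> wb s (mact S (fourier u)) (schur_const n s * A * B).
Proof. by move=> A0 B0 hA hB; exact: mact_wb hA hB. Qed.

Lemma sobolev_op_linr s m (S : Zn -> T) (z : R[i]) u u' : sclass m S ->
  gdom (sobolev T (s + m)) u -> gdom (sobolev T (s + m)) u' ->
  sobolev_op s m S (z *: u + u') = z *: sobolev_op s m S u + sobolev_op s m S u'.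
Proof.
move=> hS hu hu'; rewrite !sobolev_opE //; last exact: sobolev_gdom_lin.
have [B B0 [hB _]] := sobolev_norm hu; have [B' B0' [hB' _]] := sobolev_norm hu'.
have [_ /(_ (`|s| / 2 + n%:R))[A A0 hA]] := hS.
have C0 : 0 <= schur_const n s * A * B by rewrite !mulr_ge0 ?schur_const_ge0.
have C0' : 0 <= schur_const n s * A * B' by rewrite !mulr_ge0 ?schur_const_ge0.
rewrite -(dist_of_lin z C0 C0' (mact_sobolev A0 B0 hA hB) (mact_sobolev A0 B0' hA hB')).
congr dist_of; apply/funext => r.
rewrite -(mact_linr z r B0 B0' hS hB hB').
by congr mact; apply/funext => k; rewrite fourier_lin.
Qed.

Lemma sobolev_op_linl s m (S S' : Zn -> T) (z : R[i]) : sclass m S -> sclass m S' ->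
  sobolev_op s m (fun k => z *: S k + S' k) = z *: sobolev_op s m S + sobolev_op s m S'.
Proof.
move=> hS hS'; apply/funext => u.
rewrite -[RHS]/(z *: sobolev_op s m S u + sobolev_op s m S' u).
have [hu|hu] := pselect (gdom (sobolev T (s + m)) u); last first.
  by rewrite !sobolev_op_out // scaler0 addr0.
rewrite !sobolev_opE //; have [B B0 [hB _]] := sobolev_norm hu.
have [_ /(_ (`|s| / 2 + n%:R))[A A0 hA]] := hS.
have [_ /(_ (`|s| / 2 + n%:R))[A' A0' hA']] := hS'.
have C0 : 0 <= schur_const n s * A * B by rewrite !mulr_ge0 ?schur_const_ge0.
have C0' : 0 <= schur_const n s * A' * B by rewrite !mulr_ge0 ?schur_const_ge0.
rewrite -(dist_of_lin z C0 C0' (mact_sobolev A0 B0 hA hB) (mact_sobolev A0' B0 hA' hB)).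
by congr dist_of; apply/funext => r; exact: mact_linl hS hS' hB.
Qed.

Lemma sobolev_op_gauge s m (S : Zn -> T) A u : 0 <= A -> sb (`|s| / 2 + n%:R) m A S ->
  gdom (sobolev T (s + m)) u -> gdom (sobolev T s) (sobolev_op s m S u) /\
  (sobolev_sq s (sobolev_op s m S u) `^ 2^-1
    <= (schur_const n s * A)%:E * sobolev_sq (s + m) u `^ 2^-1)%E.
Proof.
move=> A0 hA hu; have [B B0 [hB e]] := sobolev_norm hu; rewrite sobolev_opE // e.
have C0 : 0 <= schur_const n s * A * B by rewrite !mulr_ge0 ?schur_const_ge0.
have hw := mact_sobolev A0 B0 hA hB.
split; first exact: dist_of_sobolev hw.
by rewrite -EFinM; apply: sobolev_gauge_le => //; rewrite (fourier_dist_of C0 hw).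
Qed.

Lemma sobolev_op_Lin s m (S : Zn -> T) : sclass m S ->
  gdom (Lin (sobolev T (s + m)) (sobolev T s)) (sobolev_op s m S).
Proof.
move=> hS; have [_ /(_ (`|s| / 2 + n%:R))[A A0 hA]] := hS.
split.
- by move=> u hu; case: (sobolev_op_gauge A0 hA hu).
- by move=> z u u' hu hu'; exact: sobolev_op_linr.
- apply: gcontinuous_gauge => u _ e hu -> e0.
  have C0 : 0 < schur_const n s * A + 1 by rewrite ltr_wpDl // mulr_ge0 ?schur_const_ge0.
  have gp : gauges (sobolev T (s + m)) (fun u => (sobolev_sq (s + m) u `^ 2^-1)%E) by [].
  apply: filterS (gnbhs_gauge u gp (divr_gt0 e0 C0)) => u' /= h hu'.
  have hd : gdom (sobolev T (s + m)) ((-1 : R[i]) *: u + u') by exact: sobolev_gdom_lin.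
  have e1 : sobolev_op s m S u' - sobolev_op s m S u = sobolev_op s m S ((-1 : R[i]) *: u + u').
    by rewrite sobolev_op_linr // scaleN1r addrC.
  rewrite e1; apply: le_lt_trans (sobolev_op_gauge A0 hA hd).2 _.
  have e2 (a b : distr T) : b - a = (-1 : R[i]) *: a + b by rewrite scaleN1r addrC.
  have {}h : (sobolev_sq (s + m) ((-1 : R[i]) *: u + u') `^ 2^-1
      < (e / (schur_const n s * A + 1))%:E)%E by rewrite -(e2 u u'); exact: h.
  have [B B0 [_ eB]] := sobolev_norm hd; rewrite eB in h *.
  rewrite -EFinM lte_fin; rewrite lte_fin ltr_pdivlMr // in h.
  apply: le_lt_trans h; rewrite mulrC ler_wpM2l // lerDl //.
- by move=> u hu; exact: sobolev_op_out.
Qed.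

(** [Q z] extends [P z] because, for smooth [a], both results have the coefficients
    [mact S (coef a)]. *)
Lemma holomorphic_sobolev (Om : set R[i]) (w : R[i] -> R[i]) (P : R[i] -> T -> T) m :
  open Om -> holomorphic_psidos Om w P -> (forall z, Om z -> complex.Re (w z) <= m) ->
  forall s, exists Q : R[i] -> distr T -> distr T,
    (forall z a, Om z -> is_Cinf a -> Q z (distr_of a) = distr_of (P z a)) /\
    @holomorphic R Om (Lin (sobolev T (s + m)) (sobolev T s)) Q.
Proof.
move=> hOm [rho hrho hP] hm s.
have hS z : Om z -> sclass m (lattice_symbol rho z).
  move=> Oz; have [d d0 hd] := open_ball hOm Oz.
  by apply: (symbol_sclass hOm hrho Oz d0) => z' /hd; exact: hm.
exists (fun z => sobolev_op s m (lattice_symbol rho z)); split.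
  move=> z a Oz ha; rewrite hP // -dist_of_coef //.
  have [B B0 hB] := ((CinfP a).1 ha).1 (s + m).
  have [hPa cPa] := lattice_opP (hS z Oz) ha.
  rewrite sobolev_opE; last exact: dist_of_sobolev hB.
  by rewrite (fourier_dist_of B0 hB) -cPa dist_of_coef.
split=> [z Oz|z0 Oz0]; first by apply: sobolev_op_Lin; exact: hS.
have [d d0 hd] := open_ball hOm Oz0.
apply: (@holomorphic_quantization R n theta T Om hOm w rho hrho
  (Lin (sobolev T (s + m)) (sobolev T s)) (sobolev_op s m) _ z0 m d Oz0 d0).
- by move=> z /hd; exact: hm.
- by move=> S; exact: sobolev_op_Lin.
- by move=> a S S' hS1 hS2; exact: sobolev_op_linl.
- move=> _ [X [q [[XC hX] -> ->]]].
  have gp : gauges (sobolev T (s + m)) (fun u => (sobolev_sq (s + m) u `^ 2^-1)%E) by [].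
  have [M hM] := hX _ gp.
  exists (`|s| / 2 + n%:R), (schur_const n s * `|M|); first by rewrite mulr_ge0 ?schur_const_ge0.
  move=> S A A0 _ hA; apply: ge_ereal_sup => _ [u Xu <-].
  apply: le_trans (sobolev_op_gauge A0 hA (XC u Xu)).2 _.
  have [B B0 [_ eB]] := sobolev_norm (XC u Xu); have := hM u Xu.
  rewrite eB -EFinM !lee_fin => BM.
  rewrite [leRHS]mulrAC; apply: ler_wpM2l; first by rewrite mulr_ge0 ?schur_const_ge0.
  exact: le_trans BM (ler_norm M).
- by [].
Qed.

End Distributions.

(** * Singular values *)

Section HilbertBasics.
Variables (R : realType) (H : hilbertType R).
Implicit Types (x y z : H) (a : R[i]).

Lemma hdot0l y : hdot (0 : H) y = 0.
Proof. by rewrite -(scale0r (0 : H)) hdotZl mul0r. Qed.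

Lemma hdotDr x y z : hdot x (y + z) = hdot x y + hdot x z.
Proof. by rewrite hdotC hdotDl rmorphD /= -!hdotC. Qed.

Lemma hdotZr a x y : hdot x (a *: y) = a^* * hdot x y.
Proof. by rewrite hdotC hdotZl rmorphM /= -hdotC. Qed.

Lemma hdotBl x y z : hdot (x - y) z = hdot x z - hdot y z.
Proof. by rewrite hdotDl -scaleN1r hdotZl mulN1r. Qed.

Lemma hdotBr x y z : hdot x (y - z) = hdot x y - hdot x z.
Proof. by rewrite hdotDr -scaleN1r hdotZr rmorphN rmorph1 mulN1r. Qed.

Lemma hdot_suml I (s : seq I) (F : I -> H) y :
  hdot (\sum_(i <- s) F i) y = \sum_(i <- s) hdot (F i) y.
Proof. by elim: s => [|i s IH]; rewrite ?big_nil ?hdot0l // !big_cons hdotDl IH. Qed.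

Lemma hdot_nrm x : hdot x x = (nrm x ^+ 2)%:C%C.
Proof. by rewrite hdot_norm -nrmE rmorphXn. Qed.

Lemma mul_conj_nrm a : a * a^* = (nrm a ^+ 2)%:C%C.
Proof. by rewrite -normCK -nrmE rmorphXn. Qed.

Lemma conj_real (t : R) : (t%:C%C : R[i])^* = t%:C%C.
Proof. by apply/eqP; rewrite eq_complex /= oppr0 !eqxx. Qed.

Lemma nrm_hdot x y : nrm (hdot x y) <= nrm x * nrm y.
Proof.
have [->|y0] := eqVneq y 0.
  by rewrite hdotC hdot0l rmorph0 nrm0 mulr_ge0 ?nrm_ge0.
have ny : 0 < nrm y by rewrite lt_def nrm_ge0 nrm_eq0 y0.
(* Cauchy-Schwarz follows from the squared norm of the component of [x] orthogonal to [y]. *)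
pose b := hdot x y; pose q : R := (nrm y ^+ 2)^-1.
have h : hdot (x - (b * q%:C%C) *: y) (x - (b * q%:C%C) *: y)
    = (nrm x ^+ 2 - nrm b ^+ 2 * q)%:C%C.
  rewrite hdotBl !hdotBr hdotZl !hdotZr hdotZl hdot_nrm hdot_nrm -/b (hdotC y x) -/b.
  have cq : (b * q%:C%C)^* = b^* * q%:C%C.
    by rewrite rmorphM /= conj_real.
  rewrite cq.
  have -> : (nrm x ^+ 2 - nrm b ^+ 2 * q)%:C%C = (nrm x ^+ 2)%:C%C - b * b^* * q%:C%C :> R[i].
    by rewrite mul_conj_nrm -rmorphM -rmorphB.
  have qy : q%:C%C * (nrm y ^+ 2)%:C%C = 1 :> R[i].
    by rewrite -rmorphM /= mulVf ?gt_eqF // exprn_gt0.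
  have -> : b^* * q%:C%C * (b * q%:C%C * (nrm y ^+ 2)%:C%C)
    = b * b^* * q%:C%C * (q%:C%C * (nrm y ^+ 2)%:C%C) by ring.
  by rewrite qy; ring.
have : 0 <= nrm x ^+ 2 - nrm b ^+ 2 * q.
  by rewrite -lecR -h hdot_nrm lecR sqr_ge0.
rewrite subr_ge0 /q ler_pdivrMr ?exprn_gt0 // -exprMn.
by rewrite ler_pXn2r ?nnegrE ?mulr_ge0 ?nrm_ge0.
Qed.

Lemma hdot_sum_orthonormal (I : eqType) (f : I -> H) (s : seq I) (c : I -> R[i]) i :
  uniq s -> i \in s -> {in s &, forall j k, hdot (f j) (f k) = (j == k)%:R} ->
  hdot (\sum_(j <- s) c j *: f j) (f i) = c i.
Proof.
move=> us si ortho; rewrite hdot_suml (bigD1_seq i) //= hdotZl ortho // eqxx mulr1.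
rewrite big_seq_cond big1 ?addr0 // => j /andP[sj ji].
by rewrite hdotZl ortho // (negbTE ji) mulr0.
Qed.

Lemma nrm_sum_orthonormal (I : eqType) (f : I -> H) (s : seq I) (c : I -> R[i]) :
  uniq s -> {in s &, forall j k, hdot (f j) (f k) = (j == k)%:R} ->
  nrm (\sum_(j <- s) c j *: f j) ^+ 2 = \sum_(j <- s) nrm (c j) ^+ 2.
Proof.
move=> us ortho; apply: (@complexI R); rewrite -hdot_nrm {1}hdot_suml rmorph_sum /=.
rewrite big_seq [RHS]big_seq; apply: eq_bigr => j sj.
by rewrite hdotZl hdotC hdot_sum_orthonormal // mul_conj_nrm.
Qed.

Lemma bessel (I : eqType) (f : I -> H) (s : seq I) x :
  uniq s -> {in s &, forall j k, hdot (f j) (f k) = (j == k)%:R} ->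
  \sum_(j <- s) nrm (hdot x (f j)) ^+ 2 <= nrm x ^+ 2.
Proof.
move=> us ortho; pose y := \sum_(j <- s) hdot x (f j) *: f j.
have ny : nrm y ^+ 2 = \sum_(j <- s) nrm (hdot x (f j)) ^+ 2.
  exact: nrm_sum_orthonormal.
have yx : hdot y x = (nrm y ^+ 2)%:C%C.
  rewrite hdot_suml ny rmorph_sum /=; apply: eq_bigr => j _.
  by rewrite hdotZl (hdotC (f j)) mul_conj_nrm.
rewrite -ny -lecR -subr_ge0.
have -> : (nrm x ^+ 2)%:C%C - (nrm y ^+ 2)%:C%C = hdot (x - y) (x - y).
  have xy : hdot x y = (nrm y ^+ 2)%:C%C.
    by rewrite hdotC yx conj_real.
  by rewrite hdotBl !hdotBr xy yx !hdot_nrm; ring.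
by rewrite hdot_nrm lecR sqr_ge0.
Qed.

(* Courant-Fischer: some nonzero combination of the first j+1 singular vectors
   is orthogonal to the at most j vectors g k, k in s. *)
Lemma singular_values_le (T : H -> H) mu (j : nat) (I : Type) (s : seq I) (g : I -> H) (lam : R) :
  (forall (a : R[i]) x y, T (a *: x + y) = a *: T x + T y) ->
  is_singular_values T mu -> (size s <= j)%N -> 0 <= lam ->
  (forall x, (forall k : 'I_(size s), hdot x (g (tnth (in_tuple s) k)) = 0) ->
     nrm (T x) <= lam * nrm x) ->
  mu j <= lam.
Proof.
move=> Tlin [mu0 mudec [e [eo ee _]]] sj lam0 hT.
have [//|muj] := leP (mu j) lam; exfalso.
have mujp : 0 < mu j by exact: le_lt_trans muj.
have mup (i : 'I_j.+1) : 0 < mu i.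
  by apply: lt_le_trans mujp _; apply: mudec; rewrite -ltnS.
(* With j + 1 rows and at most j columns the rows are dependent; a nonzero [v] in the left kernel is
   the required combination. *)
pose M : 'M[R[i]]_(j.+1, size s) := \matrix_(i, k) hdot (e i) (g (tnth (in_tuple s) k)).
have : kermx M != 0.
  rewrite kermx_eq0 /row_free; apply/negP => /eqP h.
  by have := rank_leq_col M; rewrite h leqNgt ltnS sj.
case/rowV0Pn => v /sub_kermxP vM v0.
pose x := \sum_(i <- enum 'I_j.+1) v ord0 i *: e i.
have ortho : {in enum 'I_j.+1 &, forall i k : 'I_j.+1, hdot (e i) (e k) = (i == k)%:R}.
  by move=> i k _ _; rewrite eo.
have uE : uniq (enum 'I_j.+1) by exact: enum_uniq.
have nx : nrm x ^+ 2 = \sum_(i < j.+1) nrm (v ord0 i) ^+ 2.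
  rewrite (@nrm_sum_orthonormal _ (fun i : 'I_j.+1 => e i) _ (fun i => v ord0 i)) //.
  by rewrite big_enum.
have nxp : 0 < nrm x ^+ 2.
  rewrite nx lt_def sumr_ge0 ?andbT => [|i _]; last exact: sqr_ge0.
  apply: contra_neq v0 => h; apply/rowP => i; rewrite mxE.
  have /psumr_eq0P : forall i : 'I_j.+1, true -> 0 <= nrm (v ord0 i) ^+ 2.
    by move=> ? _; exact: sqr_ge0.
  by move=> /(_ h i isT)/eqP; rewrite sqrf_eq0 nrm_eq0 => /eqP.
have xg k : hdot x (g (tnth (in_tuple s) k)) = 0.
  rewrite /x hdot_suml big_enum /=.
  move/matrixP: (vM) => /(_ ord0 k); rewrite !mxE => h.
  by rewrite -[RHS]h; apply: eq_bigr => i _; rewrite hdotZl mxE.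
have T0 : T 0 = 0.
  by have := Tlin (-1) 0 0; rewrite scaler0 addr0 scaleN1r addNr.
have Tx : T x = \sum_(i <- enum 'I_j.+1) v ord0 i *: T (e i).
  rewrite /x; elim: (enum 'I_j.+1) => [|i l IH]; first by rewrite !big_nil.
  by rewrite !big_cons Tlin IH.
(* By [abs_eigen] the vectors [T (e i)] are orthogonal of norm [mu i], so on their span [T]
   stretches by at least [mu j]. *)
have nTx : nrm (T x) ^+ 2 = \sum_(i < j.+1) mu i ^+ 2 * nrm (v ord0 i) ^+ 2.
  apply: (@complexI R); rewrite -hdot_nrm {1}Tx hdot_suml big_enum rmorph_sum /=.
  apply: eq_bigr => i _; rewrite hdotZl (ee i (mup i)) (hdotC (e i)).
  rewrite (@hdot_sum_orthonormal _ (fun i : 'I_j.+1 => e i) _ (fun i => v ord0 i) i) //.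
    by rewrite mulrCA mul_conj_nrm -rmorphM.
  by rewrite mem_enum.
have := hT x xg; apply/negP; rewrite -ltNge.
rewrite -(ltr_pXn2r (ltn0Sn 1)) ?nnegrE ?mulr_ge0 ?nrm_ge0 // exprMn.
apply: (@lt_le_trans _ _ (mu j ^+ 2 * nrm x ^+ 2)).
  by rewrite ltr_pM2r // ltr_pXn2r ?nnegrE // ltW.
rewrite nTx nx mulr_sumr; apply: ler_sum => i _; rewrite ler_wpM2r ?sqr_ge0 //.
by rewrite ler_pXn2r ?nnegrE //; apply: mudec; rewrite -ltnS.
Qed.

(* When T has no singular value sequence, singular_value T is the zero sequence. *)
Lemma singular_value_le (T : H -> H) (lam : nat -> R) : (forall j, 0 <= lam j) ->
  (forall mu j, is_singular_values T mu -> mu j <= lam j) ->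
  forall j, 0 <= singular_value T j <= lam j.
Proof.
move=> lam0 h j; rewrite /singular_value; case: xgetP => [mu _ hmu|_].
  by rewrite (h _ _ hmu) andbT; case: hmu.
by rewrite lexx lam0.
Qed.

End HilbertBasics.

(** * Convergence of p-series *)

Section PSeries.
Variable R : realType.

(** Condensation: the terms with 2^K <= j + 1 < 2^(K+1) number 2^K and are at most 2^(-a K), so
    dyadic blocks are dominated by a geometric series of ratio [q]. The shift from j to j + 1 is the
    reason for the predecessors. *)
Lemma pseries_bounded (a : R) : 1 < a -> exists2 Z : R, 0 <= Z &
  forall N, \sum_(0 <= j < N) (j.+1%:R : R) `^ (- a) <= Z.
Proof.
move=> a1; pose q : R := 2 `^ (1 - a).
have q0 : 0 < q by rewrite powR_gt0.
have q1 : q < 1.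
  have -> : q = (2 `^ (a - 1))^-1 by rewrite -powRN /q; congr (_ `^ _); ring.
  rewrite invf_lt1 ?powR_gt0 //.
  have : 1 `^ (a - 1) < 2 `^ (a - 1) :> R by apply: gt0_ltr_powR; rewrite ?nnegrE ?ltr1n ?subr_gt0.
  by rewrite powR1.
have q1' : 0 < 1 - q by rewrite subr_gt0.
have f0 (j : nat) : 0 <= (j.+1%:R : R) `^ (- a) by exact: powR_ge0.
exists (1 - q)^-1; first by rewrite invr_ge0 ltW.
have dy K : \sum_(0 <= j < (2 ^ K).-1) (j.+1%:R : R) `^ (- a) <= (1 - q ^+ K) / (1 - q).
  elim: K => [|K IH]; first by rewrite big_geq // expr0 subrr mul0r.
  have p2 : (0 < 2 ^ K)%N by rewrite expn_gt0.
  have le1 : ((2 ^ K).-1 <= (2 ^ K.+1).-1)%N by rewrite expnS; lia.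
  rewrite (big_cat_nat (n := (2 ^ K).-1)) //=.
  have -> : (1 - q ^+ K.+1) / (1 - q) = (1 - q ^+ K) / (1 - q) + q ^+ K.
    by rewrite exprS; field; rewrite gt_eqF.
  apply: lerD => //.
  apply: (@le_trans _ _ (\sum_((2 ^ K).-1 <= j < (2 ^ K.+1).-1) ((2 ^ K)%:R : R) `^ (- a))).
    rewrite big_nat_cond [leRHS]big_nat_cond; apply: ler_sum => j /andP[/andP[hj _] _].
    rewrite !powRN lef_pV2 ?posrE ?powR_gt0 ?ltr0n //.
    by apply: ge0_ler_powR; rewrite ?nnegrE ?ler0n ?ler_nat; [lra|by []|by []|lia].
  rewrite sumr_const_nat -[leLHS]mulr_natr.
  have -> : ((2 ^ K.+1).-1 - (2 ^ K).-1 = 2 ^ K)%N by rewrite expnS; lia.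
  have t0 : (2 ^ K)%:R != 0 :> R by rewrite pnatr_eq0 -lt0n.
  have xe : (2 ^ K)%:R = 2 `^ K%:R :> R by rewrite natrX powR_mulrn.
  rewrite xe -powRrM -powRD ?pnatr_eq0 ?implybT // -[leRHS]powR_mulrn ?(ltW q0) // /q -powRrM.
  have -> : K%:R * - a + K%:R = (1 - a) * K%:R by ring.
  exact: lexx.
move=> N; apply: le_trans (_ : _ <= \sum_(0 <= j < (2 ^ N).-1) (j.+1%:R : R) `^ (- a)) _.
  have le1 : (N <= (2 ^ N).-1)%N by have := ltn_expl N (isT : (1 < 2)%N); lia.
  rewrite [leRHS](big_cat_nat (n := N)) //= lerDl; exact: sumr_ge0.
apply: le_trans (dy N) _; rewrite ler_pdivrMr // mulVf ?gt_eqF //.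
by rewrite gerBl exprn_ge0 // ltW.
Qed.

End PSeries.

Lemma fmap_ultra (X Y : Type) (f : X -> Y) (F : set_system X) :
  UltraFilter F -> UltraFilter (f @ F).
Proof.
move=> UF; split; first exact: fmap_proper_filter.
move=> G PG FG; rewrite eqEsubset; split => // A GA.
have [//|hA] := in_ultra_setVsetC (f @^-1` A) UF.
have /filter_ex[y [Ay nAy]] : G (A `&` ~` A) by apply: filterI => //; exact: FG.
by exfalso; apply: nAy.
Qed.

(** * Operators on L_2, their compactness and their singular values *)

Section L2Operators.
Variables (R : realType) (n : nat) (theta : 'M[R]_n) (T : nctorus theta).
Local Notation Zn := 'rV[int]_n.
Local Notation U k := (mono (@nc_gen R n theta T) k).
Local Notation H := (nc_L2 T).
Implicit Types (k l r : Zn) (s m A B t : R) (c d : Zn -> R[i]) (S : Zn -> T) (x y : H).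

Definition basis k : H := nc_emb (U k).

Definition hat x k : R[i] := hdot x (basis k).

Lemma basis_orthonormal k l : hdot (basis k) (basis l) = (k == l)%:R.
Proof. by rewrite /basis nc_emb_dot tr_mono_star. Qed.

Lemma hat_lin (z : R[i]) x y k : hat (z *: x + y) k = z * hat x k + hat y k.
Proof. by rewrite /hat hdotDl hdotZl. Qed.

Lemma hat_wb x : wb 0 (hat x) (nrm x).
Proof.
move=> K; under eq_bigr do rewrite powRr0 mul1r.
by apply: bessel; rewrite ?fset_uniq // => j k _ _; exact: basis_orthonormal.
Qed.

Lemma nrm_basis_sum (K : {fset Zn}) c :
  nrm (\sum_(k <- K) c k *: basis k) ^+ 2 = \sum_(k <- K) nrm (c k) ^+ 2.
Proof.
by apply: nrm_sum_orthonormal; rewrite ?fset_uniq // => j k _ _; exact: basis_orthonormal.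
Qed.

Lemma hsum_basis_bound c x B : 0 <= B -> hsum (fun k => c k *: basis k) x -> wb 0 c B ->
  nrm x <= B.
Proof.
move=> B0 hx hc; apply: hsum_bound hx _ => K.
rewrite -(ler_pXn2r (ltn0Sn 1)) ?nnegrE ?nrm_ge0 // nrm_basis_sum.
by apply: le_trans (hc K); apply: ler_sum => k _; rewrite powRr0 mul1r.
Qed.

Lemma hsum_basis_exists c B : wb 0 c B -> exists x, hsum (fun k => c k *: basis k) x.
Proof.
move=> hc; apply: hsum_cauchy => e e0.
have e20 : 0 < e / 2 by rewrite divr_gt0.
have [J hJ] := wb_tail (exprn_gt0 2 e20) hc.
exists J => K /hJ hK; apply: (@le_lt_trans _ _ (e / 2)); last first.
  by rewrite ltr_pdivrMr // ltr_pMr // ltr1n.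
rewrite -(ler_pXn2r (ltn0Sn 1)) ?nnegrE ?nrm_ge0 ?(ltW e20) // nrm_basis_sum.
by apply: le_trans hK; apply: ler_sum => k _; rewrite powRr0 mul1r.
Qed.

Lemma hat_hsum c x : hsum (fun k => c k *: basis k) x -> hat x = c.
Proof.
move=> hx; apply/funext => r.
have h : hsum (V := R[i]) (fun k => hat (c k *: basis k) r) (hat x r).
  apply: (hsum_linear (phi := fun y : H => hat y r : R[i]) (C := nrm (basis r))) hx.
  - by move=> a y y'; exact: hat_lin.
  - by move=> y; rewrite mulrC; exact: nrm_hdot.
apply: (hsum_unique h).
have := @hsum_fin R n R[i] [fset r]%fset (fun k => hat (c k *: basis k) r).
rewrite big_seq_fset1 /hat hdotZl basis_orthonormal eqxx mulr1; apply => k.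
by rewrite inE hdotZl basis_orthonormal => /negbTE ->; rewrite mulr0.
Qed.

Lemma hsum_basis_lin (z : R[i]) c c' x x' : hsum (fun k => c k *: basis k) x ->
  hsum (fun k => c' k *: basis k) x' ->
  hsum (fun k => (z * c k + c' k) *: basis k) (z *: x + x').
Proof.
move=> hx hx'; apply: hsum_ext (hsum_lin (c := z) hx hx') => k.
by rewrite scalerA scalerDl.
Qed.

Lemma emb_lin (z : R[i]) (a b : T) : nc_emb (z *: a + b) = z *: nc_emb a + nc_emb b.
Proof. exact: nc_emb_linear. Qed.

Lemma nrm_emb (a : T) : nrm (nc_emb a) <= nrm a.
Proof.
rewrite -(ler_pXn2r (ltn0Sn 1)) ?nnegrE ?nrm_ge0 //.
have := nrm_tr (a ** star a); rewrite -nc_emb_dot hdot_nrm nrm_real ger0_norm ?sqr_ge0 //.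
by move=> /le_trans; apply; apply: le_trans (nrm_cmul _ _) _; rewrite nrm_star.
Qed.

Lemma hat_emb (a : T) : hat (nc_emb a) = coef a.
Proof. by apply/funext => k; rewrite /hat /basis nc_emb_dot. Qed.

Lemma emb_hsum (a : T) : is_Cinf a -> hsum (fun k => coef a k *: basis k) (nc_emb a).
Proof.
move=> /CinfP[_ ha].
apply: hsum_ext (hsum_linear (phi := fun b : T => nc_emb b : H) (C := 1) _ _ ha).
- move=> k; rewrite -[_ *: U k]addr0 emb_lin /basis.
  have -> : nc_emb (0 : T) = 0 :> H.
    by have := emb_lin (-1) (0 : T) 0; rewrite scaler0 addr0 scaleN1r addNr.
  by rewrite addr0.
- by move=> z b b'; exact: emb_lin.
- by move=> b; rewrite mul1r nrm_emb.
Qed.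

Definition l2_op S : H -> H :=
  fun x => xget 0 [set y : H | hsum (fun r => mact S (hat x) r *: basis r) y].

Lemma l2_op_eq S x y : hsum (fun r => mact S (hat x) r *: basis r) y -> l2_op S x = y.
Proof.
by rewrite /l2_op => h; case: xgetP => [y' _ hy|/(_ y)//]; exact: hsum_unique hy h.
Qed.

Lemma hat_wb_neg s m x : s + m <= 0 -> wb (s + m) (hat x) (nrm x).
Proof. by move=> sm; apply: wb_weaken sm (hat_wb x). Qed.

Lemma zero_shift : `|0 : R| / 2 + n%:R <= n%:R :> R.
Proof. by rewrite normr0 mul0r add0r. Qed.

Lemma mact_hat m A S x : m <= 0 -> 0 <= A -> sb n%:R m A S ->
  wb 0 (mact S (hat x)) (schur_const n (0 : R) * A * nrm x).
Proof.
move=> m0 A0 hA; apply: (mact_wb A0 (nrm_ge0 x) zero_shift hA).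
by apply: hat_wb_neg; rewrite add0r.
Qed.

Lemma l2_op_hsum m S x : m <= 0 -> sclass m S ->
  hsum (fun r => mact S (hat x) r *: basis r) (l2_op S x).
Proof.
move=> m0 [_ /(_ n%:R)[A A0 hA]].
have [y hy] := hsum_basis_exists (mact_hat x m0 A0 hA).
by rewrite (l2_op_eq hy).
Qed.

Lemma l2_op_lin m S (z : R[i]) x y : m <= 0 -> sclass m S ->
  l2_op S (z *: x + y) = z *: l2_op S x + l2_op S y.
Proof.
move=> m0 hS; apply: l2_op_eq.
apply: hsum_ext (hsum_basis_lin (z := z) (l2_op_hsum (x := x) m0 hS) (l2_op_hsum (x := y) m0 hS)) => r.
congr (_ *: _).
have h0 : 0 + m <= 0 by rewrite add0r.
rewrite -(mact_linr z r (nrm_ge0 x) (nrm_ge0 y) hS (hat_wb_neg x h0) (hat_wb_neg y h0)).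
by congr mact; apply/funext => k; rewrite hat_lin.
Qed.

Lemma l2_op_linl m S S' (z : R[i]) : m <= 0 -> sclass m S -> sclass m S' ->
  l2_op (fun k => z *: S k + S' k) = z *: l2_op S + l2_op S'.
Proof.
move=> m0 hS hS'; apply/funext => x; rewrite -[RHS]/(z *: l2_op S x + l2_op S' x).
apply: l2_op_eq.
apply: hsum_ext (hsum_basis_lin (z := z) (l2_op_hsum (x := x) m0 hS) (l2_op_hsum (x := x) m0 hS')) => r.
congr (_ *: _); have h0 : 0 + m <= 0 by rewrite add0r.
by rewrite (mact_linl z r (nrm_ge0 x) hS hS' (hat_wb_neg x h0)).
Qed.

Lemma l2_op_emb m S (a : T) : sclass m S -> is_Cinf a ->
  l2_op S (nc_emb a) = nc_emb (lattice_op S a).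
Proof.
move=> hS ha; have [h1 e1] := lattice_opP hS ha; apply: l2_op_eq.
by rewrite hat_emb -e1; exact: emb_hsum.
Qed.

Lemma jap_notin_box (L : nat) r : r \notin box n L -> (L.+1%:R : R) ^+ 2 <= jap R r.
Proof.
move=> rL; have [j hj] : exists j, (L < `|r ord0 j|)%N.
  apply: contrapT => h; move/negP: rL; apply; apply: mem_box => j.
  by rewrite leqNgt; apply/negP => hj; apply: h; exists j.
apply: le_trans (coord_sqr_le R r j).
rewrite -[leRHS]real_normK ?num_real // -intr_norm lerXn2r ?nnegrE ?ler0n //.
by rewrite -abszE -[leRHS]/((`|r ord0 j|%N)%:R) ler_nat.
Qed.

(* Rellich: a ball of a positive-order Sobolev space is compact in L_2. *)
Lemma sobolev_ball_compact t (C : R) : 0 < t -> 0 <= C ->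
  compact [set x : H | hsum (fun r => hat x r *: basis r) x /\ wb t (hat x) C].
Proof.
move=> t0 C0; rewrite compact_ultra => F UF FA.
have bd x r : wb t (hat x) C -> nrm (hat x r) <= C.
  move=> h; apply: le_trans (wb_point r C0 h).
  rewrite -[leLHS]mul1r ler_wpM2r ?nrm_ge0 //.
  by rewrite -[leLHS](powRr0 (jap R r)); apply: jap_powR_le; rewrite divr_ge0 // ltW.
(* Along an ultrafilter every bounded coefficient converges. The limits satisfy the same weighted
   bound, and norm convergence follows by splitting at a box: finitely many coefficients inside, a
   uniformly small tail outside. *)
have lim r : exists d : R[i], (fun x => hat x r) @ F --> d.
  have := @square_compact R 0 C; rewrite compact_ultra.
  move=> /(_ ((fun x => hat x r) @ F)) /= h; have [|| d [_ hd]] := h _; last by exists d.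
  - exact: fmap_ultra.
  apply: filterS FA => x [_ /(bd x r) hx] /=; rewrite subr0.
  by split; apply: le_trans hx; [exact: abs_Re_le|exact: abs_Im_le].
have [d hd] := choice lim.
have hdw : wb t d C.
  move=> K; pose G x := \sum_(r <- K) jap R r `^ t * nrm (hat x r) ^+ 2.
  have key : G @ F --> \sum_(r <- K) jap R r `^ t * nrm (d r) ^+ 2.
    rewrite /G; apply: cvg_big => [|r _]; first exact: (@add_continuous R).
    apply: cvgM; first exact: cvg_cst.
    rewrite expr2; under eq_fun do rewrite expr2.
    by apply: cvgM; exact: cvg_nrm.
  apply: (closed_cvg (fun z => z <= C ^+ 2)) key; first exact: closed_le.
  by apply: filterS FA => x [_ hx]; exact: hx.
have hd0 : wb 0 d C := wb_weaken (ltW t0) hdw.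
have [y hy] := hsum_basis_exists hd0.
have ey := hat_hsum hy.
exists y; split; first by rewrite /= ey.
apply/cvg_nrmP => e e0.
(* Outside the box jap^t >= 64 (C^2 + 1) / e^2, so a sequence of weighted norm 4 C has squared tail
   at most e^2 / 4; the [+ 1] covers C = 0. *)
have [L hL] := @nat_above R ((64 * (C ^+ 2 + 1) / e ^+ 2) `^ (2 * t)^-1).
have e2 : 0 < e ^+ 2 by exact: exprn_gt0.
have Ltail r : r \notin box n L -> jap R r `^ (- t) * (4 * C) ^+ 2 <= e ^+ 2 / 4.
  move=> /jap_notin_box hj.
  have X0 : 0 <= 64 * (C ^+ 2 + 1) / e ^+ 2.
    by apply: divr_ge0 (ltW e2); have := sqr_ge0 C; lra.
  have hX : 64 * (C ^+ 2 + 1) / e ^+ 2 <= jap R r `^ t.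
    apply: (@le_trans _ _ ((L.+1%:R ^+ 2) `^ t)); last first.
      apply: ge0_ler_powR; rewrite ?nnegrE ?sqr_ge0 ?(ltW t0) //; exact/ltW/jap_gt0.
    rewrite -(powR_mulrn 2 (ler0n R L.+1)) -powRrM.
    have -> : 64 * (C ^+ 2 + 1) / e ^+ 2 = ((64 * (C ^+ 2 + 1) / e ^+ 2) `^ (2 * t)^-1) `^ (2%:R * t).
      by rewrite -powRrM mulVf ?powRr1 // gt_eqF // mulr_gt0.
    apply: ge0_ler_powR; rewrite ?nnegrE ?powR_ge0 ?mulr_ge0 ?(ltW t0) //.
    by apply: le_trans hL _; rewrite ler_nat.
  have jp : 0 < jap R r `^ t by rewrite powR_gt0 ?jap_gt0.
  rewrite powRN mulrC ler_pdivrMr // mulrC.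
  rewrite ler_pdivrMr // in hX.
  by have := sqr_ge0 C; nra.
pose M : R := (size (box n L)).+1%:R; have M0 : 0 < M by rewrite ltr0n.
(* At most [M] coefficients, each off by less than [eta], contribute at most e^2 / (4 M) <= e^2 /
   4. *)
pose eta := e / (2 * M); have eta0 : 0 < eta by rewrite divr_gt0 // mulr_gt0.
have near_box : F [set x : H | forall r, [set` box n L] r -> nrm (hat x r - d r) < eta].
  apply: (@filter_finite _ _ F (fun r x => nrm (hat x r - d r) < eta)).
    exact: finite_seq.
  by move=> r _; move: (hd r) => /cvg_nrmP/(_ eta eta0).
apply: filterS2 FA near_box => x [hx hxw] hn.
(* Box and tail add up to e^2 / 2, below (3 / 4)^2 e^2; a factor less than 1 gives the strict
   inequality. *)
have hdiff : wb 0 (fun r => (-1) * d r + hat x r) (3 / 4 * e).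
  move=> K; rewrite (bigID (fun r => r \in box n L)) /=.
  have b1 : \sum_(r <- K | r \in box n L) jap R r `^ 0 * nrm (-1 * d r + hat x r) ^+ 2 <= e ^+ 2 / 4.
    rewrite -big_filter.
    apply: (@le_trans _ _ (\sum_(r <- [seq r <- K | r \in box n L]) eta ^+ 2)).
      rewrite big_seq [leRHS]big_seq; apply: ler_sum => r; rewrite mem_filter => /andP[rb _].
      rewrite powRr0 mul1r mulN1r addrC ler_pXn2r ?nnegrE ?nrm_ge0 ?(ltW eta0) //.
      exact/ltW/hn.
    rewrite big_const_seq count_predT iter_addr_0 -[leLHS]mulr_natr.
    have sz : (size [seq r <- K | r \in box n L] <= size (box n L))%N.
      apply: uniq_leq_size; first by rewrite filter_uniq ?fset_uniq.
      by move=> r; rewrite mem_filter => /andP[].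
    have {}sz : (size [seq r <- K | r \in box n L])%:R <= M :> R.
      by rewrite /M ler_nat ltnW.
    apply: (@le_trans _ _ (eta ^+ 2 * M)); first by rewrite ler_wpM2l ?sqr_ge0.
    have -> : eta ^+ 2 * M = e ^+ 2 / 4 / M by rewrite /eta; field; rewrite gt_eqF.
    by rewrite ler_pdivrMr // ler_peMr ?divr_ge0 ?sqr_ge0 // /M ler1n.
  have b2 : \sum_(r <- K | r \notin box n L) jap R r `^ 0 * nrm (-1 * d r + hat x r) ^+ 2 <= e ^+ 2 / 4.
    have hw := wb_lin (-1) C0 C0 hdw hxw.
    have {}hw : wb t (fun r => -1 * d r + hat x r) (4 * C).
      apply: wb_le hw; rewrite nrmN nrm_cst1 mul1r; first by rewrite mulr_ge0 ?addr_ge0.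
      by rewrite (_ : 2 * (C + C) = 4 * C) //; ring.
    have [C00|C1] := eqVneq C 0.
      rewrite big1 ?divr_ge0 ?sqr_ge0 // => r _.
      have := wb_point r (_ : 0 <= 4 * C) hw; rewrite C00 mulr0 lexx => /(_ isT).
      rewrite pmulr_rle0 ?powR_gt0 ?jap_gt0 // => h.
      have -> : nrm (-1 * d r + hat x r) = 0 by apply/eqP; rewrite eq_le h nrm_ge0.
      by rewrite expr0n mulr0.
    have C4 : 0 < (4 * C) ^+ 2 by rewrite exprn_gt0 // mulr_gt0 // lt_def C1.
    apply: (@le_trans _ _ (\sum_(r <- K | r \notin box n L)
       (e ^+ 2 / 4 / (4 * C) ^+ 2) * (jap R r `^ t * nrm (-1 * d r + hat x r) ^+ 2))).
      apply: ler_sum => r rb; rewrite powRr0 mul1r mulrA -[leLHS]mul1r ler_wpM2r ?sqr_ge0 //.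
      have jp : 0 < jap R r `^ t by rewrite powR_gt0 ?jap_gt0.
      have := Ltail r rb; rewrite powRN mulrC ler_pdivrMr // => h.
      by rewrite mulrAC ler_pdivlMr // mul1r.
    have hs : \sum_(r <- K | r \notin box n L) jap R r `^ t * nrm (-1 * d r + hat x r) ^+ 2 <= (4 * C) ^+ 2.
      apply: le_trans (hw K); rewrite [leRHS](bigID (fun r => r \in box n L)) /= lerDr.
      by apply: sumr_ge0 => r _; rewrite mulr_ge0 ?powR_ge0 ?sqr_ge0.
    rewrite -mulr_sumr; apply: le_trans (ler_wpM2l _ hs) _.
      by rewrite !divr_ge0 ?sqr_ge0.
    by rewrite divfK // gt_eqF.
  apply: le_trans (lerD b1 b2) _; rewrite exprMn; lra.
have e34 : 0 <= 3 / 4 * e by rewrite mulr_ge0 // ltW.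
have := hsum_basis_bound e34 (hsum_basis_lin (z := -1) hy hx) hdiff.
rewrite scaleN1r addrC => /le_lt_trans; apply; lra.
Qed.

(** An operator of order m < 0 maps the unit ball of L_2 into a ball of W_2^(-m), whose order is
    positive, and [sobolev_ball_compact] applies. *)
Lemma l2_op_compact m S : m < 0 -> sclass m S -> compact_op (l2_op S).
Proof.
move=> m0 hS; have m0' := ltW m0.
split; first by move=> a x y; exact: l2_op_lin hS.
  have [_ /(_ n%:R)[A A0 hA]] := hS.
  move=> x; apply/cvg_nrmP => e e0.
  pose D := schur_const n (0 : R) * A + 1.
  have D0 : 0 < D by rewrite ltr_wpDl // mulr_ge0 ?schur_const_ge0.
  apply/nbhs_nrmP; exists (e / D); first by rewrite divr_gt0.
  move=> y hy.
  have -> : l2_op S y - l2_op S x = l2_op S ((-1 : R[i]) *: x + y).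
    by rewrite (l2_op_lin _ _ _ m0' hS) scaleN1r addrC.
  have -> : (-1 : R[i]) *: x + y = y - x by rewrite scaleN1r addrC.
  apply: le_lt_trans (hsum_basis_bound _ (l2_op_hsum m0' hS) (mact_hat _ m0' A0 hA)) _.
    by rewrite !mulr_ge0 ?schur_const_ge0 ?nrm_ge0.
  rewrite ltr_pdivlMr // mulrC in hy; apply: le_lt_trans hy.
  by rewrite ler_wpM2r ?nrm_ge0 // lerDl.
have [_ /(_ (`|- m| / 2 + n%:R))[A A0 hA]] := hS.
have C0 : 0 <= schur_const n (- m) * A * 1 by rewrite !mulr_ge0 ?schur_const_ge0.
have t0 : 0 < - m by rewrite oppr_gt0.
apply: (@precompact_subset _ _ [set x : H | hsum (fun r => hat x r *: basis r) x /\
   wb (- m) (hat x) (schur_const n (- m) * A * 1)]); last first.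
  apply: compact_precompact; first exact: norm_hausdorff.
  exact: sobolev_ball_compact.
move=> _ [x hx <-]; have hx1 : nrm x <= 1 by rewrite -nrm_le.
have h := l2_op_hsum (x := x) m0' hS; rewrite /= (hat_hsum h); split => //.
apply: (mact_wb A0 ler01 (lexx _) hA); rewrite addNr.
exact: wb_le (nrm_ge0 x) hx1 (hat_wb x).
Qed.

(** Where the coefficients of [x] live, [jap] is at least (L + 1)^2, so the W_2^m norm of [x] is at
    most (L + 1)^m times its L_2 norm. *)
Lemma l2_op_offbox m A S (L : nat) x : m < 0 -> 0 <= A -> sclass m S -> sb n%:R m A S ->
  (forall r, r \in box n L -> hat x r = 0) ->
  nrm (l2_op S x) <= schur_const n (0 : R) * A * (L.+1%:R `^ m) * nrm x.
Proof.
move=> m0 A0 hS hA hx.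
have B0 : 0 <= L.+1%:R `^ m * nrm x by rewrite mulr_ge0 ?powR_ge0 ?nrm_ge0.
have hw : wb (0 + m) (hat x) (L.+1%:R `^ m * nrm x).
  move=> K; rewrite add0r.
  apply: (@le_trans _ _ (\sum_(r <- K) (L.+1%:R `^ m) ^+ 2 * nrm (hat x r) ^+ 2)).
    apply: ler_sum => r _; have [rb|rb] := boolP (r \in box n L).
      by rewrite hx // nrm0 expr0n !mulr0.
    rewrite ler_wpM2r ?sqr_ge0 // -powR_mulrn ?powR_ge0 // -powRrM mulrC powRrM powR_mulrn //.
    have hj := jap_notin_box rb.
    have -> : jap R r `^ m = (jap R r `^ (- m))^-1 by rewrite -powRN opprK.
    have -> : (L.+1%:R ^+ 2) `^ m = ((L.+1%:R ^+ 2) `^ (- m))^-1 :> R by rewrite -powRN opprK.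
    rewrite lef_pV2 ?posrE ?powR_gt0 ?exprn_gt0 ?ltr0n ?jap_gt0 //.
    apply: ge0_ler_powR; rewrite ?nnegrE ?sqr_ge0 ?oppr_ge0 ?(ltW m0) //; exact/ltW/jap_gt0.
  rewrite -mulr_sumr exprMn ler_wpM2l ?sqr_ge0 //.
  by apply: le_trans (hat_wb x K); apply: ler_sum => r _; rewrite powRr0 mul1r.
have h := mact_wb A0 B0 zero_shift hA hw.
rewrite -(mulrA _ (_ `^ _)).
apply: hsum_basis_bound (l2_op_hsum (ltW m0) hS) h.
by rewrite !mulr_ge0 ?schur_const_ge0 ?powR_ge0 ?nrm_ge0.
Qed.

Lemma l2_op_nrm m A S x : m <= 0 -> 0 <= A -> sclass m S -> sb n%:R m A S ->
  nrm (l2_op S x) <= schur_const n (0 : R) * A * nrm x.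
Proof.
move=> m0 A0 hS hA.
apply: hsum_basis_bound (l2_op_hsum m0 hS) (mact_hat x m0 A0 hA).
by rewrite !mulr_ge0 ?schur_const_ge0 ?nrm_ge0.
Qed.

Lemma l2_op_singular m A S : (0 < n)%N -> m < 0 -> 0 <= A -> sclass m S -> sb n%:R m A S ->
  forall j, 0 <= singular_value (l2_op S) j
    <= schur_const n (0 : R) * A * 3 `^ (- m) * j.+1%:R `^ (m / n%:R).
Proof.
move=> n0 m0 A0 hS hA.
have D0 : 0 <= schur_const n (0 : R) * A by rewrite mulr_ge0 ?schur_const_ge0.
have h31 : 1 <= (3 : R) `^ (- m).
  by rewrite -[leLHS](powRr0 (3 : R)); apply: ler_powR; rewrite ?ler1n // oppr_ge0 ltW.
apply: singular_value_le => [j|mu j hmu]; first by rewrite !mulr_ge0 ?powR_ge0.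
have lin a x y : l2_op S (a *: x + y) = a *: l2_op S x + l2_op S y by exact: l2_op_lin (ltW m0) hS.
(* For j = 0 not even the box of one monomial is allowed, and the operator norm is used. For j > 0,
   [L] is the largest with (2 L + 1)^n <= j; maximality gives j + 1 <= (2 L + 3)^n <= (3 (L + 1))^n,
   hence the factor 3^(-m). *)
have [j0|j1] := posnP j.
  apply: (@le_trans _ _ (schur_const n (0 : R) * A)); last first.
    by rewrite j0 powR1 mulr1 ler_peMr.
  apply: (singular_values_le (s := [::] : seq Zn) (g := basis) lin hmu) => // x _.
  exact: l2_op_nrm (ltW m0) A0 hS hA.
have hex : exists L, ((L + L).+1 ^ n <= j)%N by exists 0%N; rewrite exp1n.
have hub L : ((L + L).+1 ^ n <= j)%N -> (L <= j)%N.
  apply: leq_trans; apply: (@leq_trans ((L + L).+1 ^ 1)); first by rewrite expn1; lia.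
  by rewrite leq_pexp2l.
have [L hL hmax] := ex_maxnP hex hub.
have hj : (j < (L.+1 + L.+1).+1 ^ n)%N.
  by rewrite ltnNge; apply/negP => /hmax; rewrite ltnn.
apply: (@le_trans _ _ (schur_const n (0 : R) * A * L.+1%:R `^ m)).
  apply: (singular_values_le (s := box n L) (g := basis) lin hmu).
  - by rewrite size_box.
  - by rewrite mulr_ge0 ?powR_ge0.
  move=> x hx; apply: l2_op_offbox => // r rb.
  have /(nthP r)[i isz <-] := rb.
  by have := hx (Ordinal isz); rewrite (tnth_nth r).
rewrite -[leRHS]mulrA ler_wpM2l //.
have nn : n%:R != 0 :> R by rewrite pnatr_eq0 -lt0n.
have base : j.+1%:R <= (3 * L.+1%:R) `^ n%:R :> R.
  rewrite powR_mulrn ?mulr_ge0 // -natrM -natrX ler_nat.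
  apply: leq_trans hj _; rewrite leq_exp2r //; lia.
have -> : L.+1%:R `^ m = 3 `^ (- m) * ((3 * L.+1%:R) `^ n%:R) `^ (m / n%:R) :> R.
  rewrite -powRrM (mulrC n%:R) divfK // powRM // mulrA -powRD ?pnatr_eq0 ?implybT // addNr powRr0 mul1r //.
rewrite ler_wpM2l ?powR_ge0 //.
have mn : m / n%:R = - (- m / n%:R) by ring.
rewrite mn !(powRN _ (- m / n%:R)) lef_pV2 ?posrE ?powR_gt0 ?mulr_gt0 ?ltr0n //.
by apply: ge0_ler_powR; rewrite ?nnegrE ?powR_ge0 ?divr_ge0 ?oppr_ge0 ?(ltW m0).
Qed.

End L2Operators.

(** * Schatten and weak Schatten classes *)

Section SchattenBounds.
Variables (R : realType) (H : hilbertType R).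
Implicit Types (S : H -> H) (p b D Z : R).

Lemma weak_schatten_norm_le S p D :
  (forall j, singular_value S j <= D * j.+1%:R `^ (- p^-1)) ->
  (ereal_sup [set ((j.+1%:R `^ p^-1) * singular_value S j)%:E | j in [set: nat]] <= D%:E)%E.
Proof.
move=> h; apply: ge_ereal_sup => _ [j _ <-]; rewrite lee_fin.
apply: le_trans (ler_wpM2l (powR_ge0 _ _) (h j)) _.
by rewrite mulrCA powRN divff ?mulr1 // gt_eqF // powR_gt0.
Qed.

Lemma schatten_sum_le S p b D Z : 0 < p -> 0 <= D ->
  (forall j, 0 <= singular_value S j <= D * j.+1%:R `^ (- b)) ->
  (forall N, \sum_(0 <= j < N) (j.+1%:R : R) `^ (- (b * p)) <= Z) ->
  (schatten_sum p S <= (D `^ p * Z)%:E)%E.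
Proof.
move=> p0 D0 hS hZ; apply: lime_le.
  by apply: is_cvg_nneseries => j _ _; rewrite lee_fin powR_ge0.
apply: nearW => N; rewrite sumEFin lee_fin.
apply: le_trans (ler_wpM2l (powR_ge0 _ _) (hZ N)); rewrite mulr_sumr.
apply: ler_sum => j _; have /andP[s0 s1] := hS j.
rewrite -mulNr powRrM -powRM ?powR_ge0 //.
by apply: ge0_ler_powR; rewrite ?nnegrE ?mulr_ge0 ?powR_ge0 // ltW.
Qed.

End SchattenBounds.

Section HilbertSpaceOperators.
Variables (R : realType) (n : nat) (theta : 'M[R]_n) (T : nctorus theta).
Local Notation H := (nc_L2 T).

(** [Phi] is the identity in both applications and only carries operators into the module underlying
    [F]. The order [m] is chosen near each point, as the strict case demands. *)
Lemma holomorphic_l2_op (F : gauged R) (Phi : (H -> H) -> F) (Om : set R[i]) w rho :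
  open Om -> holomorphic_symbols (T := T) Om w rho ->
  (forall (a : R[i]) X Y, Phi (a *: X + Y) = a *: Phi X + Phi Y) ->
  (forall z0, Om z0 -> exists m d : R,
     [/\ m < 0, 0 < d, forall z, nrm (z - z0) < d -> complex.Re (w z) <= m,
       forall S, sclass m S -> gdom F (Phi (l2_op S)) &
       forall p, gauges F p -> exists2 C : R, 0 <= C & forall S A, 0 <= A ->
         sclass m S -> sb n%:R m A S -> (p (Phi (l2_op S)) <= (C * A)%:E)%E]) ->
  holomorphic Om (fun z => Phi (l2_op (lattice_symbol rho z))).
Proof.
move=> hOm hrho hPhi h; split=> [z Oz|z0 Oz0].
  have [m [d [m0 d0 hw hd _]]] := h z Oz; apply: hd.
  exact: (symbol_sclass hOm hrho Oz d0 hw).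
have [m [d [m0 d0 hw hd hg]]] := h z0 Oz0.
apply: (@holomorphic_quantization R n theta T Om hOm w rho hrho F
  (fun S => Phi (l2_op S)) _ z0 m d Oz0 d0 hw) => //.
- by move=> a S S' hS hS'; rewrite (l2_op_linl a (ltW m0) hS hS') hPhi.
- by move=> p gp; exists n%:R; exact: hg.
Qed.

Lemma psidos_l2_op (Om : set R[i]) w (P : R[i] -> T -> T) rho :
  open Om -> holomorphic_symbols Om w rho -> (forall z, Om z -> P z = psido (rho z)) ->
  forall z a, Om z -> is_Cinf a ->
    l2_op (lattice_symbol rho z) (nc_emb a) = nc_emb (P z a) :> H.
Proof.
move=> hOm hrho hP z a Oz ha; have [hw _ _ _] := hrho.
have [d d0 hd] := holomorphic_scalar_bounded hw Oz ltr01.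
by rewrite (l2_op_emb (symbol_sclass hOm hrho Oz d0 hd) ha) hP.
Qed.

Lemma holomorphic_weak_schatten (Om : set R[i]) w (P : R[i] -> T -> T) (m : R) :
  (0 < n)%N -> open Om -> holomorphic_psidos Om w P -> m < 0 ->
  (forall z, Om z -> complex.Re (w z) <= m) ->
  exists Q : R[i] -> H -> H,
    (forall z a, Om z -> is_Cinf a -> Q z (nc_emb a) = nc_emb (P z a)) /\
    @holomorphic R Om (weak_schatten H (n%:R * `|m|^-1)) Q.
Proof.
move=> n0 hOm [rho hrho hP] m0 hm.
have nn : 0 < n%:R :> R by rewrite ltr0n.
have pE : (n%:R * `|m|^-1)^-1 = - (m / n%:R) by rewrite invfM invrK ltr0_norm // mulrC mulNr.
exists (fun z => l2_op (lattice_symbol rho z)); split; first exact: (psidos_l2_op hOm hrho hP).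
apply: (@holomorphic_l2_op (weak_schatten H (n%:R * `|m|^-1)) id _ w) => // z0 Oz0.
have [d d0 hd] := open_ball hOm Oz0.
exists m, d; split=> // [z /hd|S hS|_ ->]; first exact: hm.
  split; first exact: l2_op_compact hS.
  have [_ /(_ n%:R)[A A0 hA]] := hS.
  exists (schur_const n (0 : R) * A * 3 `^ (- m)) => j j0.
  (* The class is defined with j for j > 0, the bound has j + 1; the exponent being negative, the
     latter is stronger. *)
  have /andP[_ /le_trans] := l2_op_singular n0 m0 A0 hS hA j; apply.
  apply: ler_wpM2l; first by rewrite !mulr_ge0 ?schur_const_ge0 ?powR_ge0.
  rewrite pE -[X in _ `^ X <= _]opprK !(powRN _ (- (m / n%:R))) lef_pV2 ?posrE ?powR_gt0 ?ltr0n //.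
  apply: ge0_ler_powR; rewrite ?nnegrE ?ler0n ?ler_nat //.
  by rewrite -mulNr divr_ge0 // oppr_ge0 ltW.
exists (schur_const n (0 : R) * 3 `^ (- m)).
  by rewrite mulr_ge0 ?schur_const_ge0 ?powR_ge0.
move=> S A A0 hS hA; apply: weak_schatten_norm_le => j; rewrite pE opprK (mulrAC _ _ A).
by have /andP[] := l2_op_singular n0 m0 A0 hS hA j.
Qed.

Lemma holomorphic_schatten (Om : set R[i]) w (P : R[i] -> T -> T) (m : R) :
  (0 < n)%N -> open Om -> holomorphic_psidos Om w P -> m < 0 ->
  (forall z, Om z -> complex.Re (w z) < m) ->
  exists Q : R[i] -> H -> H,
    (forall z a, Om z -> is_Cinf a -> Q z (nc_emb a) = nc_emb (P z a)) /\
    @holomorphic R Om (schatten H (n%:R * `|m|^-1)) Q.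
Proof.
move=> n0 hOm [rho hrho hP] m0 hm; have [hw _ _ _] := hrho.
have nn : 0 < n%:R :> R by rewrite ltr0n.
set p := n%:R * `|m|^-1.
have p0 : 0 < p by rewrite mulr_gt0 // invr_gt0 normr_gt0 ltr0_neq0.
exists (fun z => l2_op (lattice_symbol rho z)); split; first exact: (psidos_l2_op hOm hrho hP).
apply: (@holomorphic_l2_op (schatten H p) id _ w) => // z0 Oz0.
(* Half the gap, so [m'] is the midpoint of Re w(z0) and [m]. *)
pose eta := (m - complex.Re (w z0)) / 2.
have eta0 : 0 < eta by rewrite divr_gt0 // subr_gt0 hm.
have [d d0 hd] := holomorphic_scalar_bounded hw Oz0 eta0.
set m' := complex.Re (w z0) + eta in hd.
have mm' : m' < m by have := hm z0 Oz0; rewrite /m' /eta; lra.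
have m'0 : m' < 0 := lt_trans mm' m0.
(* Since p = n / |m|, the powers mu_j^p decay with exponent m' / m, which exceeds 1 because m' < m <
   0. *)
have bp : 1 < (- (m' / n%:R)) * p.
  have -> : (- (m' / n%:R)) * p = m' / m.
    by rewrite /p ltr0_norm //; field; rewrite (gt_eqF nn) (lt_eqF m0).
  by rewrite ltr_ndivlMr // mul1r.
have [Z Z0 hZ] := pseries_bounded bp.
have key S A : 0 <= A -> sclass m' S -> sb n%:R m' A S ->
    (schatten_sum p (l2_op S : H -> H) <=
      ((schur_const n (0 : R) * A * 3 `^ (- m')) `^ p * Z)%:E)%E.
  move=> A0 hS hA; apply: schatten_sum_le hZ => //.
    by rewrite !mulr_ge0 ?schur_const_ge0 ?powR_ge0.
  by move=> j; rewrite opprK; exact: l2_op_singular.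
exists m', d; split=> // [S hS|_ ->].
  split; first exact: l2_op_compact hS.
  have [_ /(_ n%:R)[A A0 hA]] := hS.
  exact: le_lt_trans (key S A A0 hS hA) (ltry _).
(* Taking the p-th root of D^p Z gives D Z^(1/p), which is linear in the symbol bound [A], as
   required. *)
exists (schur_const n (0 : R) * 3 `^ (- m') * Z `^ p^-1).
  by rewrite !mulr_ge0 ?schur_const_ge0 ?powR_ge0.
move=> S A A0 hS hA.
have D0 : 0 <= schur_const n (0 : R) * A * 3 `^ (- m').
  by rewrite !mulr_ge0 ?schur_const_ge0 ?powR_ge0.
have s0 : (0 <= schatten_sum p (l2_op S : H -> H))%E.
  by apply: nneseries_ge0 => j _ _; rewrite lee_fin powR_ge0.
have pV : 0 <= p^-1 by rewrite invr_ge0 ltW.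
apply: le_trans (gt0_ler_poweR pV _ _ (key S A A0 hS hA)) _.
- by rewrite in_itv /= s0 leey.
- by rewrite in_itv /= leey lee_fin mulr_ge0 ?powR_ge0.
rewrite poweR_EFin lee_fin powRM ?powR_ge0 // -powRrM divff ?gt_eqF // powRr1 //.
by rewrite [leRHS]mulrAC (mulrAC (schur_const n (0 : R))).
Qed.

End HilbertSpaceOperators.

Theorem proposition1 (R : realType) (n : nat) (hn : (2 <= n)%N)
    (theta : 'M[R]_n) (htheta : theta^T = - theta) (T : nctorus theta)
    (Om : set R[i]) (hOm : open Om) (w : R[i] -> R[i])
    (P : R[i] -> T -> T) (hP : holomorphic_psidos Om w P) :
  [/\ @holomorphic R Om (Lin (Cinf T) (Cinf T)) P,
      (forall m : R, (forall z, Om z -> complex.Re (w z) <= m) ->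
       forall s : R, exists Q : R[i] -> distr T -> distr T,
         (forall z a, Om z -> is_Cinf a ->
            Q z (distr_of a) = distr_of (P z a)) /\
         @holomorphic R Om (Lin (sobolev T (s + m)) (sobolev T s)) Q) &
      (forall m : R, m < 0 ->
         ((forall z, Om z -> complex.Re (w z) < m) ->
          exists Q : R[i] -> nc_L2 T -> nc_L2 T,
            (forall z a, Om z -> is_Cinf a ->
               Q z (nc_emb a) = nc_emb (P z a)) /\
            @holomorphic R Om (schatten (nc_L2 T) (n%:R * `|m|^-1)) Q) /\
         ((forall z, Om z -> complex.Re (w z) <= m) ->
          exists Q : R[i] -> nc_L2 T -> nc_L2 T,
            (forall z a, Om z -> is_Cinf a ->
               Q z (nc_emb a) = nc_emb (P z a)) /\
            @holomorphic R Om (weak_schatten (nc_L2 T) (n%:R * `|m|^-1)) Q))].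
Proof.
have n0 : (0 < n)%N by exact: ltnW hn.
split; first exact: holomorphic_smooth hOm hP.
  by move=> m hm s; exact: holomorphic_sobolev hOm hP hm s.
move=> m m0; split=> hm; first exact: holomorphic_schatten hP m0 hm.
exact: holomorphic_weak_schatten hP m0 hm.
Qed.
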